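(* Let $u$ be the function on $\mathbb{R}\times(0,\infty)$ defined by $$u(x,t)=\begin{cases}\bar u(x,t)=h(x-y(x,t),t)e^{\beta(t)}, & \text{if } y_*(x,t)=y^*(x,t)=:y(x,t),\\[1ex](f')^{-1}\!\left(\dfrac{f(\bar u(x+,t))-f(\bar u(x-,t))}{\bar u(x+,t)-\bar u(x-,t)}\right), & \text{if } y_*(x,t)\neq y^*(x,t).\end{cases}$$ Then the function $$R(x,t)=\int_0^{y_*(x,t)}\rho_0(y)\,dy$$ is a weak solution of $R_t+f'(u)R_x=0$ in $\mathbb{R}\times(0,\infty)$ with initial condition $R(x,0)=\int_0^x\rho_0(z)\,dz$.
   Context: Standing assumptions: $f\in C^2(\mathbb{R};\mathbb{R})$ is strictly convex with superlinear growth, i.e. $\lim_{|v|\to\infty}f(v)/|v|=\infty$; $\alpha\in L^\infty([0,\infty);\mathbb{R})$; $u_0,\rho_0:\mathbb{R}\to\mathbb{R}$ are bounded measurable functions. Put $\beta(t)=\int_0^t\alpha(s)\,ds$. The Legendre transform of $f$ is $f^*(p)=\sup_{v\in\mathbb{R}}\{pv-f(v)\}$. The function $h:\mathbb{R}\times(0,\infty)\to\mathbb{R}$ is defined as follows: $h(x,t)$ is the unique $q\in\mathbb{R}$ with $\int_0^t f'(q\,e^{\beta(\theta)})\,d\theta=x$. For $x,y\in\mathbb{R}$, $t>0$ put $$F(x,y,t)=\int_0^t f^*\big(f'(h(x-y,t)e^{\beta(\theta)})\big)e^{-\beta(\theta)}\,d\theta+\int_0^y u_0(z)\,dz,$$ and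 let $y_*(x,t)$ and $y^*(x,t)$ be the smallest and the largest minimizer of $F(x,\cdot,t)$ over $\mathbb{R}$. When they coincide, their common value is denoted $y(x,t)$, and $\bar u(x,t)=h(x-y(x,t),t)e^{\beta(t)}$; for fixed $t>0$ this is defined for all but countably many $x$, and $\bar u(x\pm,t)$ denote its right and left limits in the variable $x$. Weak solution: a function $R\in L^\infty_{loc}(\mathbb{R}\times(0,\infty))$ with $R(\cdot,t)\in BV_{loc}(\mathbb{R})$ for each $t>0$ is a weak solution of $R_t+f'(u)R_x=0$ with initial condition $R_0(x)=\int_0^x\rho_0(z)\,dz$ if $$\int_0^\infty\int_{-\infty}^\infty R\,\phi_t\,dx\,dt-\int_0^\infty\int_{-\infty}^\infty f'(u(x,t))\,\phi(x,t)\,dR(x)\,dt=0\quad\text{for all }\phi\in C_c^\infty(\mathbb{R}\times(0,\infty)),$$ and $\|R(\cdot,t)-R_0\|_\infty\to0$ as $t\to0$. Here $dR(x)$ is the Lebesgue–Stieltjes measure of $x\mapsto R(x,t)$ for fixed $t$. *)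

(* Defs.v *)
From HB Require Import structures.
From mathcomp Require Import all_boot all_order all_algebra.
From mathcomp Require Import all_classical all_reals all_analysis.
From mathcomp Require Import measurable_realfun.

Set Implicit Arguments.
Unset Strict Implicit.
Unset Printing Implicit Defensive.
Import Order.TTheory GRing.Theory Num.Theory.
Import numFieldNormedType.Exports.

Local Open Scope classical_set_scope.
Local Open Scope ring_scope.

Section function_classes.
Context {R : realType}.
Implicit Types (f : R -> R) (phi : R * R -> R).

Definition class_C2 f : Prop :=
  [/\ forall x, derivable f x 1, forall x, derivable (derive1 f) x 1
    & continuous (derive1 (derive1 f))].

Definition strictly_convex f : Prop := forall x y s : R,
  x != y -> 0 < s < 1 ->
  f (s * x + (1 - s) * y) < s * f x + (1 - s) * f y.

Definition superlinear f : Prop :=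
  f v / `|v| @[v --> +oo] --> +oo /\ f v / `|v| @[v --> -oo] --> +oo.

Fixpoint class_Ck (k : nat) phi : Prop :=
  if k is k'.+1 then
    [/\ forall p, derivable phi p (1, 0) /\ derivable phi p (0, 1),
        class_Ck k' ('D_(1, 0) phi) & class_Ck k' ('D_(0, 1) phi)]
  else continuous phi.

(* Elements of C_c^oo(Omega) are represented by their extensions by zero. *)
Definition test_function (Omega : set (R * R)) phi : Prop :=
  [/\ forall k, class_Ck k phi, compact (closure [set p | phi p != 0])
    & closure [set p | phi p != 0] `<=` Omega].

End function_classes.

Section completed_measurability.
Context d (T : measurableType d) {R : realType}.
Variable mu : {measure set T -> \bar R}.

(* measurable_fun refers to the Borel sigma-algebra on R and R * R; here
   measurability is with respect to its completion, i.e. Lebesgue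
   measurability when mu is Lebesgue measure. The integral of the library is
   defined for arbitrary functions as a supremum over simple functions, so that
   it also has the right value on these functions. *)
Definition completed_measurable_fun (D : set T) (f : T -> R) : Prop :=
  forall Y : set R, measurable Y -> completed_algebra_gen mu (D `&` f @^-1` Y).

Definition Linfty (D : set T) (f : T -> R) : Prop :=
  completed_measurable_fun D f /\ finite_norm mu +oo%E (f \_ D).

End completed_measurability.

Section bounded_functions.
Context {R : realType}.
Notation mu := (@lebesgue_measure R).

Definition bounded_measurable (f : R -> R) : Prop :=
  completed_measurable_fun mu setT f /\ exists M, forall x, `|f x| <= M.

Definition Linfty_loc (Omega : set (R * R)) (w : R -> R -> R) : Prop :=
  forall K : set (R * R), compact K -> K `<=` Omega ->
    Linfty (mu \x mu)%E K (fun p => w p.1 p.2).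

Definition BV_loc (g : R -> R) : Prop := forall a b, bounded_variation a b g.

Definition oriented_integral (g : R -> R) (a b : R) : R :=
  if a <= b then \int[mu]_(z in `[a, b]) g z
  else - \int[mu]_(z in `[b, a]) g z.

End bounded_functions.

Section stieltjes.
Context {R : realType}.
Implicit Types (g F : R -> R).

(* The value F(x+) when F is nondecreasing, and a junk value otherwise. *)
Definition right_reg F (x : R) : R :=
  if pselect {homo F : y z / y <= z} then inf (F @` `]x, +oo[) else 0.

Lemma right_reg_nondecreasing F : {homo right_reg F : x y / x <= y}.
Proof.
move=> x y xy; rewrite /right_reg; case: pselect => // ndF.
apply: lb_le_inf; first by exists (F (y + 1)), (y + 1) => //=;
  rewrite in_itv/= andbT ltrDl.
move=> _ [z /= + <-]; rewrite in_itv/= andbT => yz.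
apply: ge_inf; last by exists z => //=; rewrite in_itv/= andbT (le_lt_trans xy).
by exists (F x) => _ [v /= + <-]; rewrite in_itv/= andbT => /ltW xv; exact: ndF.
Qed.

Lemma right_reg_right_continuous F :
  forall x, right_reg F @ x^'+ --> right_reg F x.
Proof.
have [ndF|nndF] := pselect {homo F : y z / y <= z}; last first.
  have -> : right_reg F = cst 0.
    by apply/funext => y; rewrite /right_reg; case: pselect.
  by move=> x; exact: cvg_cst.
have rE y : right_reg F y = inf (F @` `]y, +oo[).
  by rewrite /right_reg; case: pselect.
have lb y : lbound (F @` `]y, +oo[) (F y).
  by move=> _ [v /= + <-]; rewrite in_itv/= andbT => /ltW; exact: ndF.
move=> x; apply/cvgrPdist_le => /= e e0.
have hinf : has_inf (F @` `]x, +oo[).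
  split; last by exists (F x); exact: lb.
  by exists (F (x + 1)), (x + 1) => //=; rewrite in_itv/= andbT ltrDl.
have [_ [z /= xz <-] zlt] := inf_adherent e0 hinf.
rewrite in_itv/= andbT in xz.
near=> y.
have xy : x <= y by apply: ltW; near: y; exact: nbhs_right_gt.
have yz : y < z by near: y; exact: nbhs_right_lt.
rewrite ler0_norm ?subr_le0; last exact: right_reg_nondecreasing.
rewrite opprB lerBlDr addrC !rE (le_trans _ (ltW zlt))//.
apply: ge_inf; first by exists (F y); exact: lb.
by exists z => //=; rewrite in_itv/= andbT.
Unshelve. all: by end_near. Qed.

HB.instance Definition _ F := isCumulative.Build R _ R (right_reg F)
  (@right_reg_nondecreasing F) (@right_reg_right_continuous F).

Definition signed_variation g (x : R) : R :=
  if 0 <= x then fine (total_variation 0 x g)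
  else - fine (total_variation x 0 g).

Definition pos_variation g (x : R) : R := (signed_variation g x + g x) / 2.
Definition neg_variation g (x : R) : R := (signed_variation g x - g x) / 2.

(* For g locally of bounded variation, g = pos_variation g - neg_variation g
   with both terms nondecreasing; dg is the difference of their
   Lebesgue-Stieltjes measures, so dg(]a, b]) = g(b+) - g(a+). Since dg need
   not be finite, the two measures are kept apart. *)
Definition pos_stieltjes g := lebesgue_stieltjes_measure (right_reg (pos_variation g)).
Definition neg_stieltjes g := lebesgue_stieltjes_measure (right_reg (neg_variation g)).

Definition stieltjes_integrable g (k : R -> R) : Prop :=
  (pos_stieltjes g).-integrable setT (EFin \o k) /\
  (neg_stieltjes g).-integrable setT (EFin \o k).

Definition stieltjes_integral g (k : R -> R) : R :=
  \int[pos_stieltjes g]_x k x - \int[neg_stieltjes g]_x k x.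

End stieltjes.

Section weak_solutions.
Context {R : realType}.
Notation mu := (@lebesgue_measure R).

Definition upper_half_plane : set (R * R) := [set p | 0 < p.2].

(* w is a weak solution of w_t + f'(u) w_x = 0 with initial condition w0.
   The two integrability conditions say that the second integral of the weak
   formulation exists as an iterated Lebesgue integral; for the first integral
   this follows from w being in L^oo_loc. *)
Definition weak_solution (f : R -> R) (u w : R -> R -> R) (w0 : R -> R) : Prop :=
  [/\ Linfty_loc upper_half_plane w,
      forall t, 0 < t -> BV_loc (w ^~ t),
      forall phi : R * R -> R, test_function upper_half_plane phi ->
        let k t x := derive1 f (u x t) * phi (x, t) in
        [/\ {ae mu, forall t, 0 < t -> stieltjes_integrable (w ^~ t) (k t)},
            mu.-integrable `]0, +oo[
              (fun t => (stieltjes_integral (w ^~ t) (k t))%:E)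
          & (\int[mu]_(t in `]0, +oo[) \int[mu]_x (w x t * 'D_(0, 1) phi (x, t)))
            - \int[mu]_(t in `]0, +oo[) stieltjes_integral (w ^~ t) (k t) = 0]
    & Lnorm mu +oo%E (fun x => (w x t - w0 x)%:E) @[t --> 0^'+] --> 0%E].

End weak_solutions.

Section lax_oleinik.
Context {R : realType}.
Variables (f alpha u0 : R -> R).
Notation mu := (@lebesgue_measure R).

Definition beta (t : R) : R := \int[mu]_(s in `[0, t]) alpha s.

Definition legendre (p : R) : R := sup (range (fun v => p * v - f v)).

(* "The unique q such that ..." is rendered by choice of such a q. *)
Definition hfun (x t : R) : R :=
  xget 0 [set q | \int[mu]_(theta in `[0, t]) derive1 f (q * expR (beta theta)) = x].

Definition Ffun (x y t : R) : R :=
  \int[mu]_(theta in `[0, t])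
    (legendre (derive1 f (hfun (x - y) t * expR (beta theta)))
     * expR (- beta theta))
  + oriented_integral u0 0 y.

Definition minimizer (x t y : R) : Prop := forall z, Ffun x y t <= Ffun x z t.

Definition y_low (x t : R) : R :=
  xget 0 [set y | minimizer x t y /\ forall z, minimizer x t z -> y <= z].

Definition y_upp (x t : R) : R :=
  xget 0 [set y | minimizer x t y /\ forall z, minimizer x t z -> z <= y].

Definition regular (t : R) : set R := [set x | y_low x t = y_upp x t].

(* Only meaningful for x in [regular t], where y_low x t is y(x, t). *)
Definition ubar (x t : R) : R := hfun (x - y_low x t) t * expR (beta t).

Definition ubar_right (x t : R) : R :=
  lim (ubar z t @[z --> within (regular t) x^'+]).
Definition ubar_left (x t : R) : R :=
  lim (ubar z t @[z --> within (regular t) x^'-]).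

Definition derive_inv (w : R) : R := xget 0 [set v | derive1 f v = w].

Definition ufun (x t : R) : R :=
  if y_low x t == y_upp x t then ubar x t
  else derive_inv ((f (ubar_right x t) - f (ubar_left x t))
                   / (ubar_right x t - ubar_left x t)).

End lax_oleinik.

(* Main.v *)
Require Import Defs.
From HB Require Import structures.
From mathcomp Require Import all_boot all_order all_algebra.
From mathcomp Require Import all_classical all_reals all_analysis.
From mathcomp Require Import ring lra measurable_realfun ess_sup_inf.
Set Implicit Arguments.
Unset Strict Implicit.
Unset Printing Implicit Defensive.
Import Order.TTheory GRing.Theory Num.Theory.
Import numFieldNormedType.Exports.
Local Open Scope classical_set_scope.
Local Open Scope ring_scope.

(** For fixed t the least minimizer y_low x t is a nondecreasing, left continuous
    function of x, so for each c the set where y_low x t <= c is a half-line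
    x <= level t c. Cutting R along these half-lines,

      R x t = int rho0 c (1_(c < y_low x t) - 1_(c < 0)) dc,
      c < y_low x t  if and only if  level t c < x,

    exhibits R as a superposition of Heaviside functions in x which jump at the
    points level t c. The transport equation for R then says that the curves
    t |-> level t c move with the speed f'(u); they are generalized
    characteristics in the sense of Dafermos.

    This is proved for every t and for all but countably many c ([level_deriv]).
    Minimizing characteristics traced back in time do not cross, and between the
    two that arrive from the extreme minimizers at (level s c, s) lies
    level t c ([level_sandwich]). When the minimizer at (level t c, t) is unique,
    both have almost the speed f'(u) and squeeze the curve. Otherwise the two
    extreme minimizers stay optimal, up to first order, along the curve;
    equating the two ways of computing the minimal value gives the
    Rankine-Hugoniot speed, which is f'(u) by the definition of u at a shock
    ([derive_ufun]). Only derivatives from the right in time are obtained in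
    this way, and they suffice.

    For the weak formulation, Fubini turns int phi R dx into an integral over c
    ([carried_Fubini]), and dominated convergence, the curves being Lipschitz in
    time, gives its right derivative ([pairing_deriv], [carried_deriv]):

      (d/dt) int phi R dx
        = int phi_t R dx - int (phi f'(u))(level t c, t) rho0 c dc.

    The last integral is the Stieltjes integral of phi f'(u) against dR, since dR
    is the image of rho0 c dc under level t ([stieltjes_image]). Integrated over
    t the left hand side vanishes: it is the limit of integrals of difference
    quotients of a compactly supported function, all of which are zero by
    translation invariance ([weak_identity]).

    The data are only Lebesgue measurable; since they enter through integrals
    alone, they may be replaced by bounded Borel functions ([Borel_version]). *)

(** * Completed measurability and Borel versions *)

Section borel_version.
Context d (T : measurableType d) {R : realType}.
Variable mu : {measure set T -> \bar R}.

Lemma measurable_fun_rat (g : T -> R) :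
  (forall q : rat, measurable (g @^-1` `]ratr q, +oo[)) ->
  measurable_fun setT g.
Proof.
move=> mg; apply: (measurability _ (RGenOInfty.measurableE R)).
move=> _ [_ [a ->] <-]; rewrite setTI.
rewrite (_ : _ @^-1` _ =
    \bigcup_(q in [set q : rat | a < ratr q]) (g @^-1` `]ratr q, +oo[)).
  by rewrite bigcup_mkcond; apply: bigcupT_measurable_rat => q; case: ifP.
apply/seteqP; split => [x /=|x [q /= aq]].
  rewrite in_itv/= andbT => /rat_in_itvoo[q]; rewrite in_itv/= => /andP[aq qg].
  by exists q => //=; rewrite in_itv/= andbT.
by rewrite !in_itv/= !andbT; exact: lt_trans.
Qed.

Lemma null_bigcup_rat (A : rat -> set T) :
  (forall q, measurable (A q)) -> (forall q, mu (A q) = 0%E) ->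
  measurable (\bigcup_q A q) /\ mu (\bigcup_q A q) = 0%E.
Proof.
move=> mA A0; have mU := bigcupT_measurable_rat mA; split => //.
apply: measure_negligible => //.
pose B n := if unpickle n is Some q then A q else set0.
rewrite (_ : \bigcup_q A q = \bigcup_n B n).
  apply: negligible_bigcup => n; rewrite /B; case: unpickle => [q|].
    exact: (negligibleP mu (mA q)).2 (A0 q).
  exact: negligible_set0.
apply/seteqP; split=> [x [q _ Aq]|x [n _]].
  by exists (pickle q); [exact: I|rewrite /B pickleK].
by rewrite /B; case: unpickle => // q Aq; exists q.
Qed.

(** Countably many level sets, those at rational heights, determine a function;
    each of them differs from a Borel set by a null set, and N is the union of
    these null sets. *)
Lemma completed_measurable_Borel (D : set T) (f : T -> R) :
  measurable D -> completed_measurable_fun mu D f ->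
  exists N, [/\ measurable N, mu N = 0%E &
    measurable_fun setT (f \_ (D `\` N))].
Proof.
move=> mD cf.
have /choice[A HA] (q : rat) : exists AN : set T * set T,
    [/\ measurable AN.1, measurable AN.2, mu AN.2 = 0%E &
      (D `&` f @^-1` `]ratr q, +oo[) `\` AN.2 = AN.1 `\` AN.2].
  have [A mA [N [N' [mN' N'0 NN']] AN]] := cf `]ratr q, +oo[%classic (measurable_itv _).
  exists (A, N'); split => //=; rewrite -AN.
  by rewrite setDUl (_ : N `\` N' = set0) ?setU0// setD_eq0.
pose N := \bigcup_q (A q).2.
have [mN N0] : measurable N /\ mu N = 0%E.
  by apply: null_bigcup_rat => q; have [] := HA q.
exists N; split => //; apply: measurable_fun_rat => q.
have -> : (f \_ (D `\` N)) @^-1` `]ratr q, +oo[ =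
    ((A q).1 `\` N) `|` (if ratr q < 0 :> R then ~` (D `\` N) else set0).
  apply/seteqP; split => x /=; rewrite in_itv/= andbT patchE.
    case: ifPn => [|xDN].
      rewrite inE => -[Dx Nx] qf; left; split => //.
      have [_ _ _ E] := HA q.
      have : ((A q).1 `\` (A q).2) x.
        rewrite -E; split; first by split => //=; rewrite in_itv/= qf.
        by move=> Ax; apply: Nx; exists q.
      by case.
    by move=> ->; right => //; move: xDN; rewrite notin_setE.
  move=> [[Ax Nx]|].
    have [_ _ _ E] := HA q.
    have : ((A q).1 `\` (A q).2) x by split => // A2; apply: Nx; exists q.
    rewrite -E => -[[Dx]] /=; rewrite in_itv/= andbT => qf _.
    by rewrite mem_set.
  case: ifPn => // q0 xDN; rewrite memNset//.
apply: measurableU; last by case: ifP => // _; exact/measurableC/measurableD.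
by apply: measurableD => //; have [] := HA q.
Qed.

Import HBNNSimple.

Let ge0_le_integral_off_null (f g : T -> \bar R) (N : set T) :
  measurable N -> mu N = 0%E ->
  (forall x, 0 <= f x)%E -> (forall x, 0 <= g x)%E ->
  (forall x, ~ N x -> f x = g x) ->
  (\int[mu]_x f x <= \int[mu]_x g x)%E.
Proof.
move=> mN N0 f0 g0 fg; rewrite ge0_integralTE//.
apply: ge_ereal_sup => /= _ [h hf <-].
have mNC : measurable (~` N) by exact: measurableC.
rewrite -integralT_nnsfun (_ : (\int[mu]_x _)%E =
    \int[mu]_x (proj_nnsfun h mNC x)%:E)%E; last first.
  apply: ge0_ae_eq_integral.
  - exact: measurableT.
  - by apply/measurable_EFinP; exact: measurable_funPT.
  - by apply/measurable_EFinP; exact: measurable_funPT.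
  - by move=> x _; rewrite lee_fin; exact: fun_ge0.
  - by move=> x _; rewrite lee_fin; exact: fun_ge0.
  - exists N; split => // x /= H; apply: contrapT => Nx; apply: H => _.
    by rewrite mindicE mem_set// mulr1.
rewrite integralT_nnsfun ge0_integralTE//.
apply: ereal_sup_ubound; exists (proj_nnsfun h mNC) => // x /=.
rewrite mindicE; case: (boolP (x \in ~` N)) => [|_].
  by rewrite inE => /= Nx; rewrite mulr1 -fg.
by rewrite mulr0.
Qed.

(** The integral of an arbitrary function is a supremum over the simple functions
    below it; cutting these to zero on N does not change their integrals. This is
    why neither f nor g has to be measurable. *)
Lemma integral_off_null (D N : set T) (f g : T -> \bar R) :
  measurable N -> mu N = 0%E -> (forall x, D x -> ~ N x -> f x = g x) ->
  (\int[mu]_(x in D) f x = \int[mu]_(x in D) g x)%E.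
Proof.
move=> mN N0 fg; rewrite integral_mkcond [RHS]integral_mkcond.
have {}fg x : ~ N x -> (f \_ D) x = (g \_ D) x.
  by move=> Nx; rewrite !patchE; case: ifPn => //; rewrite inE => Dx; exact: fg.
have E (F G : T -> \bar R) : (forall x, 0 <= F x)%E -> (forall x, 0 <= G x)%E ->
    (forall x, ~ N x -> F x = G x) -> (\int[mu]_x F x = \int[mu]_x G x)%E.
  move=> F0 G0 FG; apply/eqP; rewrite eq_le.
  rewrite (ge0_le_integral_off_null mN N0 F0 G0 FG)//=.
  by apply: (ge0_le_integral_off_null mN N0 G0 F0) => x /FG.
rewrite integralE [RHS]integralE; congr (_ - _)%E; apply: E.
- by move=> x; exact: funepos_ge0.
- by move=> x; exact: funepos_ge0.
- by move=> x /fg; rewrite !funeposE => ->.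
- by move=> x; exact: funeneg_ge0.
- by move=> x; exact: funeneg_ge0.
- by move=> x /fg; rewrite !funenegE => ->.
Qed.

(** The domains of integration A are arbitrary: the two functions differ on a null
    set only, and the integral does not see it. *)
Lemma Borel_version (D : set T) (f : T -> R) (M : R) :
  measurable D -> completed_measurable_fun mu D f ->
  {ae mu, forall x, D x -> `|f x| <= M} -> 0 <= M ->
  exists g : T -> R, [/\ measurable_fun setT g, forall x, `|g x| <= M &
    forall A, A `<=` D ->
      \int[mu]_(x in A) f x = \int[mu]_(x in A) g x].
Proof.
move=> mD cf [N1 [mN1 N10 fM]] M0.
have [N [mN N0 mg]] := completed_measurable_Borel mD cf.
have mNN : measurable (N `|` N1) by exact: measurableU.
have NN0 : mu (N `|` N1) = 0%E.
  apply: measure_negligible => //; apply: negligibleU.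
    exact: (negligibleP mu mN).2 N0.
  exact: (negligibleP mu mN1).2 N10.
exists ((f \_ (D `\` N)) \_ (~` N1)); split.
- apply/(measurable_restrictT _ _).1; first exact: measurableC.
  exact: measurable_funTS.
- move=> x; rewrite !patchE; case: ifPn => [|_]; last by rewrite normr0.
  rewrite inE => N1x; case: ifPn => [|_]; last by rewrite normr0.
  rewrite inE => -[Dx _]; apply: contrapT => fx; apply: N1x; apply: fM.
  by move=> /(_ Dx).
- move=> A AD; congr fine; apply: (integral_off_null mNN NN0) => x Ax Nx.
  rewrite !patchE mem_set//; last by move=> ?; apply: Nx; right.
  rewrite mem_set//; split; first exact: AD.
  by move=> ?; apply: Nx; left.
Qed.

End borel_version.

Section essential_bounds.
Context d (T : measurableType d) {R : realType} (mu : {measure set T -> \bar R}).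

Lemma Linfty_norm_le (g : T -> R) (M : R) : 0 <= M -> (forall x, `|g x| <= M) ->
  (Lnorm mu +oo (EFin \o g) <= M%:E)%E.
Proof.
move=> M0 gM; rewrite unlock; case: ifPn => _; last by rewrite lee_fin.
by apply/ess_supP; apply: nearW => x /=; rewrite lee_fin.
Qed.

Lemma Linfty_ae_bounded (g : T -> R) : (0 < mu setT)%E -> finite_norm mu +oo g ->
  exists2 M : R, 0 <= M & {ae mu, forall x, `|g x| <= M}.
Proof.
move=> mu0; rewrite /finite_norm unlock mu0 => /(ess_supr_bounded (f := Num.norm \o g))[M HM].
exists `|M| => //; apply: filterS HM => x /le_trans; apply; exact: ler_norm.
Qed.

End essential_bounds.

Section Borel_versions.
Context {R : realType}.
Notation mu := (@lebesgue_measure R).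

(** Used for the initial data, which are integrated over intervals on both sides
    of 0. *)
Lemma bounded_measurable_version (g : R -> R) : bounded_measurable g ->
  exists k : R -> R, exists2 M : R, 0 <= M & [/\ measurable_fun setT k,
    forall x, `|k x| <= M & forall A, \int[mu]_(x in A) g x = \int[mu]_(x in A) k x].
Proof.
move=> [mg [M HM]]; have M0 : 0 <= M by rewrite (le_trans _ (HM 0)).
have [|k [mk kM kE]] := Borel_version (T := measurableTypeR R) measurableT mg _ M0.
  by apply: nearW => x _; exact: HM.
by exists k, M => //; split => // A; exact: kE.
Qed.

(** Used for alpha, which is controlled on the half-line only, and there only
    almost everywhere. *)
Lemma Linfty_version (D : set R) (g : R -> R) : measurable D -> Linfty mu D g ->
  exists k : R -> R, exists2 M : R, 0 <= M & [/\ measurable_fun setT k,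
    forall x, `|k x| <= M &
    forall A, A `<=` D -> \int[mu]_(x in A) g x = \int[mu]_(x in A) k x].
Proof.
move=> mD [mg fg].
have mu0 : (0 < mu setT)%E.
  apply: (@lt_le_trans _ _ (mu `[0, 1]%classic)); last by apply: le_measure; rewrite ?inE.
  by rewrite lebesgue_measure_itv/= lte_fin ltr01 oppr0 adde0 lte_fin.
have [M M0 HM] := Linfty_ae_bounded mu0 fg.
have [|k [mk kM kE]] := Borel_version (T := measurableTypeR R) mD mg _ M0.
  by apply: filterS HM => x + Dx; rewrite patchE mem_set.
by exists k, M.
Qed.

End Borel_versions.

(** * Integrals over oriented intervals *)

Section oriented.
Context {R : realType}.
Implicit Types (g k : R -> R).
Notation mu := (@lebesgue_measure R).
Notation oint := oriented_integral.

(** The functions integrated below are either continuous or bounded and Borel;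
    both are Borel and bounded on bounded sets. *)
Definition loc_bounded_Borel g := measurable_fun setT g /\
  forall N, exists M, forall x, `|x| <= N -> `|g x| <= M.

Lemma continuous_loc_bounded_Borel g : continuous g -> loc_bounded_Borel g.
Proof.
move=> cg; split; first exact: continuous_measurable_fun.
move=> N; have cgN : {within `[- `|N|, `|N|], continuous (fun x => `|g x|)}.
  by apply: continuous_subspaceT => x; apply: cvg_norm; exact: cg.
have NN : - `|N| <= `|N| by rewrite (le_trans _ (normr_ge0 _))// oppr_le0.
have [c _ Hc] := EVT_max NN cgN.
exists `|g c| => x xN; apply: Hc; rewrite in_itv/= -ler_norml.
by rewrite (le_trans xN)// ler_norm.
Qed.

Lemma bounded_loc_bounded_Borel g M :
  measurable_fun setT g -> (forall x, `|g x| <= M) -> loc_bounded_Borel g.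
Proof. by move=> mg gM; split=> // N; exists M. Qed.

Lemma loc_bounded_BorelM g k : loc_bounded_Borel g -> loc_bounded_Borel k ->
  loc_bounded_Borel (fun x => g x * k x).
Proof.
move=> [mg bg] [mk bk]; split; first exact: measurable_funM.
move=> N; have [A HA] := bg N; have [B HB] := bk N; exists (A * B) => x xN.
by rewrite normrM ler_pM// ?HA ?HB.
Qed.

Lemma loc_bounded_integrable g a b : loc_bounded_Borel g ->
  mu.-integrable `[a, b] (EFin \o g).
Proof.
move=> [mg bg]; apply: measurable_bounded_integrable => //=.
- rewrite lebesgue_measure_itv/=; case: ifP => // _.
  by rewrite -EFinB ltry.
- exact: measurable_funTS.
- have [M HM] := bg (`|a| + `|b|).
  exists M; split; first exact: num_real.
  move=> M' MM' x /=; rewrite in_itv/= => /andP[ax xb].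
  apply: (le_trans _ (ltW MM')); apply: HM; rewrite ler_norml.
  have := ler_norm b; have := ler_norm (- a); rewrite normrN.
  have := normr_ge0 a; have := normr_ge0 b; lra.
Qed.

Lemma ointE g a b : a <= b -> oint g a b = \int[mu]_(x in `[a, b]) g x.
Proof. by move=> ab; rewrite /oriented_integral ab. Qed.

Lemma ointxx g a : oint g a a = 0.
Proof. by rewrite ointE// set_itv1 Rintegral_set1. Qed.

Lemma oint_opp g a b : oint g a b = - oint g b a.
Proof.
have [->|/lt_total/orP[ab|ba]] := eqVneq a b; first by rewrite ointxx oppr0.
- by rewrite /oriented_integral (ltW ab) leNgt ab/= opprK.
- by rewrite /oriented_integral (ltW ba) leNgt ba.
Qed.

Let oint_chasles_le g a b c : loc_bounded_Borel g -> a <= b -> b <= c ->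
  oint g a b + oint g b c = oint g a c.
Proof.
move=> lg ab bc; rewrite !ointE//; last exact: le_trans bc.
have H := @Rintegral_itvB R g (BLeft a) (BRight c) b.
rewrite Rintegral_itv_obnd_cbnd in H; last first.
  apply: integrableS (loc_bounded_integrable b c lg) => //.
  exact: subset_itv_oc_cc.
rewrite -H ?bnd_simp//; first by rewrite addrC subrK.
exact: loc_bounded_integrable.
Qed.

Lemma oint_chasles g b a c : loc_bounded_Borel g ->
  oint g a b + oint g b c = oint g a c.
Proof.
move=> lg.
have [ab|/ltW ba] := leP a b; have [bc|/ltW cb] := leP b c.
- exact: oint_chasles_le.
- have [ac|/ltW ca] := leP a c.
    by rewrite -(oint_chasles_le lg ac cb) (oint_opp g b c) addrK.
  by rewrite (oint_opp g b c) -(oint_chasles_le lg ca ab) (oint_opp g a c); ring.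
- have [ac|/ltW ca] := leP a c.
    by rewrite (oint_opp g a b) -(oint_chasles_le lg ba ac); ring.
  by rewrite (oint_opp g a c) (oint_opp g a b) -(oint_chasles_le lg bc ca); ring.
- by rewrite (oint_opp g a c) -(oint_chasles_le lg cb ba) opprD addrC -!oint_opp.
Qed.

Lemma fine_mu_itv (a b : R) : a <= b -> fine (mu `[a, b]) = b - a.
Proof.
rewrite lebesgue_measure_itv/= lte_fin le_eqVlt => /predU1P[->|ab].
  by rewrite ltxx subrr.
by rewrite ab.
Qed.

Lemma oint_le g a b M : loc_bounded_Borel g -> a <= b ->
  (forall x, a <= x <= b -> g x <= M) -> oint g a b <= M * (b - a).
Proof.
move=> lg ab gM; rewrite ointE// -fine_mu_itv// -Rintegral_cst//.
apply: le_Rintegral => //.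
- exact: loc_bounded_integrable.
- by apply: loc_bounded_integrable; apply: continuous_loc_bounded_Borel => x; exact: cvg_cst.
Qed.

Lemma oint_ge g a b m : loc_bounded_Borel g -> a <= b ->
  (forall x, a <= x <= b -> m <= g x) -> m * (b - a) <= oint g a b.
Proof.
move=> lg ab gM; rewrite ointE// -fine_mu_itv// -Rintegral_cst//.
apply: le_Rintegral => //.
- by apply: loc_bounded_integrable; apply: continuous_loc_bounded_Borel => x; exact: cvg_cst.
- exact: loc_bounded_integrable.
Qed.

Lemma oint_norm_le g a b M : loc_bounded_Borel g -> a <= b ->
  (forall x, a <= x <= b -> `|g x| <= M) -> `|oint g a b| <= M * (b - a).
Proof.
move=> lg ab gM; rewrite ler_norml -mulNr; apply/andP; split.
  by apply: oint_ge => // x /gM; rewrite ler_norml => /andP[].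
by apply: oint_le => // x /gM; rewrite ler_norml => /andP[].
Qed.

Lemma oint_lipschitz g M : loc_bounded_Borel g -> (forall x, `|g x| <= M) ->
  forall a b c, `|oint g a b - oint g a c| <= M * `|b - c|.
Proof.
move=> lg gM a b c; wlog cb : b c / c <= b => [H|].
  have [/H//|/ltW/H] := leP c b.
  by rewrite [in X in X -> _]distrC [`|c - b|]distrC.
rewrite -(oint_chasles c a b lg) addrC addKr (ger0_norm (_ : 0 <= b - c)) ?subr_ge0//.
exact: oint_norm_le.
Qed.

Lemma ler_oint g k a b : loc_bounded_Borel g -> loc_bounded_Borel k -> a <= b ->
  (forall x, a <= x <= b -> g x <= k x) -> oint g a b <= oint k a b.
Proof.
move=> lg lk ab gk; rewrite !ointE//; apply: le_Rintegral => //;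
  do ?exact: loc_bounded_integrable.
Qed.

Lemma ointD g k a b : loc_bounded_Borel g -> loc_bounded_Borel k ->
  oint (fun x => g x + k x) a b = oint g a b + oint k a b.
Proof.
move=> lg lk; rewrite /oriented_integral; case: ifP => ab;
 rewrite RintegralD// ?opprD//; exact: loc_bounded_integrable.
Qed.

Lemma ointZ g (r : R) a b : loc_bounded_Borel g ->
  oint (fun x => r * g x) a b = r * oint g a b.
Proof.
move=> lg; rewrite /oriented_integral; case: ifP => ab;
 rewrite RintegralZl// ?mulrN//; exact: loc_bounded_integrable.
Qed.

Lemma eq_oint g k a b : (forall x, a <= x <= b \/ b <= x <= a -> g x = k x) ->
  oint g a b = oint k a b.
Proof.
move=> gk; rewrite /oriented_integral; case: ifP => ab; [|congr (- _)];
  by apply: eq_Rintegral => x; rewrite inE/= in_itv/= => xab; apply: gk; tauto.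
Qed.

(** The gap between the two functions attains its minimum on [a, b], hence is
    bounded below. *)
Lemma ltr_oint g k a b : continuous g -> continuous k -> a < b ->
  (forall x, a <= x <= b -> g x < k x) -> oint g a b < oint k a b.
Proof.
move=> cg ck ab gk.
have cd : {within `[a, b], continuous (fun x => k x - g x)}.
  apply: continuous_subspaceT => x.
  by apply: cvgB; [exact: ck|exact: cg].
have [c cab Hc] := EVT_min (ltW ab) cd.
have lg := continuous_loc_bounded_Borel cg.
have lk := continuous_loc_bounded_Borel ck.
have lc : loc_bounded_Borel (fun _ : R => k c - g c).
  by apply: continuous_loc_bounded_Borel => x; exact: cvg_cst.
have lgc : loc_bounded_Borel (fun x => g x + (k c - g c)).
  by apply: continuous_loc_bounded_Borel => x; apply: cvgD; [exact: cg|exact: cvg_cst].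
have le : oint (fun x => g x + (k c - g c)) a b <= oint k a b.
  apply: ler_oint => //; first exact: ltW.
  by move=> x xab; rewrite addrC -lerBrDr; apply: Hc; rewrite in_itv.
rewrite ointD// in le; apply: lt_le_trans le; rewrite ltrDl.
apply: (@lt_le_trans _ _ ((k c - g c) * (b - a))).
  by rewrite mulr_gt0// subr_gt0// gk// -[_ <= _ <= _]/(c \in `[a,b]).
by apply: oint_ge => //; exact: ltW.
Qed.

End oriented.

Section oint_limits.
Context {R : realType}.
Notation oint := oriented_integral.
Notation mu := (@lebesgue_measure R).

Lemma loc_bounded_cst (r : R) : loc_bounded_Borel (fun _ : R => r).
Proof. by apply: continuous_loc_bounded_Borel => x; exact: cvg_cst. Qed.

Lemma oint_cvg (a b B : R) (F : nat -> R -> R) (G : R -> R) : a <= b ->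
  (forall n, measurable_fun setT (F n)) ->
  (forall n x, a <= x <= b -> `|F n x| <= B) ->
  (forall x, a <= x <= b -> F n x @[n --> \oo] --> G x) ->
  mu.-integrable `[a, b] (EFin \o G) /\
  oint (F n) a b @[n --> \oo] --> oint G a b.
Proof.
move=> ab mF FB FG.
have mG : measurable_fun `[a, b] G.
  apply: (measurable_fun_cvg (h := F)) => [n|x]; first exact: measurable_funTS.
  by rewrite /= in_itv/=; exact: FG.
have iB : mu.-integrable `[a, b] (EFin \o cst B).
  exact/loc_bounded_integrable/loc_bounded_cst.
have H1 n : measurable_fun `[a, b] (EFin \o F n).
  by apply/measurable_EFinP; exact: measurable_funTS.
have H2 : measurable_fun `[a, b] (EFin \o G) by exact/measurable_EFinP.
have H3 : {ae mu, forall x, `[a, b]%classic x ->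
    (EFin \o F n) x @[n --> \oo] --> (EFin \o G) x}.
  apply: aeW => x /=; rewrite in_itv/= => /FG H.
  by apply: cvg_EFin => //; exact: nearW.
have H5 : {ae mu, forall x n, `[a, b]%classic x -> (`|(EFin \o F n) x| <= (EFin \o cst B) x)%E}.
  by apply: aeW => x n /=; rewrite in_itv/= => /(FB n); rewrite lee_fin.
have [iG _ H] := @dominated_convergence _ _ _ mu _ (measurable_itv _)
  (fun n => EFin \o F n) (EFin \o G) (EFin \o cst B) H1 H2 H3 iB H5.
split => //; under eq_fun do rewrite ointE//; rewrite ointE//.
apply: fine_cvg; rewrite fineK//; apply: integrable_fin_num => //; exact: measurable_itv.
Qed.

(** Differentiability of the primitive, in the epsilon-delta form in which it is
    combined with estimates on the level curves. *)
Lemma oint_first_order (psi : R -> R) (x0 e : R) : continuous psi -> 0 < e ->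
  exists2 d, 0 < d & forall x, `|x - x0| < d ->
    `|oint psi x0 x - psi x0 * (x - x0)| <= e * `|x - x0|.
Proof.
move=> cpsi e0; have lpsi := continuous_loc_bounded_Borel cpsi.
have := cpsi x0 => /cvgrPdist_lt /(_ _ e0) /nbhs_ballP[d /= d0 Hd].
exists d => // x xd.
have H z : `|z - x0| <= `|x - x0| -> psi x0 - e <= psi z <= psi x0 + e.
  move=> zx; have : `|psi x0 - psi z| < e.
    by apply: Hd; rewrite /ball/= distrC (le_lt_trans zx).
  by rewrite ltr_norml => /andP[*]; apply/andP; split; lra.
have [x0x|/ltW xx0] := leP x0 x.
  rewrite (ger0_norm (_ : 0 <= x - x0)) ?subr_ge0// ler_distl -mulrBl -mulrDl.
  have Hz z : x0 <= z <= x -> psi x0 - e <= psi z <= psi x0 + e.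
    by move=> /andP[z1 z2]; apply: H; rewrite !ger0_norm ?subr_ge0// lerD2r.
  by apply/andP; split; [apply: oint_ge|apply: oint_le] => // z /Hz/andP[].
have -> : oint psi x0 x - psi x0 * (x - x0) = - (oint psi x x0 - psi x0 * (x0 - x)).
  by rewrite (oint_opp _ x0 x); ring.
rewrite normrN [`|x - x0|]distrC (ger0_norm (_ : 0 <= x0 - x)) ?subr_ge0// ler_distl -mulrBl -mulrDl.
have Hz z : x <= z <= x0 -> psi x0 - e <= psi z <= psi x0 + e.
  move=> /andP[z1 z2]; apply: H; rewrite ![`|_ - x0|]distrC.
  by rewrite !ger0_norm ?subr_ge0// lerD2l lerN2.
by apply/andP; split; [apply: oint_ge|apply: oint_le] => // z /Hz/andP[].
Qed.

Lemma oint_continuous (psi : R -> R) M (a : R) : loc_bounded_Borel psi ->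
  (forall x, `|psi x| <= M) -> continuous (oint psi a).
Proof.
move=> lpsi psiM x; have M0 : 0 <= M by rewrite (le_trans _ (psiM 0)).
apply/cvgrPdist_lt => e e0; apply/nbhs_ballP; exists (e / (M + 1)) => /=.
  by rewrite divr_gt0// ltr_wpDl.
move=> y; rewrite /ball/= ltr_pdivlMr; last by rewrite ltr_wpDl.
apply: le_lt_trans; apply: (le_trans (oint_lipschitz lpsi psiM _ _ _)).
by rewrite mulrC ler_wpM2l// lerDl.
Qed.

Lemma oint_eq0 (g : R -> R) a b : (forall x, a <= x <= b \/ b <= x <= a -> g x = 0) ->
  oint g a b = 0.
Proof.
move=> g0; rewrite (@eq_oint _ g (fun _ => 0))// /oriented_integral.
by rewrite !Rintegral_cst// !mul0r oppr0 if_same.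
Qed.

(** The mass to the right of l, as an oriented integral: no case distinction on
    the position of l with respect to [-L, L] is left, because psi vanishes
    outside. *)
Lemma oint_cut (psi : R -> R) L l : 0 <= L -> loc_bounded_Borel psi ->
  (forall x, L <= `|x| -> psi x = 0) ->
  oint (fun x => if l < x then psi x else 0) (- L) L = oint psi l L.
Proof.
move=> L0 lpsi psi0; have LL : - L <= L by rewrite (le_trans _ L0)// oppr_le0.
have lcut : loc_bounded_Borel (fun x => if l < x then psi x else 0).
  case: (lpsi) => mpsi bpsi; split.
    apply: measurable_fun_ifT => //.
    exact: (measurable_fun_ltr (f := fun=> l) (g := id)).
  move=> N; have [M HM] := bpsi N; exists M => x xN; case: ifP => _; first exact: HM.
  by rewrite normr0 (le_trans _ (HM x xN)).
have [Ll|lL] := leP L l.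
  rewrite oint_eq0 => [|x [/andP[_ xL]|/andP[Lx xL]]].
  - rewrite oint_eq0// => x [/andP[lx xL]|/andP[Lx _]]; apply: psi0.
      by rewrite (le_trans _ (ler_norm _))// (le_trans Ll).
    by rewrite (le_trans Lx)// ler_norm.
  - by rewrite ltNge (le_trans xL Ll).
  - by rewrite ltNge (le_trans xL (le_trans LL Ll)).
have [lL'|Ll] := leP l (- L).
  rewrite (@eq_oint _ _ psi) => [|x xL]; last first.
    case: ifPn => //; rewrite -leNgt => xl; rewrite psi0//.
    by rewrite -normrN (le_trans _ (ler_norm _))// lerNr (le_trans xl).
  rewrite -(oint_chasles (- L) l L lpsi) [X in _ = X + _]oint_eq0 ?add0r// => x.
  move=> [/andP[_ xL]|/andP[Lx xl]]; apply: psi0.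
    by rewrite -normrN (le_trans _ (ler_norm _))// lerNr.
  by rewrite -normrN (le_trans _ (ler_norm _))// lerNr (le_trans xl).
rewrite -(oint_chasles l _ _ lcut) [X in X + _]oint_eq0 ?add0r; last first.
  by move=> x [/andP[_ xl]|/andP[lx xL]]; rewrite ltNge ?xl// (le_trans xL)// ltW.
rewrite !ointE ?(ltW lL)//.
have oc (g : R -> R) : loc_bounded_Borel g -> \int[mu]_(x in `[l, L]) g x = \int[mu]_(x in `]l, L]) g x.
  move=> lg; rewrite Rintegral_itv_obnd_cbnd//.
  by apply: integrableS (loc_bounded_integrable l L lg) => //; exact: subset_itv_oc_cc.
rewrite !oc//; apply: eq_Rintegral => x; rewrite inE/= in_itv/= => /andP[lx _].
by rewrite lx.
Qed.

End oint_limits.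

(** * Measures on the line and in the plane *)

Section image.
Context d d' (T1 : measurableType d) (T2 : measurableType d') {R : realType}.
Variables (m : {measure set T1 -> \bar R}) (X : T1 -> T2).
Hypothesis mX : measurable_fun setT X.

Definition image_measure : {measure set T2 -> \bar R} :=
  measure_function_pushforward__canonical__measure_function_Measure m mX.

(** The change of variables formula for signed integrands, from the one for
    nonnegative integrands applied to positive and negative parts. *)
Lemma integral_image (f : T2 -> \bar R) : measurable_fun setT f ->
  (\int[image_measure]_x f x = \int[m]_x f (X x))%E.
Proof.
move=> mf; rewrite integralE [RHS]integralE; congr (_ - _)%E.
- rewrite ge0_integral_pushforward//; first by rewrite preimage_setT -funepos_comp.
  exact: measurable_funepos.
- rewrite ge0_integral_pushforward//; first by rewrite preimage_setT -funeneg_comp.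
  exact: measurable_funeneg.
Qed.

End image.

Section plane.
Context {R : realType}.
Notation mu := (@lebesgue_measure R).

(** An open set is the union of the boxes with rational corners that it
    contains. *)
Lemma open_measurable2 (A : set (R * R)) : open A -> measurable A.
Proof.
move=> oA.
pose box (q : rat * rat * (rat * rat)) : set (R * R) :=
  `]ratr q.1.1, ratr q.1.2[%classic `*` `]ratr q.2.1, ratr q.2.2[%classic.
have -> : A = \bigcup_q (if `[< box q `<=` A >] then box q else set0).
  apply/seteqP; split => [[x y] Axy|p [q _]]; last by case: asboolP => // qA qp; exact: qA.
  have := open_nbhs_nbhs (conj oA Axy : open_nbhs _ _) => /nbhs_ballP[e /= e0 He].
  have e20 : 0 < e / 2 by rewrite divr_gt0.
  have lt1 (z : R) : z - e / 2 < z by lra.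
  have lt2 (z : R) : z < z + e / 2 by lra.
  have [a] := rat_in_itvoo (lt1 x); rewrite in_itv/= => /andP[a1 a2].
  have [b] := rat_in_itvoo (lt2 x); rewrite in_itv/= => /andP[b1 b2].
  have [c] := rat_in_itvoo (lt1 y); rewrite in_itv/= => /andP[c1 c2].
  have [d] := rat_in_itvoo (lt2 y); rewrite in_itv/= => /andP[d1 d2].
  exists ((a, b), (c, d)) => //; case: asboolP => [_|]; first by split => /=; rewrite in_itv/= ?a2 ?b1 ?c2.
  case=> -[x' y'] [/=]; rewrite !in_itv/= => /andP[x1 x2] /andP[y1 y2].
  by apply: He; split => /=; rewrite /ball/= ltr_norml; apply/andP; split; lra.
apply: countable_bigcupT_measurable => [|q]; first exact: countableP.
case: ifP => // _.
by apply: measurableX; exact: measurable_itv.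
Qed.

Lemma compact_measurable2 (K : set (R * R)) : compact K -> measurable K.
Proof.
move=> cK; rewrite -[K]setCK; apply: measurableC; apply: open_measurable2.
by rewrite openC; apply: compact_closed => //; exact: norm_hausdorff.
Qed.

Lemma Fubini_box (k : R * R -> R) (a b c d M : R) :
  measurable_fun setT k -> (forall p, `|k p| <= M) ->
  \int[mu]_(x in `[a, b]) (\int[mu]_(y in `[c, d]) k (x, y)) =
  \int[mu]_(y in `[c, d]) (\int[mu]_(x in `[a, b]) k (x, y)).
Proof.
move=> mk kM; pose A := `[a, b]%classic `*` `[c, d]%classic : set (R * R).
have mA : measurable A by apply: measurableX; exact: measurable_itv.
have fin (u v : R) : (mu `[u, v]%classic < +oo)%E.
  by rewrite lebesgue_measure_itv/=; case: ifP => // _; rewrite -EFinB ltry.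
have muA : ((mu \x mu) A < +oo)%E.
  rewrite /A product_measure1E; [|exact: measurable_itv|exact: measurable_itv].
  by rewrite lte_mul_pinfty ?ge0_fin_numE//; exact: fin.
have ik : (mu \x mu)%E.-integrable setT ((EFin \o k) \_ A).
  apply/(integrable_mkcond _ _).1; first exact: mA.
  apply: measurable_bounded_integrable => //.
  - exact: measurable_funTS.
  by exists M; split => [|m Mm x _]; [exact: num_real|apply: (le_trans (kM x)); exact: ltW].
have kx x : measurable_fun setT (fun y => k (x, y)).
  by apply: measurableT_comp mk _; exact: pair1_measurable.
have ky y : measurable_fun setT (fun x => k (x, y)).
  by apply: measurableT_comp mk _; exact: pair2_measurable.
have := Fubini ik.
have L x : (\int[mu]_y ((EFin \o k) \_ A) (x, y) =
    ((fun x => (\int[mu]_(y in `[c, d]) k (x, y))%:E) \_ `[a, b]) x)%E.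
  rewrite patchE; case: ifPn => [|]; rewrite ?inE ?notin_setE => xab.
    rewrite /Rintegral fineK; last first.
      apply: integrable_fin_num; first exact: measurable_itv.
      exact: (loc_bounded_integrable c d (bounded_loc_bounded_Borel (kx x) (fun y => kM (x, y)))).
    rewrite [RHS]integral_mkcond; apply: eq_integral => y _; rewrite !patchE.
    by rewrite /A in_setX/= [x \in _]mem_set.
  apply: integral0_eq => y _; rewrite patchE ifF//; apply/negbTE.
  by rewrite notin_setE => -[].
have L' y : (\int[mu]_x ((EFin \o k) \_ A) (x, y) =
    ((fun y => (\int[mu]_(x in `[a, b]) k (x, y))%:E) \_ `[c, d]) y)%E.
  rewrite patchE; case: ifPn => [|]; rewrite ?inE ?notin_setE => ycd.
    rewrite /Rintegral fineK; last first.
      apply: integrable_fin_num; first exact: measurable_itv.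
      exact: (loc_bounded_integrable a b (bounded_loc_bounded_Borel (ky y) (fun x => kM (x, y)))).
    rewrite [RHS]integral_mkcond; apply: eq_integral => x _; rewrite !patchE.
    by rewrite /A in_setX/= [y \in _]mem_set// andbT.
  apply: integral0_eq => x _; rewrite patchE ifF//; apply/negbTE.
  by rewrite notin_setE => -[].
under eq_integral do rewrite L; under [RHS]eq_integral do rewrite L'.
by rewrite -!integral_mkcond => H; congr fine.
Qed.

(** The image of Lebesgue measure under a translation gives every interval its
    length, hence is Lebesgue measure. *)
Lemma integral_translate (K : R -> R) e : measurable_fun setT K ->
  \int[mu]_t K (t + e) = \int[mu]_t K t.
Proof.
move=> mK; congr fine.
have ms : measurable_fun setT ((fun t : R => t + e) : measurableTypeR R -> measurableTypeR R).
  by apply: measurable_funD.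
rewrite -(integral_image mu ms (f := EFin \o K)); last exact/measurable_EFinP.
apply: eq_measure_integral => A mA _; apply/esym.
apply: (lebesgue_measure_unique (mu := image_measure mu ms)) => // _ [[p q] _ <-] /=.
rewrite /pushforward.
have -> : (fun t : R => t + e) @^-1` `]p, q] = `](p - e), (q - e)]%classic.
  by apply/seteqP; split => x /=; rewrite !in_itv/= ltrBlDr lerBrDr.
by rewrite !lebesgue_measure_itv/= !lte_fin ltrD2r -!EFinD (_ : q - e - (p - e) = q - p)//; ring.
Qed.

(** Discards the exceptional values c, those taken by y_low at rational points. *)
Lemma countable_range_rat (g : rat -> R) :
  measurable (range g) /\ mu (range g) = 0%E.
Proof.
have cg : countable (range g).
  by apply: card_le_trans (card_image_le _ _) _; exact: countableP.
by split; [exact: countable_measurable|exact: countable_lebesgue_measure0].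
Qed.

End plane.

(** * Stieltjes integrals as integrals along a parametrization *)

Section density.
Context d (T : measurableType d) {R : realType} (mu : {measure set T -> \bar R}).
Local Open Scope ereal_scope.
Variable a : T -> R.
Hypothesis ma : measurable_fun setT a.
Hypothesis a0 : forall x, (0 <= a x)%R.

Definition density (A : set T) : \bar R := \int[mu]_(x in A) (a x)%:E.

Let density0 : density set0 = 0.
Proof. by rewrite /density integral_set0. Qed.

Let density_ge0 A : 0 <= density A.
Proof. by apply: integral_ge0 => x _; rewrite lee_fin. Qed.

Let density_sigma : semi_sigma_additive density.
Proof.
apply: semi_sigma_additive_nng_induced; first exact/measurable_EFinP.
by move=> x; rewrite lee_fin.
Qed.

Definition density_measure : {measure set T -> \bar R} :=
  HB.pack density (isMeasure.Build _ _ _ density density0 density_ge0 density_sigma).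

Import HBNNSimple.

Let integral_density_nnsfun (h : {nnsfun T >-> R}) :
  \int[mu]_x ((h x)%:E * (a x)%:E) = \int[density_measure]_x (h x)%:E.
Proof.
have mA : measurable_fun setT (EFin \o a) by exact/measurable_EFinP.
transitivity (\int[density_measure]_x
   (\sum_(y \in range h) (y * \1_(h @^-1` [set y]) x)%:E)); last first.
  by apply: eq_integral => t tE; rewrite /= fimfunE -fsumEFin.
have indich r : measurable_fun setT (fun x => (r * \1_(h @^-1` [set r]) x)%:E).
  by apply: (measurable_comp measurableT) => //; exact: measurable_funM.
rewrite ge0_integral_fsum//; last by move=> m y Ey; exact: nnfun_muleindic_ge0.
transitivity (\int[mu]_x (\sum_(y \in range h)
    (y * \1_(h @^-1` [set y]) x)%:E * (a x)%:E)).
  under [RHS]eq_integral => x xE.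
    rewrite -ge0_mule_fsuml => [|y]; last exact: nnfun_muleindic_ge0.
    rewrite fsumEFin // -(fimfunE _ x); over.
  by [].
rewrite ge0_integral_fsum//; last 2 first.
  - by move=> y; apply: emeasurable_funM.
  - move=> m y Ey; apply: mule_ge0; last by rewrite lee_fin.
    by rewrite EFinM nnfun_muleindic_ge0.
apply: eq_fsbigr => r rhn.
under [RHS]eq_integral do rewrite EFinM.
rewrite integralZl_indic_nnsfun => //.
under eq_integral do rewrite EFinM -muleA.
rewrite ge0_integralZl//.
- under eq_integral do rewrite muleC.
  rewrite (eq_integral ((EFin \o a) \_ (h @^-1` [set r]))); last first.
    by move=> x xE; rewrite epatch_indic.
  by rewrite -integral_mkcond integral_indic// setIT.
- by apply: emeasurable_funM => //; exact/measurable_EFinP.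
- by move=> t Et; rewrite mule_ge0 ?lee_fin.
- by move: rhn; rewrite inE => -[t _ <-]; rewrite lee_fin.
Qed.

Let ge0_integral_density (f : T -> \bar R) : measurable_fun setT f ->
  (forall x, 0 <= f x) ->
  \int[density_measure]_x f x = \int[mu]_x (f x * (a x)%:E).
Proof.
move=> mf f0; pose h := nnsfun_approx measurableT mf.
have -> : \int[density_measure]_x f x =
    lim (\int[density_measure]_x (EFin \o h n) x @[n --> \oo]).
  have fE x : setT x -> f x = lim ((EFin \o h n) x @[n --> \oo]).
    by move=> Ex; apply/esym/cvg_lim => //; exact: cvg_nnsfun_approx.
  under eq_integral => x /[!inE] /fE -> //.
  apply: monotone_convergence => //.
  - move=> n; apply/measurable_EFinP.
    by apply: (measurable_funS measurableT) => //; exact/measurable_funP.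
  - by move=> n x Ex //=; rewrite lee_fin.
  - by move=> x Ex m b mb; rewrite lee_fin; exact/lefP/nd_nnsfun_approx.
have fg x : setT x -> f x * (a x)%:E = lim (((h n x)%:E * (a x)%:E) @[n --> \oo]).
  by move=> Ex; apply/esym/cvg_lim => //; apply: cvgeZr;
    [|exact: cvg_nnsfun_approx].
under [RHS]eq_integral => x /[!inE] /fg -> //.
rewrite monotone_convergence//; last 3 first.
- move=> n; apply: emeasurable_funM; apply/measurable_EFinP => //.
- by move=> n x Ex /=; rewrite mule_ge0 ?lee_fin.
- by move=> x Ex m b mb/=; rewrite lee_wpmul2r ?lee_fin//; exact/lefP/nd_nnsfun_approx.
by under [in RHS]eq_fun do rewrite integral_density_nnsfun.
Qed.

(** The density need not be bounded nor the measure finite, so the formula is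
    derived from simple functions by monotone convergence. *)
Lemma integral_density (f : T -> \bar R) : measurable_fun setT f ->
  \int[density_measure]_x f x = \int[mu]_x (f x * (a x)%:E).
Proof.
move=> mf; rewrite integralE [RHS]integralE; congr (_ - _).
- rewrite ge0_integral_density//; last exact: measurable_funepos.
  apply: eq_integral => x _; rewrite !funeposE maxe_pMl ?lee_fin//.
  by rewrite mul0e.
- rewrite ge0_integral_density//; last exact: measurable_funeneg.
  apply: eq_integral => x _; rewrite !funenegE maxe_pMl ?lee_fin//.
  by rewrite mul0e mulNe.
Qed.

End density.

Section signed_variation.
Context {R : realType}.
Implicit Types (g F : R -> R).

Lemma nd_right_reg_cvg F q : {homo F : x y / x <= y} ->
  F x @[x --> q^'+] --> right_reg F q.
Proof.
move=> ndF; rewrite /right_reg; case: pselect => // ndF'.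
apply: (@nondecreasing_at_right_cvgr _ F q +oo%O) => //.
  by move=> x y _ _; exact: ndF.
by exists (F q) => _ [v /= + <-]; rewrite in_itv/= andbT => /ltW; exact: ndF.
Qed.

Lemma stieltjes_itv F p q : p <= q ->
  lebesgue_stieltjes_measure (right_reg F) `]p, q] = (right_reg F q - right_reg F p)%:E.
Proof.
move=> pq; rewrite /lebesgue_stieltjes_measure/= /measure_extension measurable_mu_extE/=; last exact: is_ocitv.
by rewrite wlength_itv_bnd.
Qed.

(** Additivity of the total variation over adjacent intervals, in the four
    positions of a and b relative to the base point 0. *)
Lemma signed_variation_diff g a b : BV_loc g -> a <= b ->
  signed_variation g b - signed_variation g a = fine (total_variation a b g).
Proof.
move=> bv ab; have fin c d : c <= d -> total_variation c d g \is a fin_num.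
  by move=> cd; apply/bounded_variationP.
rewrite /signed_variation; case: (leP 0 b) => b0; case: (leP 0 a) => a0.
- by rewrite (total_variationD _ a0 ab) fineD ?fin// addrC addKr.
- by rewrite (total_variationD _ (ltW a0) b0) fineD ?fin// ?ltW// opprK addrC.
- by have := lt_le_trans b0 a0; rewrite ltNge ab.
- by rewrite (total_variationD _ ab (ltW b0)) fineD ?fin// ?ltW// opprK addrC addrK.
Qed.

Lemma norm_diff_variation g a b : BV_loc g -> a <= b ->
  `|g b - g a| <= signed_variation g b - signed_variation g a.
Proof.
move=> bv ab; rewrite signed_variation_diff// -lee_fin fineK.
  exact: total_variation_ge.
exact/bounded_variationP.
Qed.

Lemma pos_variation_nd g : BV_loc g -> {homo pos_variation g : x y / x <= y}.
Proof.
move=> bv x y xy; have := norm_diff_variation bv xy.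
rewrite ler_norml /pos_variation ler_pM2r ?invr_gt0// => /andP[*]; lra.
Qed.

Lemma neg_variation_nd g : BV_loc g -> {homo neg_variation g : x y / x <= y}.
Proof.
move=> bv x y xy; have := norm_diff_variation bv xy.
rewrite ler_norml /neg_variation ler_pM2r ?invr_gt0// => /andP[*]; lra.
Qed.

Lemma pos_neg_right_cvg g q : BV_loc g ->
  g x @[x --> q^'+] --> right_reg (pos_variation g) q - right_reg (neg_variation g) q.
Proof.
move=> bv.
have H : pos_variation g x - neg_variation g x @[x --> q^'+] -->
    right_reg (pos_variation g) q - right_reg (neg_variation g) q.
  apply: cvgB; apply: nd_right_reg_cvg; [exact: pos_variation_nd|exact: neg_variation_nd].
have E : (fun x => pos_variation g x - neg_variation g x) = g.
  by apply/funext => x; rewrite /pos_variation /neg_variation; field.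
by rewrite E in H.
Qed.

End signed_variation.

Lemma stieltjes_lty {R : realType} (F : R -> R) p q :
  (lebesgue_stieltjes_measure (right_reg F) `]p, q]%classic < +oo)%E.
Proof.
have [pq|qp] := leP p q; first by rewrite stieltjes_itv// ltry.
have -> : `]p, q]%classic = set0 :> set R by rewrite set_itv_ge// bnd_simp -leNgt ltW.
by rewrite measure0.
Qed.

Lemma fine_sub_eq {R : realType} (a b c d : \bar R) : a \is a fin_num ->
  b \is a fin_num -> c \is a fin_num -> d \is a fin_num ->
  (a + d = b + c)%E -> fine a - fine b = fine c - fine d.
Proof. by case: a b c d => [a| |] [b| |] [c| |] [d| |]//= _ _ _ _ []; lra. Qed.

(** If the increments of g, between right limits, are the integrals of rho over
    the preimages of intervals under X, then dg is the image under X of the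
    measure with density rho. As dg is a difference of two measures that may both
    be infinite, and rho changes sign, the equality is stated between the sums
    m1 = dg^+ + X(M dc) and m2 = dg^- + X((rho + M) dc) of genuine measures; these
    agree on intervals ]p, q], hence on all Borel sets. *)
Section stieltjes_image.
Context {R : realType}.
Notation mu := (@lebesgue_measure R).
Variables (g X rho : R -> R) (M : R).
Hypothesis bvg : BV_loc g.
Hypothesis mX : measurable_fun setT X.
Hypothesis mrho : measurable_fun setT rho.
Hypothesis rhoM : forall x, `|rho x| <= M.
Hypothesis X_proper : forall p q, exists N, X @^-1` `]p, q] `<=` `[- N, N]%classic.
Hypothesis g_diff : forall p q gp gq, p <= q ->
  g x @[x --> p^'+] --> gp -> g x @[x --> q^'+] --> gq ->
  gq - gp = \int[mu]_(c in X @^-1` `]p, q]) rho c.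

Let up c := rho c + M.
Let un (c : R) := M.

Let M0 : 0 <= M.
Proof. by rewrite (le_trans _ (rhoM 0)). Qed.

Let mup : measurable_fun setT up.
Proof. by apply: measurable_funD. Qed.

Let mun : measurable_fun setT un.
Proof. exact: measurable_cst. Qed.

Let up0 c : 0 <= up c.
Proof. by have := rhoM c; rewrite ler_norml /up; lra. Qed.

Let un0 c : 0 <= un c. Proof. exact: M0. Qed.

Let upM c : `|up c| <= M + M.
Proof. by rewrite ger0_norm// /up lerD2r; have := rhoM c; rewrite ler_norml => /andP[]. Qed.

Let nup : {measure set (measurableTypeR R) -> \bar R} :=
  image_measure (density_measure mu mup up0) (mX : measurable_fun setT (X : measurableTypeR R -> measurableTypeR R)).
Let nun : {measure set (measurableTypeR R) -> \bar R} :=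
  image_measure (density_measure mu mun un0) (mX : measurable_fun setT (X : measurableTypeR R -> measurableTypeR R)).

Let mXitv p q : measurable (X @^-1` `]p, q]).
Proof. by rewrite -[X in measurable X]setTI; exact: mX. Qed.

Let int_over (u : R -> R) p q : loc_bounded_Borel u ->
  mu.-integrable (X @^-1` `]p, q]) (EFin \o u).
Proof.
move=> lu; have [N XN] := X_proper p q.
have H := loc_bounded_integrable (- N) N lu.
by apply: integrableS H => //; exact: mXitv.
Qed.

Let lrho : loc_bounded_Borel rho. Proof. exact: bounded_loc_bounded_Borel rhoM. Qed.
Let lup : loc_bounded_Borel up. Proof. exact: bounded_loc_bounded_Borel upM. Qed.
Let lun : loc_bounded_Borel un.
Proof. by apply: (bounded_loc_bounded_Borel (M := M)) => // x; rewrite ger0_norm. Qed.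

Let nupE p q : nup `]p, q]%classic = (\int[mu]_(c in X @^-1` `]p, q]) up c)%:E.
Proof. by rewrite /Rintegral fineK//; apply: integrable_fin_num; [exact: mXitv|exact: int_over]. Qed.

Let nunE p q : nun `]p, q]%classic = (\int[mu]_(c in X @^-1` `]p, q]) un c)%:E.
Proof. by rewrite /Rintegral fineK//; apply: integrable_fin_num; [exact: mXitv|exact: int_over]. Qed.

Let m1 : {measure set (measurableTypeR R) -> \bar R} := measure_add (pos_stieltjes g) nun.
Let m2 : {measure set (measurableTypeR R) -> \bar R} := measure_add (neg_stieltjes g) nup.

Let m1_add A : m1 A = (pos_stieltjes g A + nun A)%E.
Proof. exact: measure_addE. Qed.

Let m2_add A : m2 A = (neg_stieltjes g A + nup A)%E.
Proof. exact: measure_addE. Qed.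

Let m1E (A : set R) : measurable A -> m1 A = m2 A.
Proof.
move=> mA; refine (@measure_unique _ R (measurableTypeR R) (@ocitv R)
  (fun n => `]- n%:R, n%:R]%classic) _ _ _ _ m1 m2 _ _ A mA).
- by [].
- exact: ocitvI.
- by move=> n; exact: is_ocitv.
- apply/seteqP; split => // x _.
  exists (Num.bound `|x|) => //=; rewrite in_itv/=.
  have := archi_boundP (normr_ge0 x); rewrite ltr_norml => /andP[-> /ltW->]//.
- move=> _ [[p q] _ <-] /=; have [pq|qp] := leP p q; last first.
    have -> : `]p, q]%classic = set0 :> set R by rewrite set_itv_ge// bnd_simp -leNgt ltW.
    by rewrite (measure0 m1) (measure0 m2).
  rewrite m1_add m2_add nupE nunE.
  rewrite /pos_stieltjes /neg_stieltjes !stieltjes_itv// -!EFinD; congr EFin.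
  have := g_diff pq (pos_neg_right_cvg bvg (q := p)) (pos_neg_right_cvg bvg (q := q)).
  have : \int[mu]_(c in X @^-1` `]p, q]) up c =
      \int[mu]_(c in X @^-1` `]p, q]) rho c + \int[mu]_(c in X @^-1` `]p, q]) un c.
    rewrite -RintegralD//; [exact: mXitv|exact: int_over|exact: int_over].
  by move=> -> D; rewrite -D; ring.
- by move=> n; rewrite m1_add nunE lte_add_pinfty ?ltry//; exact: stieltjes_lty.
Qed.

Variables (k : R -> R) (B L : R).
Hypothesis mk : measurable_fun setT k.
Hypothesis kB : forall x, `|k x| <= B.
Hypothesis kL : forall x, L < `|x| -> k x = 0.

Let integrable_k (m : {measure set (measurableTypeR R) -> \bar R}) :
  (forall p q, m `]p, q]%classic < +oo)%E -> m.-integrable setT (EFin \o k).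
Proof.
move=> mfin; pose A := `]- (`|L| + 1), `|L|]%classic : set R.
have kA : EFin \o k = (EFin \o k) \_ A.
  apply/funext => x; rewrite patchE; case: ifPn => //; rewrite notin_setE /A/= in_itv/= => xA.
  rewrite kL// ltNge; apply/negP => xL; apply: xA; move: xL; rewrite ler_norml => /andP[xL Lx].
  by apply/andP; split; have := ler_norm L; lra.
rewrite kA; apply/(integrable_mkcond _ _).1; first exact: measurable_itv.
apply: measurable_bounded_integrable => //.
- exact: measurable_itv.
- exact: mfin.
- exact: measurable_funTS.
exists B; split; first exact: num_real.
by move=> b Bb x _; apply: (le_trans (kB x)); exact: ltW.
Qed.

Lemma stieltjes_image : stieltjes_integrable g k /\
  stieltjes_integral g k = \int[mu]_c (k (X c) * rho c).
Proof.
have i1 : (pos_stieltjes g).-integrable setT (EFin \o k).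
  by apply: integrable_k => p q; exact: stieltjes_lty.
have i2 : (neg_stieltjes g).-integrable setT (EFin \o k).
  by apply: integrable_k => p q; exact: stieltjes_lty.
have i3 : nup.-integrable setT (EFin \o k).
  by apply: integrable_k => p q; rewrite nupE ltry.
have i4 : nun.-integrable setT (EFin \o k).
  by apply: integrable_k => p q; rewrite nunE ltry.
split=> //.
have mk' : measurable_fun setT (EFin \o k) by exact/measurable_EFinP.
have mkX : measurable_fun setT (fun c => k (X c)) by exact: measurableT_comp.
have E3 : (\int[nup]_x (k x)%:E = \int[mu]_c (k (X c) * up c)%:E)%E.
  rewrite integral_image// integral_density//; exact/measurable_EFinP.
have E4 : (\int[nun]_x (k x)%:E = \int[mu]_c (k (X c) * un c)%:E)%E.
  rewrite integral_image// integral_density//; exact/measurable_EFinP.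
have H : (\int[pos_stieltjes g]_x (k x)%:E + \int[nun]_x (k x)%:E =
    \int[neg_stieltjes g]_x (k x)%:E + \int[nup]_x (k x)%:E)%E.
  have H1 := @integral_measure_add _ _ _ (pos_stieltjes g) nun setT measurableT (EFin \o k) i1 i4.
  have H2 := @integral_measure_add _ _ _ (neg_stieltjes g) nup setT measurableT (EFin \o k) i2 i3.
  apply: (eq_trans (esym H1)); apply: (eq_trans _ H2).
  by apply: (@eq_measure_integral _ _ _ setT m2 m1) => A mA _; exact: m1E.
have [N XN] := X_proper (- (`|L| + 1)) `|L|.
have int_kX u b : loc_bounded_Borel u -> (forall c, `|u c| <= b) ->
    mu.-integrable setT (EFin \o (fun c => k (X c) * u c)).
  move=> lu ub.
  have -> : EFin \o (fun c => k (X c) * u c) = (EFin \o (fun c => k (X c) * u c)) \_ `[- N, N].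
    apply/funext => c; rewrite patchE; case: ifPn => //; rewrite notin_setE => cN.
    rewrite /= kL ?mul0r// ltNge; apply/negP => xL; apply: cN; apply: XN.
    rewrite /= in_itv/=; move: xL; rewrite ler_norml => /andP[xL Lx].
    by apply/andP; split; have := ler_norm L; lra.
  apply/(integrable_mkcond _ _).1; first exact: measurable_itv.
  apply: loc_bounded_integrable; apply: loc_bounded_BorelM => //.
  exact: (bounded_loc_bounded_Borel (M := B)).
have j1 := int_kX _ _ lrho rhoM.
have j2 : mu.-integrable setT (EFin \o (fun c => k (X c) * un c)).
  by apply: (int_kX _ M) => // c; rewrite ger0_norm.
rewrite /stieltjes_integral /Rintegral.
have F1 := integrable_fin_num measurableT i1; have F2 := integrable_fin_num measurableT i2.
have F3 := integrable_fin_num measurableT i3; have F4 := integrable_fin_num measurableT i4.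
have F5 := integrable_fin_num measurableT j1.
apply: (etrans (fine_sub_eq F1 F2 F3 F4 H)).
have E5 : (\int[nup]_x (k x)%:E = \int[mu]_c (k (X c) * rho c)%:E + \int[nun]_x (k x)%:E)%E.
  rewrite E3 E4 -integralD//; apply: eq_integral => c _ /=.
  by rewrite -EFinD /up /un mulrDr.
by apply: (etrans (congr1 (fun z => fine z - _) E5)); rewrite fineD// addrK.
Qed.

End stieltjes_image.

(** * Convexity of the flux *)

Section convexity.
Context {R : realType}.
Variable f : R -> R.
Notation f' := (derive1 f).

Definition tangent_below := forall v w, v != w -> f v + f' v * (w - v) < f w.

Lemma derive1_first_order (v e : R) : derivable f v 1 -> 0 < e ->
  exists2 d : R, 0 < d & forall w : R, `|w - v| < d ->
    `|f w - f v - f' v * (w - v)| <= e * `|w - v|.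
Proof.
move=> fv e0.
have H : (fun h : R => h^-1 *: (f (h + v) - f v)) @ 0^' --> f' v.
  have E : (fun h : R => h^-1 *: (f (h *: 1 + v) - f v)) = (fun h => h^-1 *: (f (h + v) - f v)).
    by apply/funext => h; rewrite /GRing.scale/= mulr1.
  by move: fv; rewrite derive1E /derivable /derive E.
move/cvgrPdist_le: H => /(_ _ e0) /=.
rewrite near_withinE => /nbhs_ballP[d /= d0 Hd]; exists d => // w wd.
have [->|wv] := eqVneq w v; first by rewrite !subrr mulr0 subrr normr0 mulr0.
have wv0 : w - v != 0 by rewrite subr_eq0.
have := Hd (w - v); rewrite /ball/= sub0r normrN => /(_ wd wv0).
rewrite subrK distrC => H; rewrite -ler_pdivrMr ?normr_gt0// -normf_div.
apply: le_trans H; rewrite le_eqVlt; apply/orP; left; apply/eqP; congr `|_|.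
by rewrite /GRing.scale/=; field.
Qed.

Hypothesis f_C2 : class_C2 f.
Hypothesis f_convex : strictly_convex f.

Lemma C2_cont : continuous f.
Proof.
move=> x; have [df _ _] := f_C2; apply: differentiable_continuous.
exact/derivable1_diffP.
Qed.

Lemma C2_cont' : continuous f'.
Proof.
move=> x; have [_ df _] := f_C2; apply: differentiable_continuous.
exact/derivable1_diffP.
Qed.

(** Were the chord below the tangent by a gap, the value at v + s (w - v), which is
    at most that on the chord by convexity, would miss the tangent by s times the
    gap; differentiability at v forbids this for small s. *)
Let tangent_le v w : v != w -> f v + f' v * (w - v) <= f w.
Proof.
move=> vw; rewrite leNgt; apply/negP => H.
have wv : 0 < `|w - v| by rewrite normr_gt0 subr_eq0 eq_sym.
pose e := (f v + f' v * (w - v) - f w) / (2 * `|w - v|).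
have e0 : 0 < e by rewrite divr_gt0 ?mulr_gt0// subr_gt0.
have [df _ _] := f_C2; have [d d0 Hd] := derive1_first_order (df v) e0.
pose s := Num.min (1 / 2) (d / (2 * `|w - v|)).
have s0 : 0 < s by rewrite lt_min !divr_gt0// mulr_gt0.
have s1 : s < 1 by rewrite gt_min; apply/orP; left; lra.
have sd : s * `|w - v| < d.
  have : s * `|w - v| <= d / (2 * `|w - v|) * `|w - v|.
    by rewrite ler_wpM2r// ge_min lexx orbT.
  move/le_lt_trans; apply.
  rewrite (_ : d / (2 * `|w - v|) * `|w - v| = d / 2); last by field; rewrite gt_eqF.
  lra.
have := Hd (v + s * (w - v)).
rewrite (_ : v + s * (w - v) - v = s * (w - v)); last by ring.
rewrite normrM (gtr0_norm s0) => /(_ sd).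
rewrite (_ : e * (s * `|w - v|) = s * (f v + f' v * (w - v) - f w) / 2); last first.
  by rewrite /e; field; rewrite gt_eqF.
have := f_convex (s := s) (x := w) (y := v); rewrite eq_sym vw s0 s1 => /(_ isT isT).
rewrite (_ : s * w + (1 - s) * v = v + s * (w - v)); last by ring.
rewrite ler_norml => H1 /andP[H2 _].
have : 0 < s * (f v + f' v * (w - v) - f w) by rewrite mulr_gt0// subr_gt0.
move: H1 H2; move: (f (v + s * (w - v))) (f' v) (f v) (f w) (w - v) => A B C D E; nra.
Qed.

(** Strictness is gained at the midpoint: f lies strictly below the chord there,
    and weakly above the tangent. *)
Lemma C2_tangent_below : tangent_below.
Proof.
move=> v w vw; pose m := 1 / 2 * v + (1 - 1 / 2) * w.
have vm : v != m.
  by apply: contra vw => /eqP vm; apply/eqP; move: vm; rewrite /m; lra.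
have s01 : 0 < (1 / 2 : R) < 1 by apply/andP; split; lra.
have := tangent_le vm; have := f_convex vw s01; rewrite -/m.
rewrite (_ : m - v = (w - v) / 2); last by rewrite /m; field.
move: (f m) (f' v) (f v) (f w) (w - v) => A B C D E; lra.
Qed.

Hypothesis f_growth : superlinear f.

(** The tangent inequality at v, evaluated at 0, bounds f' v from below by
    (f v - f 0) / v for v > 0 and from above for v < 0; superlinear growth makes
    both quotients unbounded, and f' is continuous. *)
Lemma superlinear_derive_surj p : exists v, f' v = p.
Proof.
have [Gp Gm] := f_growth.
have [a pa a1] : exists2 a, p <= f' a & 1 <= a.
  move/cvgryPge : Gp => /(_ (p + `|f 0|)) [A [_ HA]].
  exists (Num.max 1 (A + 1)); last by rewrite le_max lexx.
  set a := Num.max _ _; have a1 : 1 <= a by rewrite le_max lexx.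
  have a0 : 0 < a by rewrite (lt_le_trans _ a1).
  have := HA a; rewrite (gtr0_norm a0) ler_pdivlMr//.
  rewrite lt_max ltrDl ltr01 orbT => /(_ isT) H1.
  have a0' : a != 0 by rewrite gt_eqF.
  have H2 := C2_tangent_below a0'; have H3 := ler_norm (f 0).
  have H4 : `|f 0| <= `|f 0| * a by rewrite ler_peMr.
  rewrite -(ler_pM2r a0); move: H1 H2 H3 H4; rewrite mulrDl.
  move: (f a) (f' a) (f 0) `|f 0| => A1 A2 A3 A4; lra.
have [b pb b1] : exists2 b, f' b <= p & b <= - 1.
  move/cvgryPge : Gm => /(_ (- p + `|f 0|)) [A [_ HA]].
  exists (Num.min (- 1) (A - 1)); last by rewrite ge_min lexx.
  set b := Num.min _ _; have b1 : b <= - 1 by rewrite ge_min lexx.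
  have b0 : b < 0 by rewrite (le_lt_trans b1)//; lra.
  have := HA b; rewrite (ltr0_norm b0) ler_pdivlMr ?oppr_gt0//.
  rewrite gt_min (_ : A - 1 < A) ?orbT; last by lra.
  move=> /(_ isT) H1.
  have b0' : b != 0 by rewrite lt_eqF.
  have H2 := C2_tangent_below b0'; have H3 := ler_norm (f 0).
  have H4 : `|f 0| <= `|f 0| * - b by rewrite ler_peMr// lerNr.
  rewrite -(ler_nM2r b0); move: H1 H2 H3 H4; rewrite mulrDl.
  move: (f b) (f' b) (f 0) `|f 0| => A1 A2 A3 A4; lra.
have ba : b <= a by rewrite (le_trans b1)// (le_trans _ a1)//; lra.
have [||c _ cp] := @IVT R f' b a p ba.
- exact: continuous_subspaceT C2_cont'.
- by rewrite ge_min pb le_max pa orbT.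
by exists c.
Qed.

(** The supremum is attained where the tangent has the given slope. *)
Lemma legendre_slope v : legendre f (f' v) = f' v * v - f v.
Proof.
have ub x : f' v * x - f x <= f' v * v - f v.
  have [->//|xv] := eqVneq x v.
  have := C2_tangent_below (negbT (etrans (eq_sym _ _) (negbTE xv))).
  by move: (f x) (f' v) (f v) => A B C; lra.
apply/eqP; rewrite eq_le /legendre; apply/andP; split.
  by apply: ge_sup; [exists (f' v * v - f v), v|move=> _ [x _ <-]].
apply: ub_le_sup; last by exists v.
by exists (f' v * v - f v) => _ [x _ <-].
Qed.

Lemma derive_invK w : f' (derive_inv f w) = w.
Proof.
have [v fv] := superlinear_derive_surj w.
exact: (@xgetPex _ 0 [set v | f' v = w] (ex_intro _ v fv)).
Qed.

End convexity.

(** * Characteristics *)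

Section characteristics.
Context {R : realType}.
Variables (f beta : R -> R).
Notation f' := (derive1 f).
Notation oint := oriented_integral.

Hypothesis f_cont : continuous f.
Hypothesis f'_cont : continuous f'.
Hypothesis f_tangent : tangent_below f.
Hypothesis f'_surj : forall p, exists v, f' v = p.
Hypothesis beta_cont : continuous beta.

(** [drift s t q] is the displacement between the times s and t along the
    characteristic on which the solution is q e^beta; it is the derivative in q
    of [action s t q]. *)
Definition speed q theta := f' (q * expR (beta theta)).
Definition cost q theta := f (q * expR (beta theta)) * expR (- beta theta).
Definition drift s t q := oint (speed q) s t.
Definition action s t q := oint (cost q) s t.

Let expR_beta_cont : continuous (fun theta => expR (beta theta)).
Proof.
by move=> x; apply: continuous_comp; [exact: beta_cont|exact: continuous_expR].
Qed.

Let expRN_beta_cont : continuous (fun theta => expR (- beta theta)).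
Proof.
move=> x; apply: (@continuous_comp _ _ _ (fun y => - beta y)); last exact: continuous_expR.
by apply: cvgN; exact: beta_cont.
Qed.

Let snd_cont (p : R * R) : {for p, continuous (fun p : R * R => p.2)}.
Proof. by rewrite /continuous_at; exact: cvg_snd. Qed.

Lemma speed2_cont : continuous (fun p : R * R => speed p.1 p.2).
Proof.
move=> p; have c1 : {for p, continuous (fun p : R * R => p.1 * expR (beta p.2))}.
  rewrite /continuous_at; apply: cvgM; first exact: cvg_fst.
  exact: (continuous_comp (@snd_cont p) (@expR_beta_cont _)).
exact: (continuous_comp c1 (@f'_cont _)).
Qed.

Lemma cost2_cont : continuous (fun p : R * R => cost p.1 p.2).
Proof.
move=> p; rewrite /continuous_at /cost; apply: cvgM; last first.
  exact: (continuous_comp (@snd_cont p) (@expRN_beta_cont _)).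
have c1 : {for p, continuous (fun p : R * R => p.1 * expR (beta p.2))}.
  rewrite /continuous_at; apply: cvgM; first exact: cvg_fst.
  exact: (continuous_comp (@snd_cont p) (@expR_beta_cont _)).
exact: (continuous_comp c1 (@f_cont _)).
Qed.

Lemma section2_cont (k : R -> R -> R) : continuous (fun p : R * R => k p.1 p.2) ->
  forall q, continuous (k q).
Proof.
move=> ck q x; rewrite /continuous_at.
by apply: (@continuous2_cvg _ _ _ _ _ _ _ _ k q x); [exact: (ck (q, x))|exact: cvg_cst|exact: cvg_id].
Qed.

Lemma section1_cont (k : R -> R -> R) : continuous (fun p : R * R => k p.1 p.2) ->
  forall y, continuous (k ^~ y).
Proof.
move=> ck y x; rewrite /continuous_at.
by apply: (@continuous2_cvg _ _ _ _ _ _ _ _ k x y); [exact: (ck (x, y))|exact: cvg_id|exact: cvg_cst].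
Qed.

Lemma speed_cont q : continuous (speed q).
Proof. exact: (section2_cont speed2_cont). Qed.

Lemma cost_cont q : continuous (cost q).
Proof. exact: (section2_cont cost2_cont). Qed.

Let lspeed q := continuous_loc_bounded_Borel (speed_cont (q := q)).
Let lcost q := continuous_loc_bounded_Borel (cost_cont (q := q)).

Lemma cont2_bounded (k : R -> R -> R) : continuous (fun p : R * R => k p.1 p.2) ->
  forall N T, exists2 C, 0 <= C & forall q theta,
    `|q| <= N -> `|theta| <= T -> `|k q theta| <= C.
Proof.
move=> ck N T.
have cK : compact (`[- N, N]%classic `*` `[- T, T]%classic : set (R * R)).
  by apply: compact_setX; exact: segment_compact.
have ckK : {within `[- N, N]%classic `*` `[- T, T]%classic,
    continuous (fun p : R * R => k p.1 p.2)}.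
  exact: continuous_subspaceT.
have := continuous_compact ckK cK => /compact_bounded[C [_ HC]].
exists (`|C| + 1) => [|q theta qN tT]; first by rewrite addr_ge0.
apply: (HC (`|C| + 1)); first by rewrite (le_lt_trans (ler_norm C))// ltrDl.
by exists (q, theta) => //=; rewrite /= !in_itv/= -!ler_norml.
Qed.

Lemma drift_chasles s t r q : drift s t q + drift t r q = drift s r q.
Proof. exact: oint_chasles. Qed.

Lemma action_chasles s t r q : action s t q + action t r q = action s r q.
Proof. exact: oint_chasles. Qed.

(** The tangent inequality of f at the points q e^beta, divided by e^beta and
    integrated in time. *)
Lemma action_tangent s t q q' : s < t -> q != q' ->
  action s t q + drift s t q * (q' - q) < action s t q'.
Proof.
move=> st qq'.
rewrite mulrC /action /drift -ointZ// -ointD//; last first.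
  by apply: loc_bounded_BorelM => //; apply: continuous_loc_bounded_Borel => x; exact: cvg_cst.
apply: ltr_oint => //.
- move=> x; apply: cvgD; first exact: cost_cont.
  by apply: cvgM; [exact: cvg_cst|exact: speed_cont].
- exact: cost_cont.
move=> x _; rewrite /cost /speed.
have e0 : expR (beta x) * expR (- beta x) = 1 by rewrite expRN mulfV// gt_eqF// expR_gt0.
have ep : 0 < expR (- beta x) := expR_gt0 _.
have : q * expR (beta x) != q' * expR (beta x).
  by apply: contra qq' => /eqP /(mulIf (lt0r_neq0 (expR_gt0 _))) ->.
move=> /f_tangent; rewrite -(ltr_pM2r ep); apply: le_lt_trans.
rewrite le_eqVlt; apply/orP; left; apply/eqP.
set e := expR (beta x) in e0 *; set e' := expR (- beta x) in e0 *.
transitivity (f (q * e) * e' + f' (q * e) * (q' - q) * (e * e')); last by ring.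
by rewrite e0; ring.
Qed.

Lemma drift_norm_le N T : exists2 C, 0 <= C & forall q s t,
  `|q| <= N -> 0 <= s -> s <= t -> t <= T -> `|drift s t q| <= C * (t - s).
Proof.
have [C C0 HC] := cont2_bounded speed2_cont N T.
exists C => // q s t qN s0 st tT; apply: oint_norm_le => // x /andP[sx xt].
by apply: HC => //; rewrite ger0_norm ?(le_trans xt)// (le_trans s0).
Qed.

Lemma action_norm_le N T : exists2 C, 0 <= C & forall q s t,
  `|q| <= N -> 0 <= s -> s <= t -> t <= T -> `|action s t q| <= C * (t - s).
Proof.
have [C C0 HC] := cont2_bounded cost2_cont N T.
exists C => // q s t qN s0 st tT; apply: oint_norm_le => // x /andP[sx xt].
by apply: HC => //; rewrite ger0_norm ?(le_trans xt)// (le_trans s0).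
Qed.

Lemma f'_mono : {homo f' : v w / v <= w}.
Proof.
move=> v w; rewrite le_eqVlt => /predU1P[->//|vw].
have := f_tangent (negbT (lt_eqF vw)); have := f_tangent (negbT (gt_eqF vw)); nra.
Qed.

(** Since e^beta is bounded below on [0, T], for q large the speed is uniformly
    large along the whole characteristic. *)
Lemma drift_coercive t0 T P : 0 < t0 -> exists2 Q, 0 <= Q & forall t,
  t0 <= t -> t <= T -> P <= drift 0 t Q /\ drift 0 t (- Q) <= - P.
Proof.
move=> t00; pose P' := `|P| / t0.
have P'0 : 0 <= P' by rewrite divr_ge0// ltW.
have [v1 Hv1] := f'_surj P'; have [v2 Hv2] := f'_surj (- P').
have [B B0 HB] := cont2_bounded (k := fun _ theta => expR (- beta theta))
  (fun p => continuous_comp (@snd_cont p) (@expRN_beta_cont _)) 0 T.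
pose v := `|v1| + `|v2|.
have v0 : 0 <= v by rewrite addr_ge0.
exists (v * B); first by rewrite mulr_ge0.
move=> t t0t tT; have t_gt0 : 0 < t by exact: lt_le_trans t0t.
have vB x : 0 <= x <= t -> v <= v * B * expR (beta x).
  move=> /andP[x0 xt].
  have := HB 0 x; rewrite normr0 lexx => /(_ isT).
  rewrite ger0_norm// => /(_ (le_trans xt tT)).
  rewrite ger0_norm ?expR_ge0// => eB.
  rewrite -mulrA ler_peMr//.
  have -> : 1 = expR (- beta x) * expR (beta x) by rewrite expRN mulVf// gt_eqF// expR_gt0.
  by rewrite ler_wpM2r// expR_ge0.
have PP : P <= P' * (t - 0).
  rewrite subr0 /P' mulrAC ler_pdivlMr//.
  apply: (le_trans (ler_wpM2r (ltW t00) (ler_norm P))).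
  by rewrite ler_wpM2l.
split.
  apply: (le_trans PP); apply: oint_ge => //; first exact: ltW.
  move=> x /vB vx; rewrite /speed -Hv1; apply: f'_mono.
  by rewrite (le_trans (ler_norm _))// (le_trans _ vx)// /v lerDl.
apply: (@le_trans _ _ ((- P') * (t - 0))); last by rewrite mulNr lerN2.
apply: oint_le => //; first exact: ltW.
move=> x /vB vx; rewrite /speed -Hv2; apply: f'_mono.
rewrite mulNr -lerN2 opprK (le_trans _ vx)// /v.
have := ler_norm (- v2); rewrite normrN; have := normr_ge0 v1; lra.
Qed.

(** Continuity under the integral sign. *)
Lemma drift_cont t : 0 < t -> continuous (drift 0 t).
Proof.
move=> t0 q.
have -> : drift 0 t = (fun q => \int[lebesgue_measure]_(theta in `[0, t]) speed q theta).
  by apply/funext => q'; rewrite /drift ointE// ltW.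
have [C C0 HC] := cont2_bounded speed2_cont (`|q| + 1) t.
apply: (@continuity_under_integral R _ _ lebesgue_measure speed `[0, t]%classic
  (measurable_itv _) (q - 1) (q + 1) _ _ (fun => C)).
- by move=> x _; apply: loc_bounded_integrable.
- apply: aeW => y _ x _; exact: (section1_cont speed2_cont).
- by apply: loc_bounded_integrable; apply: continuous_loc_bounded_Borel => x; exact: cvg_cst.
- move=> x /=; rewrite in_itv/= => /andP[x1 x2]; apply: aeW => y /=; rewrite in_itv/= => /andP[y0 yt].
  apply: HC; last by rewrite ger0_norm.
  rewrite ler_norml; have := ler_norm q; have := ler_norm (- q); rewrite normrN; lra.
- by rewrite inE/= in_itv/=; lra.
Qed.

Lemma drift_surj t p : 0 < t -> exists q, drift 0 t q = p.
Proof.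
move=> t0; have [Q Q0 HQ] := drift_coercive t `|p| t0.
have [H1 H2] := HQ t (lexx _) (lexx _).
have QQ : - Q <= Q by rewrite (le_trans _ Q0)// oppr_le0.
have cw : {within `[- Q, Q], continuous (drift 0 t)}.
  by apply: continuous_subspaceT; exact: drift_cont.
have [|q _ <-] := IVT QQ cw (v := p); last by exists q.
have := ler_norm p; have := ler_norm (- p); rewrite normrN => h1 h2.
rewrite ge_min le_max; apply/andP; split; apply/orP; [left|right].
  by rewrite (le_trans H2)// lerNl.
by rewrite (le_trans h2).
Qed.

(** The estimate is uniform for q near q0: the slopes of the characteristics that
    it is applied to vary with s. *)
Lemma cont2_mean (k : R -> R -> R) (q0 t e : R) :
  continuous (fun p : R * R => k p.1 p.2) -> 0 < e ->
  exists2 d, 0 < d & forall q s, `|q - q0| < d -> t <= s -> s < t + d ->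
    `|oint (k q) t s - k q0 t * (s - t)| <= e * (s - t).
Proof.
move=> ck e0; have := ck (q0, t) => /cvgrPdist_lt /(_ _ e0) /nbhs_ballP[d /= d0 Hd].
exists d => // q s qd ts sd.
have lk : loc_bounded_Borel (k q).
  apply: continuous_loc_bounded_Borel; exact: (section2_cont ck).
have H x : t <= x <= s -> `|k q0 t - k q x| < e.
  move=> /andP[tx xs]; apply: (Hd (q, x)); split => /=; rewrite /ball/= distrC// ltr_norml.
  by apply/andP; split; lra.
rewrite ler_distl -mulrBl -mulrDl; apply/andP; split.
  apply: oint_ge => // x /H; rewrite ltr_norml => /andP[]; lra.
apply: oint_le => // x /H; rewrite ltr_norml => /andP[]; lra.
Qed.

End characteristics.

(** * Minimizers of the Hopf-Lax functional *)

(** What the variational part of the argument uses about the characteristics: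
    [drift s t] is the derivative of the strictly convex [action s t], both are
    additive in time, and [speed], [cost] are their time derivatives. *)
Record flow {R : realType} (drift action : R -> R -> R -> R)
    (speed cost : R -> R -> R) : Prop
  := Flow {
  flow_drift_chasles : forall s t r q : R, drift s t q + drift t r q = drift s r q;
  flow_action_chasles : forall s t r q : R,
    action s t q + action t r q = action s r q;
  flow_action_tangent : forall s t q q' : R, s < t -> q != q' ->
    action s t q + drift s t q * (q' - q) < action s t q';
  flow_drift_norm_le : forall N T : R, exists2 C : R, 0 <= C & forall q s t : R,
    `|q| <= N -> 0 <= s -> s <= t -> t <= T -> `|drift s t q| <= C * (t - s);
  flow_action_norm_le : forall N T : R, exists2 C : R, 0 <= C & forall q s t : R,
    `|q| <= N -> 0 <= s -> s <= t -> t <= T -> `|action s t q| <= C * (t - s);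
  flow_drift_coercive : forall t0 T P : R, 0 < t0 -> exists2 Q : R, 0 <= Q & forall t : R,
    t0 <= t -> t <= T -> P <= drift 0 t Q /\ drift 0 t (- Q) <= - P;
  flow_drift_mean : forall q0 t e : R, 0 < e ->
    exists2 d : R, 0 < d & forall q s : R, `|q - q0| < d -> t <= s -> s < t + d ->
    `|drift t s q - speed q0 t * (s - t)| <= e * (s - t);
  flow_action_mean : forall q0 t e : R, 0 < e ->
    exists2 d : R, 0 < d & forall q s : R, `|q - q0| < d -> t <= s -> s < t + d ->
    `|action t s q - cost q0 t * (s - t)| <= e * (s - t) }.

Section hopf_lax.
Context {R : realType}.
Variables (drift action : R -> R -> R -> R) (speed cost : R -> R -> R).
Hypothesis dyn : flow drift action speed cost.

Let drift_chasles := flow_drift_chasles dyn.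
Let action_chasles := flow_action_chasles dyn.
Let action_tangent := flow_action_tangent dyn.
Let drift_norm_le := flow_drift_norm_le dyn.
Let action_norm_le := flow_action_norm_le dyn.
Let drift_coercive := flow_drift_coercive dyn.
Let drift_mean := flow_drift_mean dyn.
Let action_mean := flow_action_mean dyn.

Lemma drift_lt s t q q' : s < t -> q < q' -> drift s t q < drift s t q'.
Proof.
move=> st qq'; have := action_tangent st (negbT (lt_eqF qq')).
have := action_tangent st (negbT (gt_eqF qq')).
rewrite -[X in _ -> _ -> is_true X](ltr_pM2r (_ : 0 < q' - q)) ?subr_gt0//; lra.
Qed.

Lemma drift_inj s t q q' : s < t -> drift s t q = drift s t q' -> q = q'.
Proof.
move=> st E; have [//|/lt_total/orP[] /(drift_lt st)] := eqVneq q q'; rewrite E ltxx//.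
Qed.

Let driftxx t q : drift t t q = 0.
Proof. by have := drift_chasles t t t q; rewrite -{3}[drift t t q]addr0 => /addrI. Qed.

Let actionxx t q : action t t q = 0.
Proof. by have := action_chasles t t t q; rewrite -{3}[action t t q]addr0 => /addrI. Qed.

Lemma action_tangent_le s t q q' : s <= t ->
  action s t q + drift s t q * (q' - q) <= action s t q'.
Proof.
rewrite le_eqVlt => /predU1P[->|st]; first by rewrite driftxx !actionxx mul0r addr0.
have [->|qq'] := eqVneq q q'; first by rewrite subrr mulr0 addr0.
exact/ltW/action_tangent.
Qed.

Variables (U : R -> R) (M : R) (h : R -> R -> R).
Hypothesis M_ge0 : 0 <= M.
Hypothesis U_lip : forall y z, `|U y - U z| <= M * `|y - z|.
Hypothesis hP : forall t p, 0 < t -> drift 0 t (h t p) = p.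

(** The Legendre transform of [action 0 t], evaluated at the maximizer. *)
Definition conj_action t p := h t p * p - action 0 t (h t p).

Definition value x y t := conj_action t (x - y) + U y.

Definition is_min x t y := forall z, value x y t <= value x z t.

Lemma h_drift t q : 0 < t -> h t (drift 0 t q) = q.
Proof. by move=> t0; apply: (drift_inj t0); rewrite hP. Qed.

Lemma h_lt t p p' : 0 < t -> p < p' -> h t p < h t p'.
Proof.
move=> t0 pp'; rewrite ltNge; apply/negP; rewrite le_eqVlt => /predU1P[E|/(drift_lt t0)].
  by move: pp'; rewrite -(hP p t0) -(hP p' t0) E ltxx.
by rewrite !hP// => /(lt_trans pp'); rewrite ltxx.
Qed.

Lemma h_le t p p' : 0 < t -> p <= p' -> h t p <= h t p'.
Proof. by move=> t0; rewrite le_eqVlt => /predU1P[->//|/(h_lt t0)/ltW]. Qed.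

Lemma drift_le_h t p q : 0 < t -> drift 0 t q <= p -> q <= h t p.
Proof. by move=> t0 /(h_le t0); rewrite h_drift. Qed.

Lemma h_le_drift t p q : 0 < t -> p <= drift 0 t q -> h t p <= q.
Proof. by move=> t0 /(h_le t0); rewrite h_drift. Qed.

(** The inequality of Fenchel and Young, with equality at q = h t p. *)
Lemma fenchel t p q : 0 < t -> q * p - action 0 t q <= conj_action t p.
Proof.
move=> t0; have := action_tangent_le (h t p) q (ltW t0); rewrite hP// /conj_action; nra.
Qed.

(** The conjugate action is strictly convex with derivative h t. *)
Lemma conj_tangent t p p' : 0 < t -> p != p' ->
  conj_action t p + h t p * (p' - p) < conj_action t p'.
Proof.
move=> t0 pp'; have hh : h t p' != h t p.
  by apply: contra pp' => /eqP E; rewrite -(hP p t0) -(hP p' t0) E.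
have := action_tangent t0 hh; rewrite hP// /conj_action; nra.
Qed.

Lemma conj_tangent_le t p p' : 0 < t ->
  conj_action t p + h t p * (p' - p) <= conj_action t p'.
Proof.
move=> t0; have [->|pp'] := eqVneq p p'; first by rewrite subrr mulr0 addr0.
exact/ltW/conj_tangent.
Qed.

(** Moving the end point (x, t) to (x', s) at the constant slope q changes the
    value by q (x' - x) - action t s q at least; q is taken optimal at the earlier
    end here, and at the later end in the next lemma. *)
Lemma value_ge_char x y t x' s : 0 < t -> t <= s ->
  value x y t + h t (x - y) * (x' - x) - action t s (h t (x - y)) <= value x' y s.
Proof.
move=> t0 ts; have := fenchel (x' - y) (h t (x - y)) (lt_le_trans t0 ts).
rewrite -(action_chasles 0 t s) /value {2}/conj_action; nra.
Qed.

Lemma value_le_char x y t x' s : 0 < t -> t <= s ->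
  value x' y s <= value x y t + h s (x' - y) * (x' - x) - action t s (h s (x' - y)).
Proof.
move=> t0 ts; have := fenchel (x - y) (h s (x' - y)) t0.
rewrite /value {2}/conj_action -(action_chasles 0 t s); nra.
Qed.

Lemma h_bounded t0 T P : 0 < t0 -> exists2 Q, 0 <= Q & forall t p,
  t0 <= t -> t <= T -> `|p| <= P -> `|h t p| <= Q.
Proof.
move=> t00; have [Q Q0 HQ] := drift_coercive T P t00; exists Q => // t p t0t tT.
rewrite ler_norml => /andP[p1 p2]; have [H1 H2] := HQ t t0t tT.
have tp : 0 < t by exact: lt_le_trans t0t.
rewrite ler_norml; apply/andP; split.
  by apply: drift_le_h => //; exact: le_trans p1.
by apply: h_le_drift => //; exact: le_trans H1.
Qed.

Lemma drift_time_cont q t e : 0 < t -> 0 < e ->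
  exists2 d, 0 < d & forall s, `|s - t| < d -> `|drift 0 s q - drift 0 t q| < e.
Proof.
move=> t0 e0; have [C C0 HC] := drift_norm_le `|q| (t + t).
exists (Num.min t (e / (C + 1))).
  by rewrite lt_min t0 divr_gt0// ltr_wpDl.
move=> s; rewrite lt_min => /andP[st]; rewrite ltr_pdivlMr; last by rewrite ltr_wpDl.
have s0 : 0 <= s by move: st; rewrite ltr_norml; lra.
have sT : s <= t + t by move: st; rewrite ltr_norml; lra.
move=> H; have E : C * `|s - t| < e by have := normr_ge0 (s - t); nra.
have [ts|/ltW ts] := leP t s.
  rewrite -(drift_chasles 0 t s) addrC addKr.
  apply: le_lt_trans E; rewrite (ger0_norm (_ : 0 <= s - t)) ?subr_ge0//.
  by apply: HC => //; exact: ltW.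
rewrite -(drift_chasles 0 s t) opprD addrA subrr add0r normrN.
apply: le_lt_trans E; rewrite distrC (ger0_norm (_ : 0 <= t - s)) ?subr_ge0//.
by apply: HC => //; rewrite lerDl ltW.
Qed.

(** h is an inverse function: it is enough that drift 0 t separates p strictly from
    its values at h t p +- e/2, and depends continuously on time. *)
Lemma h_cont p t e : 0 < t -> 0 < e -> exists2 d, 0 < d & forall p' t',
  `|p' - p| < d -> `|t' - t| < d -> `|h t' p' - h t p| < e.
Proof.
move=> t0 e0; set q := h t p.
have e2 : 0 < e / 2 by rewrite divr_gt0.
have lo : drift 0 t (q - e / 2) < p by rewrite -[X in _ < X](hP p t0); apply: drift_lt => //; rewrite /q; lra.
have hi : p < drift 0 t (q + e / 2) by rewrite -[X in X < _](hP p t0); apply: drift_lt => //; rewrite /q; lra.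
pose g1 := (p - drift 0 t (q - e / 2)) / 2.
pose g2 := (drift 0 t (q + e / 2) - p) / 2.
have g10 : 0 < g1 by rewrite divr_gt0// subr_gt0.
have g20 : 0 < g2 by rewrite divr_gt0// subr_gt0.
have [d1 d10 H1] := drift_time_cont (q - e / 2) t0 g10.
have [d2 d20 H2] := drift_time_cont (q + e / 2) t0 g20.
exists (Num.min (Num.min d1 d2) (Num.min t (Num.min g1 g2))); first by rewrite !lt_min; do !(apply/andP; split).
move=> p' t'; rewrite !lt_min => /and3P[_ _ /andP[pg1 pg2]] /and3P[/andP[td1 td2] tt _].
have t'0 : 0 < t' by move: tt; rewrite ltr_norml; lra.
have := H1 _ td1; have := H2 _ td2; move: pg1 pg2; rewrite !ltr_norml => pg1 pg2 K2 K1.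
have E1 : drift 0 t (q - e / 2) = p - 2 * g1 by rewrite /g1; field.
have E2 : drift 0 t (q + e / 2) = p + 2 * g2 by rewrite /g2; field.
have : q - e / 2 <= h t' p' by apply: drift_le_h => //; lra.
have : h t' p' <= q + e / 2 by apply: h_le_drift => //; lra.
by move=> A B; apply/andP; split; lra.
Qed.

Lemma value_lip_y x t N : 0 < t -> exists2 C, 0 <= C & forall y y',
  `|y| <= N -> `|y'| <= N -> `|value x y t - value x y' t| <= C * `|y - y'|.
Proof.
move=> t0; have [Q Q0 HQ] := h_bounded t (`|x| + N) t0.
exists (Q + M) => [|y y' yN y'N]; first exact: addr_ge0.
have bd z : `|z| <= N -> `|h t (x - z)| <= Q.
  by move=> zN; apply: HQ => //; rewrite (le_trans (ler_normB _ _))// lerD2l.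
have := conj_tangent_le (x - y) (x - y') t0; have := conj_tangent_le (x - y') (x - y) t0.
rewrite (_ : x - y - (x - y') = y' - y); last by ring.
rewrite (_ : x - y' - (x - y) = y - y'); last by ring.
have n1 : `|h t (x - y') * (y' - y)| <= Q * `|y - y'| by rewrite normrM distrC ler_wpM2r// bd.
have n2 : `|h t (x - y) * (y - y')| <= Q * `|y - y'| by rewrite normrM ler_wpM2r// bd.
have := U_lip y y'; move: n1 n2; rewrite /value mulrDl !ler_norml.
move=> *; apply/andP; split; lra.
Qed.

Lemma value_cont x t N : 0 < t -> exists C, exists2 d, 0 < d & 0 <= C /\ forall x' t' y,
  `|x' - x| < d -> `|t' - t| < d -> `|y| <= N ->
  `|value x' y t' - value x y t| <= C * (`|x' - x| + `|t' - t|).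
Proof.
move=> t0; have t20 : 0 < t / 2 by rewrite divr_gt0.
have [Q Q0 HQ] := h_bounded (t + t) (`|x| + 1 + N) t20.
have [C C0 HC] := action_norm_le Q (t + t).
exists (Q + C); exists (Num.min 1 (t / 2)); first by rewrite lt_min ltr01.
split; first exact: addr_ge0.
move=> x' t' y; rewrite !lt_min => /andP[x1 _] /andP[_ tt] yN.
have t'1 : t / 2 <= t' by move: tt; rewrite ltr_norml; lra.
have t'2 : t' <= t + t by move: tt; rewrite ltr_norml; lra.
have t'0 : 0 < t' by exact: lt_le_trans t'1.
have b1 : `|h t' (x' - y)| <= Q.
  apply: HQ => //; rewrite (le_trans (ler_normB _ _))// lerD//.
  rewrite -[x'](subrK x) (le_trans (ler_normD _ _))// addrC lerD2l.
  exact: ltW.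
have b2 : `|h t (x - y)| <= Q.
  apply: HQ => //; [lra|lra|].
  rewrite (le_trans (ler_normB _ _))// lerD// lerDl//.
have m1 : `|h t' (x' - y) * (x' - x)| <= Q * `|x' - x| by rewrite normrM ler_wpM2r.
have m2 : `|h t (x - y) * (x' - x)| <= Q * `|x' - x| by rewrite normrM ler_wpM2r.
have CQ1 := mulr_ge0 C0 (normr_ge0 (x' - x)).
have CQ2 := mulr_ge0 Q0 (normr_ge0 (t' - t)).
have [ts|/ltW ts] := leP t t'.
  have := value_le_char x y x' t0 ts; have := value_ge_char x y x' t0 ts.
  have := HC _ _ _ b1 (ltW t0) ts t'2; have := HC _ _ _ b2 (ltW t0) ts t'2.
  move: m1 m2 CQ2; rewrite !mulrDl !mulrDr (ger0_norm (_ : 0 <= t' - t)) ?subr_ge0//.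
  rewrite !ler_norml; move=> *; apply/andP; split; lra.
have t2 : t <= t + t by rewrite lerDl ltW.
have := value_le_char x' y x t'0 ts; have := value_ge_char x' y x t'0 ts.
have := HC _ _ _ b1 (ltW t'0) ts t2; have := HC _ _ _ b2 (ltW t'0) ts t2.
move: m1 m2 CQ2; rewrite !mulrDl !mulrDr [`|t' - t|]distrC (ger0_norm (_ : 0 <= t - t')) ?subr_ge0//.
rewrite !ler_norml; move=> *; apply/andP; split; lra.
Qed.

(** At slopes beyond M the convex part of the value grows faster than U can
    compensate. This bounds the slopes of all minimizing characteristics. *)
Lemma is_min_h x t y : 0 < t -> is_min x t y -> `|h t (x - y)| <= M.
Proof.
move=> t0 my; rewrite ler_norml; apply/andP; split; rewrite leNgt; apply/negP => hM.
  pose p := drift 0 t (- M).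
  have xp : x - y < p by rewrite -(hP (x - y) t0); exact: drift_lt.
  have := my (x - p); rewrite /value (_ : x - (x - p) = p); last by ring.
  have := conj_tangent t0 (negbT (gt_eqF xp)); rewrite h_drift//.
  have := U_lip (x - p) y; rewrite ler_norml.
  rewrite distrC (_ : y - (x - p) = p - (x - y)); last by ring.
  rewrite (gtr0_norm (_ : 0 < p - (x - y))) ?subr_gt0//; nra.
pose p := drift 0 t M.
have xp : p < x - y by rewrite -(hP (x - y) t0); exact: drift_lt.
have := my (x - p); rewrite /value (_ : x - (x - p) = p); last by ring.
have := conj_tangent t0 (negbT (lt_eqF xp)); rewrite h_drift//.
have := U_lip (x - p) y; rewrite ler_norml.
rewrite (_ : x - p - y = (x - y) - p); last by ring.
rewrite (gtr0_norm (_ : 0 < x - y - p)) ?subr_gt0//; nra.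
Qed.

Lemma value_y_cont x t : 0 < t -> continuous (fun y => value x y t).
Proof.
move=> t0 y; have [C C0 HC] := value_lip_y x (`|y| + 1) t0.
apply/cvgrPdist_lt => e e0; apply/nbhs_ballP; exists (Num.min 1 (e / (C + 1))) => /=.
  by rewrite lt_min ltr01 divr_gt0// ltr_wpDl.
move=> y'; rewrite /ball/= lt_min ltr_pdivlMr; last by rewrite ltr_wpDl.
move=> /andP[d1 d2]; apply: le_lt_trans (HC y y' _ _) _.
- by rewrite lerDl.
- rewrite -[y'](subrK y) (le_trans (ler_normD _ _))// addrC lerD2l distrC.
  exact: ltW.
- by rewrite (le_lt_trans _ d2)// mulrC ler_wpM2l// lerDl.
Qed.

Lemma is_min_bounds x t y : 0 < t -> is_min x t y ->
  x - drift 0 t M <= y <= x - drift 0 t (- M).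
Proof.
move=> t0 /(is_min_h t0); rewrite ler_norml => /andP[h1 h2].
have H q q' : q <= q' -> drift 0 t q <= drift 0 t q'.
  by rewrite le_eqVlt => /predU1P[->//|/(drift_lt t0)/ltW].
move/H: h1; move/H: h2; rewrite hP//; lra.
Qed.

Lemma is_min_exists x t : 0 < t -> exists y, is_min x t y.
Proof.
move=> t0; pose a := x - drift 0 t M; pose b := x - drift 0 t (- M).
have ab : a <= b.
  rewrite /a /b lerD2l lerN2; move: M_ge0; rewrite le_eqVlt => /predU1P[<-|M0].
    by rewrite oppr0.
  by apply/ltW/drift_lt => //; rewrite (lt_trans _ M0)// oppr_lt0.
have cw : {within `[a, b], continuous (fun y => value x y t)}.
  by apply: continuous_subspaceT; exact: value_y_cont.
have [c cab Hc] := EVT_min ab cw.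
have ca : value x c t <= value x a t by apply: Hc; rewrite in_itv/= lexx.
have cb : value x c t <= value x b t by apply: Hc; rewrite in_itv/= lexx ab.
have ha : h t (x - a) = M.
  by rewrite /a (_ : x - (x - _) = drift 0 t M) ?h_drift//; ring.
have hb : h t (x - b) = - M.
  by rewrite /b (_ : x - (x - _) = drift 0 t (- M)) ?h_drift//; ring.
exists c => z; have [za|az] := ltP z a.
  apply: (le_trans ca); have := conj_tangent_le (x - a) (x - z) t0.
  rewrite ha /value.
  rewrite (_ : x - z - (x - a) = a - z); last by ring.
  have := U_lip a z; rewrite (gtr0_norm (_ : 0 < a - z)) ?subr_gt0// ler_norml; lra.
have [bz|zb] := ltP b z; last by apply: Hc; rewrite in_itv/= az.
apply: (le_trans cb); have := conj_tangent_le (x - b) (x - z) t0.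
rewrite hb /value.
rewrite (_ : x - z - (x - b) = b - z); last by ring.
have := U_lip z b; rewrite (gtr0_norm (_ : 0 < z - b)) ?subr_gt0// ler_norml; lra.
Qed.

Lemma is_min_closed x t m : 0 < t ->
  (forall d, 0 < d -> exists2 y, is_min x t y & `|m - y| < d) -> is_min x t m.
Proof.
move=> t0 H z; rewrite leNgt; apply/negP => zm.
have zm0 : 0 < value x m t - value x z t by rewrite subr_gt0.
have := @value_y_cont x t t0 m => /cvgrPdist_lt /(_ _ zm0) /nbhs_ballP[d /= d0 Hd].
have [y my md] := H d d0; have := Hd y md; rewrite /= ltr_norml; have := my z; lra.
Qed.

Lemma least_min_exists x t : 0 < t ->
  exists y, is_min x t y /\ forall z, is_min x t z -> y <= z.
Proof.
move=> t0; pose S := [set y | is_min x t y].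
have hi : has_inf S.
  split; first by have [y] := is_min_exists x t0; exists y.
  by exists (x - drift 0 t M) => y /(is_min_bounds t0)/andP[].
exists (inf S); split; last by move=> z mz; apply: ge_inf => //; case: hi.
apply: is_min_closed => // d d0; have [y Sy yd] := inf_adherent d0 hi.
exists y => //; rewrite distrC ger0_norm ?subr_ge0; last by apply: ge_inf => //; case: hi.
by rewrite ltrBlDl.
Qed.

Lemma greatest_min_exists x t : 0 < t ->
  exists y, is_min x t y /\ forall z, is_min x t z -> z <= y.
Proof.
move=> t0; pose S := [set y | is_min x t y].
have hi : has_sup S.
  split; first by have [y] := is_min_exists x t0; exists y.
  by exists (x - drift 0 t (- M)) => y /(is_min_bounds t0)/andP[].
exists (sup S); split; last by move=> z mz; apply: ub_le_sup => //; case: hi.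
apply: is_min_closed => // d d0; have [y Sy yd] := sup_adherent d0 hi.
exists y => //; rewrite ger0_norm ?subr_ge0; last by apply: ub_le_sup => //; case: hi.
by rewrite ltrBlDl -ltrBlDr.
Qed.

(** On the compact interval the value exceeds its minimum over the line by a
    positive gap, which survives small changes of (x, t). All the semicontinuity
    used below comes from this. *)
Lemma no_min_stable x t a b : 0 < t -> a <= b ->
  (forall y, a <= y <= b -> ~ is_min x t y) ->
  exists2 d, 0 < d & forall x' t' y, `|x' - x| < d -> `|t' - t| < d ->
    a <= y <= b -> ~ is_min x' t' y.
Proof.
move=> t0 ab nomin; have [y0 my0] := is_min_exists x t0.
have cw : {within `[a, b], continuous (fun y => value x y t)}.
  by apply: continuous_subspaceT; exact: value_y_cont.
have [c cab Hc] := EVT_min ab cw.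
have gap : 0 < value x c t - value x y0 t.
  rewrite subr_gt0 ltNge; apply/negP => cy0.
  by apply: (nomin c cab) => z; exact: le_trans (my0 z).
set gp := _ - _ in gap.
have [C [d d0 [C0 HC]]] := value_cont x (`|a| + `|b| + `|y0|) t0.
have C10 : 0 < 4 * (C + 1) by rewrite mulr_gt0// ltr_wpDl.
exists (Num.min d (gp / (4 * (C + 1)))); first by rewrite lt_min d0 divr_gt0.
move=> x' t' y; rewrite !lt_min !ltr_pdivlMr// => /andP[xd xg] /andP[td tg] yab my.
have n0 : `|y0| <= `|a| + `|b| + `|y0| by rewrite lerDr addr_ge0.
have ny : `|y| <= `|a| + `|b| + `|y0|.
  move/andP: yab => []; have := ler_norm b; have := ler_norm (- a); rewrite normrN.
  have := normr_ge0 a; have := normr_ge0 b; have := normr_ge0 y0.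
  by rewrite ler_norml => *; apply/andP; split; lra.
have := HC _ _ _ xd td ny; have := HC _ _ _ xd td n0.
have := my y0; have := Hc y yab.
have E : C * (`|x' - x| + `|t' - t|) < gp / 2.
  rewrite mulrDr; have := normr_ge0 (x' - x); have := normr_ge0 (t' - t); lra.
rewrite !ler_norml; move: E; rewrite /gp; lra.
Qed.

(** Minimizing characteristics do not cross, as exchanging the feet of two that do
    would lower the sum of the values, by strict convexity of the conjugate
    action. *)
Lemma is_min_mono x1 x2 t y1 y2 : 0 < t -> x1 < x2 ->
  is_min x1 t y1 -> is_min x2 t y2 -> y1 <= y2.
Proof.
move=> t0 x12 m1 m2; rewrite leNgt; apply/negP => y21.
have := m1 y2; have := m2 y1; rewrite /value.
have ab : x1 - y1 != x1 - y2 by apply: contraTneq y21 => /addrI/oppr_inj ->; rewrite ltxx.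
have cd : x2 - y1 != x2 - y2 by apply: contraTneq y21 => /addrI/oppr_inj ->; rewrite ltxx.
have ac : x1 - y1 != x2 - y1 by apply: contraTneq x12 => /addIr ->; rewrite ltxx.
have bd : x1 - y2 != x2 - y2 by apply: contraTneq x12 => /addIr ->; rewrite ltxx.
have [bc|/ltW cb] := leP (x1 - y2) (x2 - y1).
  rewrite eq_sym in ab; have := conj_tangent t0 ab; have := conj_tangent t0 cd.
  have := h_le t0 bc.
  rewrite -(ler_pM2r (_ : 0 < y1 - y2)) ?subr_gt0//.
  rewrite (_ : x2 - y2 - (x2 - y1) = y1 - y2); last by ring.
  rewrite (_ : x1 - y1 - (x1 - y2) = - (y1 - y2)); last by ring.
  rewrite mulrN; lra.
rewrite eq_sym in ac; have := conj_tangent t0 ac; have := conj_tangent t0 bd.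
have := h_le t0 cb.
rewrite -(ler_pM2r (_ : 0 < x2 - x1)) ?subr_gt0//.
rewrite (_ : x2 - y2 - (x1 - y2) = x2 - x1); last by ring.
rewrite (_ : x1 - y1 - (x2 - y1) = - (x2 - x1)); last by ring.
rewrite mulrN; lra.
Qed.

(** Along a minimizing characteristic the minimizer is unique at earlier times:
    by the equality case of the convex inequality between t and s, any other
    minimizer at the intermediate point would leave with the same slope. *)
Lemma backward_unique x s t y : 0 < t -> t < s -> is_min x s y ->
  let z := x - drift t s (h s (x - y)) in
  is_min z t y /\ forall y', is_min z t y' -> y' = y.
Proof.
move=> t0 ts my z; have s0 : 0 < s by exact: lt_trans ts.
set q := h s (x - y) in z *.
have zy : h t (z - y) = q.
  rewrite -[RHS](h_drift q t0); congr h; rewrite /z.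
  by have := drift_chasles 0 t s q; rewrite [drift 0 s q]hP//; lra.
have vx : value x y s = value z y t + q * (x - z) - action t s q.
  have := value_ge_char z y x t0 (ltW ts); rewrite zy.
  by have := value_le_char z y x t0 (ltW ts); rewrite -/q; lra.
have xz : x - z = drift t s q by rewrite /z; ring.
have key y' : value z y t + (action t s (h s (x - y')) - action t s q
    - drift t s q * (h s (x - y') - q)) <= value z y' t.
  have := my y'; have := value_le_char z y' x t0 (ltW ts); rewrite vx xz; lra.
split.
  move=> y'; apply: le_trans (key y'); rewrite lerDl.
  by have := action_tangent_le q (h s (x - y')) (ltW ts); lra.
move=> y' my'; have := my' y; have := key y'.
have [qq|/(action_tangent ts)] := eqVneq q (h s (x - y')); last lra.
have : drift 0 s q = drift 0 s (h s (x - y')) by rewrite qq.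
by rewrite /q !hP//; lra.
Qed.

Variables ylow yupp : R -> R -> R.
Hypothesis ylowP : forall x t, 0 < t ->
  is_min x t (ylow x t) /\ forall z, is_min x t z -> ylow x t <= z.
Hypothesis yuppP : forall x t, 0 < t ->
  is_min x t (yupp x t) /\ forall z, is_min x t z -> z <= yupp x t.

Lemma ylow_min x t : 0 < t -> is_min x t (ylow x t).
Proof. by move=> /(ylowP x)[]. Qed.

Lemma yupp_min x t : 0 < t -> is_min x t (yupp x t).
Proof. by move=> /(yuppP x)[]. Qed.

Lemma ylow_le_yupp x t : 0 < t -> ylow x t <= yupp x t.
Proof. by move=> t0; apply: (ylowP x t0).2; exact: yupp_min. Qed.

(** Characteristics have bounded speed, because their slopes are bounded. *)
Lemma min_dist T : exists2 C, 0 <= C & forall x t y,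
  0 < t -> t <= T -> is_min x t y -> `|x - y| <= C * t.
Proof.
have [C C0 HC] := drift_norm_le M T; exists C => // x t y t0 tT /(is_min_h t0) hM.
rewrite -(hP (x - y) t0) -[X in _ * X]subr0; apply: HC => //; exact: ltW.
Qed.

Lemma yupp_le_ylow x1 x2 t : 0 < t -> x1 < x2 -> yupp x1 t <= ylow x2 t.
Proof. by move=> t0 x12; apply: (is_min_mono t0 x12); [exact: yupp_min|exact: ylow_min]. Qed.

Lemma ylow_mono t x1 x2 : 0 < t -> x1 <= x2 -> ylow x1 t <= ylow x2 t.
Proof.
move=> t0; rewrite le_eqVlt => /predU1P[->//|/(yupp_le_ylow t0)].
exact/le_trans/ylow_le_yupp.
Qed.

Lemma yupp_mono t x1 x2 : 0 < t -> x1 <= x2 -> yupp x1 t <= yupp x2 t.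
Proof.
move=> t0; rewrite le_eqVlt => /predU1P[->//|/(yupp_le_ylow t0)] H.
exact: le_trans H (ylow_le_yupp _ t0).
Qed.

(** No minimizer lies in ]-oo, c], and minimizers near (x, t) stay in a fixed
    bounded region, so that compactness of the rest of the half-line suffices. *)
Lemma ylow_lsc x t c : 0 < t -> c < ylow x t -> exists2 d, 0 < d &
  forall x' t', `|x' - x| < d -> `|t' - t| < d -> c < ylow x' t'.
Proof.
move=> t0 cy; have [C C0 HC] := min_dist (t + t).
pose a := Num.min c (x - 1 - C * (t + t)).
have ac : a <= c by rewrite ge_min lexx.
have nomin y : a <= y <= c -> ~ is_min x t y.
  by move=> /andP[_ yc] /(ylowP x t0).2; rewrite leNgt (le_lt_trans yc).
have [d d0 Hd] := no_min_stable t0 ac nomin.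
exists (Num.min d (Num.min 1 t)); first by rewrite !lt_min d0 ltr01.
move=> x' t'; rewrite !lt_min => /and3P[xd x1 _] /and3P[td _ tt].
have t'0 : 0 < t' by move: tt; rewrite ltr_norml; lra.
have t'T : t' <= t + t by move: tt; rewrite ltr_norml; lra.
rewrite ltNge; apply/negP => yc.
apply: (Hd x' t' (ylow x' t')) => //; last exact: ylow_min.
rewrite yc andbT ge_min; apply/orP; right.
have := HC x' t' _ t'0 t'T (ylow_min x' t'0).
have : C * t' <= C * (t + t) by rewrite ler_wpM2l.
by move: x1; rewrite ltr_norml ler_norml; lra.
Qed.

Lemma yupp_usc x t c : 0 < t -> yupp x t < c -> exists2 d, 0 < d &
  forall x' t', `|x' - x| < d -> `|t' - t| < d -> yupp x' t' < c.
Proof.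
move=> t0 cy; have [C C0 HC] := min_dist (t + t).
pose b := Num.max c (x + 1 + C * (t + t)).
have cb : c <= b by rewrite le_max lexx.
have nomin y : c <= y <= b -> ~ is_min x t y.
  by move=> /andP[cy' _] /(yuppP x t0).2; rewrite leNgt (lt_le_trans cy).
have [d d0 Hd] := no_min_stable t0 cb nomin.
exists (Num.min d (Num.min 1 t)); first by rewrite !lt_min d0 ltr01.
move=> x' t'; rewrite !lt_min => /and3P[xd x1 _] /and3P[td _ tt].
have t'0 : 0 < t' by move: tt; rewrite ltr_norml; lra.
have t'T : t' <= t + t by move: tt; rewrite ltr_norml; lra.
rewrite ltNge; apply/negP => yc.
apply: (Hd x' t' (yupp x' t')) => //; last exact: yupp_min.
rewrite yc/= le_max; apply/orP; right.
have := HC x' t' _ t'0 t'T (yupp_min x' t'0).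
have : C * t' <= C * (t + t) by rewrite ler_wpM2l.
by move: x1; rewrite ltr_norml ler_norml; lra.
Qed.

(** The curve t |-> level t c separates the points whose minimizer lies to the
    left of c from the others: it is the generalized characteristic from c. *)
Definition level t c := sup [set x | ylow x t <= c].

Lemma level_has_sup t c : 0 < t -> has_sup [set x | ylow x t <= c].
Proof.
move=> t0; have [C C0 HC] := min_dist t; split.
  exists (c - C * t) => /=; have := HC (c - C * t) t _ t0 (lexx _) (ylow_min _ t0).
  by rewrite ler_norml; lra.
exists (c + C * t) => x /=; have := HC x t _ t0 (lexx _) (ylow_min _ t0).
by rewrite ler_norml; lra.
Qed.

(** Lower semicontinuity makes y_low left continuous in x, so the half-line is
    closed. *)
Lemma level_le x t c : 0 < t -> (ylow x t <= c) = (x <= level t c).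
Proof.
move=> t0; have hs := level_has_sup c t0; apply/idP/idP => [yc|].
  by apply: ub_le_sup => //; case: hs.
apply: contraTT; rewrite -!ltNge => /(ylow_lsc t0)[d d0 Hd].
have d20 : 0 < d / 2 by rewrite divr_gt0.
apply: (@le_lt_trans _ _ (x - d / 2)); last lra.
apply: ge_sup; first by case: hs.
move=> z /= zc; rewrite leNgt; apply/negP => xz.
have [zx|xz'] := leP z x.
  have : c < ylow z t.
    by apply: Hd; rewrite ?subrr ?normr0// ltr_norml; apply/andP; split; lra.
  by rewrite ltNge zc.
have : c < ylow x t by apply: Hd; rewrite subrr normr0.
rewrite ltNge => /negP; apply.
by apply: le_trans zc; apply: ylow_mono => //; exact: ltW.
Qed.

Lemma level_gt x t c : 0 < t -> (c < ylow x t) = (level t c < x).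
Proof. by move=> t0; rewrite !ltNge level_le. Qed.

Lemma ylow_level t c : 0 < t -> ylow (level t c) t <= c.
Proof. by move=> t0; rewrite level_le. Qed.

Lemma yupp_level t c : 0 < t -> c <= yupp (level t c) t.
Proof.
move=> t0; rewrite leNgt; apply/negP => /(yupp_usc t0)[d d0 Hd].
have d20 : 0 < d / 2 by rewrite divr_gt0.
have : yupp (level t c + d / 2) t < c.
  by apply: Hd; rewrite ?subrr ?normr0// ltr_norml; apply/andP; split; lra.
rewrite ltNge => /negP; apply.
apply: le_trans (ylow_le_yupp _ t0); apply: ltW; rewrite level_gt//; lra.
Qed.

Lemma level_mono t c c' : 0 < t -> c <= c' -> level t c <= level t c'.
Proof. by move=> t0 cc'; rewrite -level_le// (le_trans _ cc')// ylow_level. Qed.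

Lemma level_dist T : exists2 C, 0 <= C & forall t c,
  0 < t -> t <= T -> `|level t c - c| <= C * t.
Proof.
have [C C0 HC] := min_dist T; exists C => // t c t0 tT.
have := HC _ _ _ t0 tT (ylow_min (level t c) t0).
have := HC _ _ _ t0 tT (yupp_min (level t c) t0).
have := ylow_level c t0; have := yupp_level c t0; rewrite !ler_norml => *.
by apply/andP; split; lra.
Qed.

(** All but countably many c. As ylow is monotone in x, such a c is not its value on
    any interval; this excludes the points c from which a rarefaction fan
    issues. *)
Definition generic t c := forall r : rat, ylow (ratr r) t != c.

(** Tracing the two extreme minimizers at (level s c, s) back to time t gives
    points on either side of level t c. *)
Lemma level_sandwich t s c : 0 < t -> t < s -> generic t c ->
  let x := level t c in let x' := level s c in
  drift t s (h s (x' - yupp x' s)) <= x' - x <= drift t s (h s (x' - ylow x' s)) /\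
  (ylow x t != yupp x t -> ylow x' s <= ylow x t /\ yupp x t <= yupp x' s).
Proof.
move=> t0 ts gc x x'; have s0 : 0 < s by exact: lt_trans ts.
have [z1 z1E [mz1 uz1]] : exists2 z1, z1 = x' - drift t s (h s (x' - ylow x' s)) &
    is_min z1 t (ylow x' s) /\ forall y, is_min z1 t y -> y = ylow x' s.
  by eexists; [reflexivity|exact: (backward_unique t0 ts (ylow_min x' s0))].
have [z2 z2E [mz2 uz2]] : exists2 z2, z2 = x' - drift t s (h s (x' - yupp x' s)) &
    is_min z2 t (yupp x' s) /\ forall y, is_min z2 t y -> y = yupp x' s.
  by eexists; [reflexivity|exact: (backward_unique t0 ts (yupp_min x' s0))].
have z1x : z1 <= x.
  by rewrite -level_le// (uz1 _ (ylow_min _ t0)) ylow_level.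
have xz2 : x <= z2.
  rewrite leNgt; apply/negP => z2x.
  have [r] := rat_in_itvoo z2x; rewrite in_itv/= => /andP[z2r rx].
  have := gc r; rewrite eq_le => /negP; apply; rewrite level_le// ltW//=.
  apply: (le_trans (yupp_level c s0)); rewrite -/x' -(uz2 _ (ylow_min _ t0)).
  by apply: ylow_mono => //; exact: ltW.
split; first by move: z1x xz2; rewrite z1E z2E => *; apply/andP; split; lra.
move=> irr; split.
  have z1x' : z1 < x.
    rewrite lt_neqAle z1x andbT; apply: contra irr => /eqP <-.
    by rewrite (uz1 _ (ylow_min _ t0)) (uz1 _ (yupp_min _ t0)).
  exact: (is_min_mono t0 z1x' mz1 (ylow_min _ t0)).
have xz2' : x < z2.
  rewrite lt_neqAle xz2 andbT; apply: contra irr => /eqP ->.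
  by rewrite (uz2 _ (ylow_min _ t0)) (uz2 _ (yupp_min _ t0)).
exact: (is_min_mono t0 xz2' (yupp_min _ t0) mz2).
Qed.

(** Both characteristics of [level_sandwich] have bounded speed. *)
Lemma level_lipschitz T : exists2 C, 0 <= C & forall t s c,
  0 < t -> t <= s -> s <= T -> generic t c ->
  `|level s c - level t c| <= C * (s - t).
Proof.
have [C C0 HC] := drift_norm_le M T; exists C => // t s c t0.
rewrite le_eqVlt => /predU1P[-> _ _|ts sT gc]; first by rewrite !subrr normr0 mulr0.
have s0 : 0 < s by exact: lt_trans ts.
have [/andP[H1 H2] _] := level_sandwich t0 ts gc.
have := HC _ t s (is_min_h s0 (ylow_min (level s c) s0)) (ltW t0) (ltW ts) sT.
have := HC _ t s (is_min_h s0 (yupp_min (level s c) s0)) (ltW t0) (ltW ts) sT.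
by move: H1 H2; rewrite !ler_norml => *; apply/andP; split; lra.
Qed.

(** The speed of the curves: the characteristic speed where the minimizer is
    unique, and otherwise the Rankine-Hugoniot speed. *)
Definition vel x t :=
  if ylow x t == yupp x t then speed (h t (x - ylow x t)) t
  else (cost (h t (x - ylow x t)) t - cost (h t (x - yupp x t)) t) /
       (h t (x - ylow x t) - h t (x - yupp x t)).

Lemma level_right_cont t c e : 0 < t -> generic t c -> 0 < e ->
  exists2 d, 0 < d & forall s, t < s -> s < t + d -> `|level s c - level t c| < e.
Proof.
move=> t0 gc e0; have [C C0 HC] := level_lipschitz (t + t).
exists (Num.min t (e / (C + 1))); first by rewrite lt_min t0 divr_gt0// ltr_wpDl.
move=> s ts; rewrite -ltrBlDl lt_min ltr_pdivlMr; last by rewrite ltr_wpDl.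
move=> /andP[s2 sd]; apply: le_lt_trans (HC t s c t0 (ltW ts) _ gc) _; first lra.
by apply: le_lt_trans sd; rewrite mulrC ler_wpM2l ?lerDl// subr_ge0 ltW.
Qed.

(** Where the minimizer is unique it is continuous, so both characteristics that
    enclose the curve have slopes close to q0. *)
Let level_deriv_regular t c e : 0 < t -> generic t c -> 0 < e ->
  ylow (level t c) t = yupp (level t c) t ->
  exists2 d, 0 < d & forall s, t < s -> s < t + d ->
    `|level s c - level t c - speed (h t (level t c - ylow (level t c) t)) t * (s - t)|
      <= e * (s - t).
Proof.
move=> t0 gc e0 reg; set x := level t c in reg *.
have yc : ylow x t = c.
  by apply/eqP; rewrite eq_le {2}reg ylow_level//= yupp_level.
rewrite yc; set q0 := h t (x - c).
have [d1 d10 H1] := drift_mean q0 t e0.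
have [d2 d20 H2] := h_cont (x - c) t0 d10.
have d2' : 0 < d2 / 2 by rewrite divr_gt0.
have lo : c - d2 / 2 < ylow x t by rewrite yc; lra.
have hi : yupp x t < c + d2 / 2 by rewrite -reg yc; lra.
have [d3 d30 H3] := ylow_lsc t0 lo.
have [d4 d40 H4] := yupp_usc t0 hi.
have e1 : 0 < Num.min (d2 / 2) (Num.min d3 d4) by rewrite !lt_min d2' d30.
have [d5 d50 H5] := level_right_cont t0 gc e1.
exists (Num.min (Num.min d1 d2) (Num.min d5 (Num.min d3 d4))).
  by rewrite !lt_min d10 d20 d50 d30.
move=> s ts; rewrite -ltrBlDl !lt_min => /andP[/andP[s1 s2] /and3P[s5 s3 s4]].
have s0 : 0 < s by exact: lt_trans ts.
have st : `|s - t| = s - t by rewrite gtr0_norm// subr_gt0.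
have := H5 s ts; rewrite -ltrBlDl => /(_ s5); rewrite !lt_min => /and3P[x2 x3 x4].
have yl : c - d2 / 2 < ylow (level s c) s by apply: H3 => //; rewrite st.
have yu : yupp (level s c) s < c + d2 / 2 by apply: H4 => //; rewrite st.
have yl' := ylow_level c s0; have yu' := yupp_level c s0.
have [/andP[K1 K2] _] := level_sandwich t0 ts gc.
have Q1 : `|h s (level s c - ylow (level s c) s) - q0| < d1.
  apply: H2; last by rewrite st.
  by move: x2; rewrite !ltr_norml -/x => *; apply/andP; split; lra.
have Q2 : `|h s (level s c - yupp (level s c) s) - q0| < d1.
  apply: H2; last by rewrite st.
  by move: x2; rewrite !ltr_norml -/x => *; apply/andP; split; lra.
have sd : s < t + d1 by rewrite -ltrBlDl.
have := H1 _ s Q1 (ltW ts) sd; have := H1 _ s Q2 (ltW ts) sd.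
by move: K1 K2; rewrite -/x !ler_norml => *; apply/andP; split; lra.
Qed.

(** At a shock, each of the extreme minimizers at either end competes with those
    of the opposite side at the other end (I1 and I2 below). To first order, both
    inequalities compare q (x' - x) - cost q t (s - t) at q1 and at q2, in
    opposite directions; the resulting equality is the jump condition. *)
Let level_deriv_shock t c e : 0 < t -> generic t c -> 0 < e ->
  ylow (level t c) t != yupp (level t c) t ->
  let q1 := h t (level t c - ylow (level t c) t) in
  let q2 := h t (level t c - yupp (level t c) t) in
  exists2 d, 0 < d & forall s, t < s -> s < t + d ->
    `|level s c - level t c - (cost q1 t - cost q2 t) / (q1 - q2) * (s - t)|
      <= e * (s - t).
Proof.
move=> t0 gc e0 irr q1 q2; set x := level t c in irr q1 q2 *.
have yy : ylow x t < yupp x t by rewrite lt_neqAle irr ylow_le_yupp.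
have q12 : 0 < q1 - q2 by rewrite subr_gt0; apply: h_lt => //; lra.
have [C C0 HC] := level_lipschitz (t + t).
have C1 : 0 < 2 * (C + 1) by rewrite mulr_gt0// ltr_wpDl.
(* n is chosen so that the errors n (C + 1) (s - t) made at q1 and at q2 add up to
   e (q1 - q2) (s - t). *)
pose n := e * (q1 - q2) / (2 * (C + 1)).
have n0 : 0 < n by rewrite divr_gt0// mulr_gt0.
have [d1 d10 H1] := action_mean q1 t n0.
have [d2 d20 H2] := action_mean q2 t n0.
pose k := Num.min n (Num.min d1 d2).
have k0 : 0 < k by rewrite !lt_min n0 d10.
have [d3 d30 H3] := h_cont (x - ylow x t) t0 k0.
have [d4 d40 H4] := h_cont (x - yupp x t) t0 k0.
have lo : ylow x t - d3 < ylow x t by lra.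
have hi : yupp x t < yupp x t + d4 by lra.
have [d5 d50 H5] := ylow_lsc t0 lo.
have [d6 d60 H6] := yupp_usc t0 hi.
have e1 : 0 < Num.min (Num.min d3 d4) (Num.min d5 d6) by rewrite !lt_min d30 d40 d50.
have [d7 d70 H7] := level_right_cont t0 gc e1.
exists (Num.min (Num.min (Num.min d1 d2) (Num.min d3 d4))
                (Num.min (Num.min d5 d6) (Num.min d7 t))).
  by rewrite !lt_min d10 d20 d30 d40 d50 d60 d70.
move=> s ts; rewrite -ltrBlDl !lt_min.
move=> /andP[/andP[/andP[s1 s2] /andP[s3 s4]] /andP[/andP[s5 s6] /andP[s7 st2]]].
have s0 : 0 < s by exact: lt_trans ts.
have st : `|s - t| = s - t by rewrite gtr0_norm// subr_gt0.
have sT : s <= t + t by rewrite -lerBlDl ltW.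
have xC := HC t s c t0 (ltW ts) sT gc.
have sd1 : s < t + d1 by rewrite -ltrBlDl.
have sd2 : s < t + d2 by rewrite -ltrBlDl.
have near1 q : `|q - q1| < k ->
    `|q * (level s c - x) - action t s q - (q1 * (level s c - x) - cost q1 t * (s - t))| <= n * (C + 1) * (s - t).
  rewrite !lt_min => /and3P[qn qd _]; have := H1 q s qd (ltW ts) sd1.
  have : `|(q - q1) * (level s c - x)| <= n * (C * (s - t)).
    by rewrite normrM ler_pM// ltW.
  by rewrite !ler_norml => *; apply/andP; split; lra.
have near2 q : `|q - q2| < k ->
    `|q * (level s c - x) - action t s q - (q2 * (level s c - x) - cost q2 t * (s - t))| <= n * (C + 1) * (s - t).
  rewrite !lt_min => /and3P[qn _ qd]; have := H2 q s qd (ltW ts) sd2.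
  have : `|(q - q2) * (level s c - x)| <= n * (C * (s - t)).
    by rewrite normrM ler_pM// ltW.
  by rewrite !ler_norml => *; apply/andP; split; lra.
have := H7 s ts; rewrite -ltrBlDl => /(_ s7); rewrite !lt_min.
move=> /andP[/andP[x3 x4] /andP[x5 x6]].
have yl : ylow x t - d3 < ylow (level s c) s by apply: H5 => //; rewrite st.
have yu : yupp (level s c) s < yupp x t + d4 by apply: H6 => //; rewrite st.
have [_ /(_ irr)[yl' yu']] := level_sandwich t0 ts gc.
rewrite -/x in xC near1 near2 x3 x4 x5 x6 yl' yu' *; set x' := level s c in xC near1 near2 x3 x4 x5 x6 yl yu yl' yu' *.
clear H1 H2 H5 H6 H7 HC.
have := H3 (x - ylow x' s) t; rewrite subrr normr0.
rewrite (_ : x - ylow x' s - (x - ylow x t) = ylow x t - ylow x' s); last by ring.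
rewrite ger0_norm ?subr_ge0// => /(_ _ d30) Qa; have {}Qa := Qa ltac:(lra).
have := H4 (x - yupp x' s) t; rewrite subrr normr0.
rewrite (_ : x - yupp x' s - (x - yupp x t) = - (yupp x' s - yupp x t)); last by ring.
rewrite normrN ger0_norm ?subr_ge0// => /(_ _ d40) Qb; have {}Qb := Qb ltac:(lra).
have := H3 (x' - ylow x t) s; rewrite st.
rewrite (_ : x' - ylow x t - (x - ylow x t) = x' - x); last by ring.
move=> /(_ x3 s3) Qc.
have := H4 (x' - yupp x t) s; rewrite st.
rewrite (_ : x' - yupp x t - (x - yupp x t) = x' - x); last by ring.
move=> /(_ x4 s4) Qd.
have I1 : h t (x - yupp x' s) * (x' - x) - action t s (h t (x - yupp x' s)) <=
    h s (x' - ylow x t) * (x' - x) - action t s (h s (x' - ylow x t)).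
  have := value_ge_char x (yupp x' s) x' t0 (ltW ts).
  have := value_le_char x (ylow x t) x' t0 (ltW ts).
  have := yupp_min x' s0 (ylow x t); have := ylow_min x t0 (yupp x' s); lra.
have I2 : h t (x - ylow x' s) * (x' - x) - action t s (h t (x - ylow x' s)) <=
    h s (x' - yupp x t) * (x' - x) - action t s (h s (x' - yupp x t)).
  have := value_ge_char x (ylow x' s) x' t0 (ltW ts).
  have := value_le_char x (yupp x t) x' t0 (ltW ts).
  have := ylow_min x' s0 (yupp x t); have := yupp_min x t0 (ylow x' s); lra.
have nE : n * (C + 1) = e * (q1 - q2) / 2.
  by rewrite /n; field; apply: lt0r_neq0; rewrite ltr_wpDl.
have dE : q1 - q2 != 0 by rewrite gt_eqF.
rewrite (_ : x' - x - _ = ((q1 - q2) * (x' - x) - (cost q1 t - cost q2 t) * (s - t)) / (q1 - q2));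
  last by field.
rewrite normrM normfV (gtr0_norm q12) ler_pdivrMr//.
have := near1 _ Qa; have := near1 _ Qc; have := near2 _ Qb; have := near2 _ Qd.
move: I1 I2; rewrite nE.
move: (h t (x - yupp x' s)) (h s (x' - ylow x t)) (h t (x - ylow x' s)) (h s (x' - yupp x t)).
move=> qa qb qc qd I1 I2; rewrite !ler_norml => /andP[A1 A2] /andP[B1 B2] /andP[D1 D2] /andP[E1 E2].
by apply/andP; split; lra.
Qed.

Lemma level_deriv t c e : 0 < t -> generic t c -> 0 < e ->
  exists2 d, 0 < d & forall s, t < s -> s < t + d ->
    `|level s c - level t c - vel (level t c) t * (s - t)| <= e * (s - t).
Proof.
move=> t0 gc e0; rewrite /vel; case: eqVneq => [reg|irr].
  exact: level_deriv_regular.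
exact: level_deriv_shock.
Qed.

(** Points traced back from slightly later times are regular, and they are
    dense because they are displaced by little. *)
Lemma regular_dense a b t : 0 < t -> a < b ->
  exists2 z, a < z < b & ylow z t = yupp z t.
Proof.
move=> t0 ab; have [C C0 HC] := drift_norm_le M (t + 1).
pose d := Num.min 1 ((b - a) / 2 / (C + 1)).
have ba : 0 < (b - a) / 2 by rewrite divr_gt0// subr_gt0.
have C1 : 0 < C + 1 by rewrite ltr_wpDl.
have d0 : 0 < d by rewrite lt_min ltr01 divr_gt0.
have d1 : d <= 1 by rewrite ge_min lexx.
have dC : d * (C + 1) <= (b - a) / 2 by rewrite -ler_pdivlMr// ge_min lexx orbT.
have td : t < t + d by rewrite ltrDl.
have s0 : 0 < t + d by lra.
have mx := ylow_min ((a + b) / 2) s0.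
have [z zE [mz uz]] : exists2 z, z = (a + b) / 2 - drift t (t + d)
      (h (t + d) ((a + b) / 2 - ylow ((a + b) / 2) (t + d))) &
    is_min z t (ylow ((a + b) / 2) (t + d)) /\
    forall y, is_min z t y -> y = ylow ((a + b) / 2) (t + d).
  by eexists; [reflexivity|exact: (backward_unique t0 td mx)].
exists z; last by rewrite (uz _ (ylow_min _ t0)) (uz _ (yupp_min _ t0)).
have tE : t + d - t = d by ring.
have := HC _ t (t + d) (is_min_h s0 mx) (ltW t0) (ltW td) ltac:(lra).
rewrite tE ler_norml; move: zE; set k := drift _ _ _ => zE /andP[k1 k2].
by apply/andP; split; lra.
Qed.

(** As x is approached from the left the minimizers tend to the least one, from
    the right to the greatest one. *)
Lemma slope_left x t e : 0 < t -> 0 < e -> exists2 d, 0 < d & forall z,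
  x - d < z -> z < x -> `|h t (z - ylow z t) - h t (x - ylow x t)| < e.
Proof.
move=> t0 e0; have [d1 d10 H1] := h_cont (x - ylow x t) t0 e0.
have d12 : 0 < d1 / 2 by rewrite divr_gt0.
have lo : ylow x t - d1 / 2 < ylow x t by lra.
have [d2 d20 H2] := ylow_lsc t0 lo.
exists (Num.min (d1 / 2) d2); first by rewrite lt_min d12.
move=> z xz zx; have := xz; rewrite ltrBlDr -ltrBlDl lt_min => /andP[z1 z2].
apply: H1; last by rewrite subrr normr0.
have := ylow_mono t0 (ltW zx).
have : ylow x t - d1 / 2 < ylow z t.
  by apply: H2; rewrite ?subrr ?normr0// ltr_norml; apply/andP; split; lra.
by rewrite ltr_norml => *; apply/andP; split; lra.
Qed.

Lemma slope_right x t e : 0 < t -> 0 < e -> exists2 d, 0 < d & forall z,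
  x < z -> z < x + d -> `|h t (z - ylow z t) - h t (x - yupp x t)| < e.
Proof.
move=> t0 e0; have [d1 d10 H1] := h_cont (x - yupp x t) t0 e0.
have d12 : 0 < d1 / 2 by rewrite divr_gt0.
have hi : yupp x t < yupp x t + d1 / 2 by lra.
have [d2 d20 H2] := yupp_usc t0 hi.
exists (Num.min (d1 / 2) d2); first by rewrite lt_min d12.
move=> z xz zx; have := zx; rewrite -ltrBlDl lt_min => /andP[z1 z2].
apply: H1; last by rewrite subrr normr0.
have := yupp_le_ylow t0 xz; have := ylow_le_yupp z t0.
have : yupp z t < yupp x t + d1 / 2.
  by apply: H2; rewrite ?subrr ?normr0// ltr_norml; apply/andP; split; lra.
by rewrite ltr_norml => *; apply/andP; split; lra.
Qed.

End hopf_lax.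

(** * Integrals transported by the level curves *)

Section clamp.
Context {R : realType}.

Lemma quotient_split (p a b c h : R) : h != 0 ->
  (a + h * b - p) / h = c + (b - c) + (a - p) / h.
Proof. by move=> h0; field. Qed.

Lemma scaled_diff0 (r x y : R) : x = y -> r * (x + (-1) * y) = 0.
Proof. by move=> ->; rewrite mulN1r subrr mulr0. Qed.

Lemma outside_shifted (a b t e : R) : 0 <= e -> e <= 1 ->
  ~ (a - 1 <= t <= b) -> t + e <= a \/ b <= t + e.
Proof.
move=> e0 e1 tab; have [ta|ta] := leP (t + e) a; first by left.
right; have [tb|tb] := leP b (t + e); first by [].
by exfalso; apply: tab; apply/andP; split; lra.
Qed.

Lemma cvg_sum3 (k u v w : nat -> R) (l1 l3 : R) :
  (forall n, k n = u n + v n + w n) ->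
  u n @[n --> \oo] --> l1 -> v n @[n --> \oo] --> (0 : R) ->
  w n @[n --> \oo] --> l3 -> k n @[n --> \oo] --> l1 + l3.
Proof.
move=> E Hu Hv Hw; under eq_fun do rewrite E.
by rewrite -[l1]addr0; apply: cvgD Hw; exact: cvgD.
Qed.

Definition clamp (a b t : R) := Num.min (Num.max t a) b.

Lemma clamp_ge (a b t : R) : a <= b -> a <= clamp a b t.
Proof. by move=> ab; rewrite /clamp le_min le_max lexx orbT. Qed.

Lemma clamp_le (a b t : R) : clamp a b t <= b.
Proof. by rewrite /clamp ge_min lexx orbT. Qed.

Lemma clamp_lipschitz (a b s t : R) : `|clamp a b s - clamp a b t| <= `|s - t|.
Proof.
wlog st : s t / s <= t.
  move=> H; have [/H//|/ltW/H] := leP s t.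
  by rewrite distrC [`|t - s|]distrC.
rewrite [leRHS]distrC (ger0_norm (_ : 0 <= t - s)) ?subr_ge0//.
rewrite ler_norml /clamp /Num.max /Num.min.
by case: (ltP s a) => ?; case: (ltP t a) => ?; case: ltP => ?; case: ltP => ?;
  apply/andP; split; lra.
Qed.

(** It is enough to compare times in [a, b], since clamping to [a, b] changes
    neither the values of K nor increases distances. *)
Lemma lipschitz_compact (K : R -> R) (a b E : R) : a <= b -> 0 <= E ->
  (forall t, t <= a \/ b <= t -> K t = 0) ->
  (forall t s, a <= t -> t <= s -> s <= b -> `|K s - K t| <= E * (s - t)) ->
  forall s t, `|K s - K t| <= E * `|s - t|.
Proof.
move=> ab E0 K0 HK.
have clP t : K t = K (clamp a b t).
  rewrite /clamp; have [ta|at_] := leP t a.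
    by rewrite (min_idPl ab) !K0//; left.
  by have [tb|bt] := leP t b => //; rewrite !K0//; right => //; exact: ltW.
move=> s t; rewrite (clP s) (clP t).
apply: (le_trans _ (ler_wpM2l E0 (clamp_lipschitz a b s t))).
have := clamp_ge s ab; have := clamp_ge t ab.
have := clamp_le a b s; have := clamp_le a b t.
move: (clamp a b s) (clamp a b t) => x y yb xb ay ax.
have [xy|/ltW yx] := leP x y.
  by rewrite distrC [`|x - _|]distrC (ger0_norm (_ : 0 <= y - x)) ?subr_ge0//; exact: HK.
by rewrite (ger0_norm (_ : 0 <= x - y)) ?subr_ge0//; exact: HK.
Qed.

End clamp.

Section transport.
Context {R : realType}.
Notation oint := oriented_integral.
Notation mu := (@lebesgue_measure R).
Variables (ylow level vel : R -> R -> R) (rho : R -> R) (M : R).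
Hypothesis rho_meas : measurable_fun setT rho.
Hypothesis rhoM : forall c, `|rho c| <= M.
Hypothesis ylow_mono : forall t x1 x2, 0 < t -> x1 <= x2 -> ylow x1 t <= ylow x2 t.
Hypothesis level_le : forall x t c, 0 < t -> (ylow x t <= c) = (x <= level t c).
Hypothesis level_mono : forall t c c', 0 < t -> c <= c' -> level t c <= level t c'.
Hypothesis ylow_dist : forall T : R, exists2 C : R, 0 <= C & forall x t,
  0 < t -> t <= T -> `|x - ylow x t| <= C * t.
Notation generic t c := (forall r : rat, ylow (ratr r) t != c).
Hypothesis level_lipschitz : forall T : R, exists2 C : R, 0 <= C & forall t s c,
  0 < t -> t <= s -> s <= T -> generic t c -> `|level s c - level t c| <= C * (s - t).
Hypothesis level_deriv : forall t c e : R, 0 < t -> generic t c -> 0 < e ->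
  exists2 d : R, 0 < d & forall s, t < s -> s < t + d ->
    `|level s c - level t c - vel (level t c) t * (s - t)| <= e * (s - t).

Definition carried x t := oint rho 0 (ylow x t).

Let lrho : loc_bounded_Borel rho.
Proof. exact: bounded_loc_bounded_Borel rhoM. Qed.

Let M0 : 0 <= M. Proof. by rewrite (le_trans _ (rhoM 0)). Qed.

Lemma ylow_meas t : 0 < t -> measurable_fun setT (ylow ^~ t).
Proof. by move=> t0; apply: nondecreasing_measurable => // x y; exact: ylow_mono. Qed.

Lemma level_meas t : 0 < t -> measurable_fun setT (level t).
Proof. by move=> t0; apply: nondecreasing_measurable => // x y; exact: level_mono. Qed.

Lemma carried_meas t : 0 < t -> measurable_fun setT (carried ^~ t).
Proof.
move=> t0; apply: (@measurableT_comp _ _ _ _ _ _ (oint rho 0)); last exact: ylow_meas.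
by apply: continuous_measurable_fun; exact: oint_continuous lrho rhoM.
Qed.

Lemma carried_norm (L T : R) : exists2 W : R, 0 <= W & forall x t,
  0 < t -> t <= T -> `|x| <= L -> `|carried x t| <= W.
Proof.
have [C C0 HC] := ylow_dist T; exists (M * (`|L| + C * `|T|)).
  by rewrite mulr_ge0// addr_ge0// mulr_ge0.
move=> x t t0 tT xL; have := oint_lipschitz lrho rhoM 0 (ylow x t) 0.
rewrite ointxx !subr0 => /le_trans; apply; rewrite ler_wpM2l//.
have Ct : C * t <= C * `|T| by rewrite ler_wpM2l// (le_trans tT)// ler_norm.
have := HC x t t0 tT; have := ler_norm L; move: xL; rewrite !ler_norml.
move: (ylow x t) => y /andP[x1 x2] Lx /andP[y1 y2]; apply/andP; split; lra.
Qed.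

Lemma carried_loc_bounded t : 0 < t -> loc_bounded_Borel (carried ^~ t).
Proof.
move=> t0; split; first exact: carried_meas.
by move=> N; have [W _ HW] := carried_norm N t; exists W => x xN; exact: HW.
Qed.

Let genset t := ~` range (fun r : rat => ylow (ratr r) t).

Let genset_generic t c : genset t c -> generic t c.
Proof. by move=> gc r; apply/eqP => yc; apply: gc; exists r. Qed.

Let genset_meas t : measurable (genset t).
Proof. by apply: measurableC; exact: (countable_range_rat _).1. Qed.

Let oint_genset (t : R) (F : R -> R) (a b : R) : oint F a b = oint (F \_ (genset t)) a b.
Proof.
have [mZ Z0] := countable_range_rat (fun r : rat => ylow (ratr r) t).
have H D : \int[mu]_(x in D) F x = \int[mu]_(x in D) (F \_ (genset t)) x.
  congr fine; apply: (@integral_off_null _ (measurableTypeR R) R mu _ _ _ _ mZ Z0).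
  by move=> x _ Zx; rewrite patchE mem_set.
by rewrite /oriented_integral !H.
Qed.

Section at_most_T.
Variables (L T : R).
Hypothesis L0 : 0 <= L.
Hypothesis T0 : 0 < T.

Let LL : - L <= L.
Proof. by rewrite (le_trans _ L0)// oppr_le0. Qed.

Let range_bound : exists2 N : R, 0 <= N & forall x t : R, 0 < t -> t <= T ->
  `|x| <= L -> - N < ylow x t < N.
Proof.
have [C C0 HC] := ylow_dist T; exists (L + C * T + 1).
  by rewrite !addr_ge0// mulr_ge0// ltW.
move=> x t t0 tT; have := HC x t t0 tT.
have : C * t <= C * T by rewrite ler_wpM2l.
by rewrite !ler_norml => *; apply/andP; split; lra.
Qed.

(** Fubini in the variables x and c, where c < ylow x t iff level t c < x. For each
    c, the integral over x is the mass of psi to the right of the curve from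
    c. The last term accounts for the base point 0 of the primitive of rho,
    which replaces - N. *)
Lemma carried_Fubini (N : R) (psi : R -> R) (t : R) : 0 <= N ->
  (forall x, `|x| <= L -> - N < ylow x t < N) -> 0 < t ->
  continuous psi -> (forall x, L <= `|x| -> psi x = 0) ->
  oint (fun x => psi x * carried x t) (- L) L =
  oint (fun c => rho c * oint psi (level t c) L) (- N) N
    - oint rho (- N) 0 * oint psi (- L) L.
Proof.
move=> N0 yN t0 cpsi psi0; have lpsi := continuous_loc_bounded_Borel cpsi.
have NN : - N <= N by rewrite (le_trans _ N0)// oppr_le0.
have [B HB] : exists B, forall x, `|psi x| <= B.
  have [_ /(_ L)[B HB]] := lpsi; exists B => x.
  have [xL|Lx] := leP `|x| L; first exact: HB.
  by rewrite psi0 ?normr0 ?(ltW Lx)// (le_trans _ (HB 0 _)) ?normr0.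
pose k (p : R * R) := psi p.1 * (if p.2 < ylow p.1 t then rho p.2 else 0).
have B0 : 0 <= B by rewrite (le_trans _ (HB 0)).
have kB p : `|k p| <= B * M.
  by rewrite /k normrM ler_pM//; case: ifP => _ //; rewrite normr0.
have mk : measurable_fun setT k.
  apply: measurable_funM.
    by apply: measurableT_comp; [exact: continuous_measurable_fun|exact: measurable_fst].
  apply: measurable_fun_ifT => //.
    apply: measurable_fun_ltr; first exact: measurable_snd.
    by apply: (measurableT_comp (ylow_meas t0)); exact: measurable_fst.
  by apply: (measurableT_comp rho_meas); exact: measurable_snd.
have := Fubini_box (- L) L (- N) N mk kB.
rewrite -(ointE (fun x => \int[mu]_(y in `[- N, N]) k (x, y)) LL).
rewrite -(ointE (fun y => \int[mu]_(x in `[- L, L]) k (x, y)) NN).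
have lcut (y : R) : loc_bounded_Borel (fun c => if c < y then rho c else 0).
  apply: (bounded_loc_bounded_Borel (M := M)) => [|c]; last by case: ifP; rewrite ?normr0.
  by apply: measurable_fun_ifT => //; exact: measurable_fun_ltr.
have L1 x : `|x| <= L -> \int[mu]_(c in `[- N, N]) k (x, c) = psi x * oint rho (- N) (ylow x t).
  move=> /yN /andP[y1 y2]; rewrite /k /= -ointE// ointZ//; congr (_ * _).
  rewrite [RHS]ointE ?ltW// -Rintegral_itv_bndo_bndc; last first.
    apply: integrableS (loc_bounded_integrable (- N) (ylow x t) lrho) => //.
    exact: subset_itv_co_cc.
  have -> : `[- N, ylow x t[%classic = `[- N, N] `&` [set c | c < ylow x t] :> set R.
    apply/seteqP; split => c /=; rewrite !in_itv/=.
      by move=> /andP[-> c2]; split => //=; rewrite ltW// (lt_trans c2).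
    by move=> [/andP[-> _] ->].
  rewrite Rintegral_mkcondr ointE//; apply: eq_Rintegral => c _.
  by rewrite patchE; case: ifPn => h; [rewrite mem_set|rewrite memNset//; apply/negP].
have L2 c : \int[mu]_(x in `[- L, L]) k (x, c) = rho c * oint psi (level t c) L.
  rewrite /k /= -ointE// -(oint_cut (level t c) L0 lpsi psi0) -ointZ; last first.
    case: (lpsi) => mpsi bpsi; apply: (bounded_loc_bounded_Borel (M := B)) => [|x].
      by apply: measurable_fun_ifT => //; exact: measurable_fun_ltr.
    by case: ifP => _; rewrite ?normr0.
  apply: eq_oint => x _; rewrite ltNge level_le// -ltNge.
  by case: ifP => _; rewrite ?mulr0// mulrC.
have -> : oint (fun x => \int[mu]_(y in `[- N, N]) k (x, y)) (- L) L =
    oint (fun x => psi x * oint rho (- N) (ylow x t)) (- L) L.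
  apply: eq_oint => x xL; apply: L1; rewrite ler_norml; case: xL => // /andP[xL Lx].
  by rewrite (le_trans LL xL) (le_trans Lx LL).
have -> : oint (fun y => \int[mu]_(x in `[- L, L]) k (x, y)) (- N) N =
    oint (fun c => rho c * oint psi (level t c) L) (- N) N.
  by apply: eq_oint => c _; exact: L2.
move=> <-; rewrite -(ointZ _ _ _ lpsi).
have lw : loc_bounded_Borel (fun x => psi x * carried x t).
  by apply: loc_bounded_BorelM => //; exact: carried_loc_bounded.
have lr : loc_bounded_Borel (fun x => oint rho (- N) 0 * psi x).
  by apply: loc_bounded_BorelM => //; exact: loc_bounded_cst.
apply/eqP; rewrite -subr_eq opprK -ointD//; apply/eqP; apply: eq_oint => x _.
by rewrite -(oint_chasles 0 (- N) (ylow x t) lrho) /carried; ring.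
Qed.

Let increment (t s : R) (psi : R -> R) (c : R) := rho c * oint psi (level t c) (level s c).

Let carried_increment (N : R) (psi : R -> R) (t s : R) : 0 <= N ->
  (forall x t, 0 < t -> t <= T -> `|x| <= L -> - N < ylow x t < N) ->
  0 < t -> t <= s -> s <= T ->
  continuous psi -> (forall x, L <= `|x| -> psi x = 0) -> forall B, (forall x, `|psi x| <= B) ->
  measurable_fun setT (increment t s psi \_ (genset t)) /\
  oint (fun x => psi x * carried x s) (- L) L - oint (fun x => psi x * carried x t) (- L) L
  = - oint (increment t s psi \_ (genset t)) (- N) N.
Proof.
move=> N0 yN t0 ts sT cpsi psi0 B HB; have lpsi := continuous_loc_bounded_Borel cpsi.
have s0 : 0 < s by exact: lt_le_trans ts.
have cP (a : R) : continuous (oint psi a) by exact: oint_continuous lpsi HB.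
have mP u : 0 < u -> measurable_fun setT (fun c => oint psi (level u c) L).
  move=> u0; have -> : (fun c => oint psi (level u c) L) = (fun c => - oint psi L (level u c)).
    by apply/funext => c; rewrite oint_opp.
  apply: measurableT_comp => //.
  apply: (@measurableT_comp _ _ _ _ _ _ (oint psi L)); last exact: level_meas.
  exact: continuous_measurable_fun.
have lP u : 0 < u -> loc_bounded_Borel (fun c => rho c * oint psi (level u c) L).
  move=> u0; apply: loc_bounded_BorelM => //; split; first exact: mP.
  move=> m; exists (B * (`|L| + (`|level u (- m)| + `|level u m|))) => c cm.
  have := oint_lipschitz lpsi HB L L (level u c); rewrite ointxx add0r normrN.
  rewrite oint_opp normrN => /le_trans; apply; rewrite ler_wpM2l//.
    by rewrite (le_trans _ (HB 0)).
  rewrite (le_trans (ler_normB _ _))// lerD2l.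
  move: cm; rewrite ler_norml => /andP[c1 c2].
  have := level_mono u0 c1; have := level_mono u0 c2.
  have := ler_norm (level u m); have := ler_norm (- level u (- m)); rewrite normrN.
  have := normr_ge0 (level u m); have := normr_ge0 (level u (- m)).
  move: (level u m) (level u (- m)) (level u c) => a1 a2 a3; rewrite ler_norml => *.
  by apply/andP; split; lra.
have incE : increment t s psi = (fun c => rho c * oint psi (level t c) L - rho c * oint psi (level s c) L).
  apply/funext => c; rewrite /increment.
  by rewrite -(oint_chasles (level s c) (level t c) L lpsi); ring.
have minc : measurable_fun setT (increment t s psi).
  by rewrite incE; apply: measurable_funB; apply: measurable_funM => //; exact: mP.
split.
  by apply/(measurable_restrictT _ _).1; [exact: genset_meas|exact: measurable_funS minc].
rewrite (carried_Fubini N0 (fun x => yN x s s0 sT) s0 cpsi psi0).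
rewrite (carried_Fubini N0 (fun x => yN x t t0 (le_trans ts sT)) t0 cpsi psi0).
rewrite -oint_genset incE.
have E : oint (fun c => rho c * oint psi (level t c) L) (- N) N =
  oint (fun c => rho c * oint psi (level t c) L - rho c * oint psi (level s c) L) (- N) N
  + oint (fun c => rho c * oint psi (level s c) L) (- N) N.
  rewrite -ointD//; [by apply: eq_oint => c _; rewrite subrK| |exact: lP].
  rewrite -incE; split => // m.
  have [_ /(_ m)[B1 H1]] := lP t t0; have [_ /(_ m)[B2 H2]] := lP s s0.
  exists (B1 + B2) => c cm; rewrite incE (le_trans (ler_normB _ _))// lerD ?H1 ?H2//.
by rewrite E; ring.
Qed.

Let increment_norm : exists2 C : R, 0 <= C & forall (psi : R -> R) (B : R), continuous psi ->
  (forall x, `|psi x| <= B) -> forall t s, 0 < t -> t <= s -> s <= T -> forall c,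
  `|(increment t s psi \_ (genset t)) c| <= C * B * (s - t).
Proof.
have [C C0 HC] := level_lipschitz T; exists (M * C); first exact: mulr_ge0.
move=> psi B cpsi HB t s t0 ts sT c; have lpsi := continuous_loc_bounded_Borel cpsi.
have B0 : 0 <= B by rewrite (le_trans _ (HB 0)).
rewrite patchE; case: ifPn => [|_]; last first.
  by rewrite normr0 mulr_ge0 ?subr_ge0// mulr_ge0// mulr_ge0.
rewrite inE => /genset_generic gc; rewrite /increment normrM -!mulrA ler_pM//.
have := oint_lipschitz lpsi HB (level t c) (level s c) (level t c).
rewrite ointxx subr0 => /le_trans; apply; rewrite mulrCA ler_wpM2l//.
exact: HC.
Qed.

(** The mass of psi between the positions of a curve at times t and s is bounded
    by the distance between them. The constant depends on psi only through its
    bound, so that psi may itself vary with time. *)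
Lemma carried_lipschitz : exists2 C : R, 0 <= C & forall (psi : R -> R) (B : R), continuous psi ->
  (forall x, L <= `|x| -> psi x = 0) -> (forall x, `|psi x| <= B) ->
  forall t s, 0 < t -> t <= s -> s <= T ->
  `|oint (fun x => psi x * carried x s) (- L) L - oint (fun x => psi x * carried x t) (- L) L|
    <= C * B * (s - t).
Proof.
have [N N0 yN] := range_bound; have [C C0 HC] := increment_norm.
exists (C * (N + N)); first by rewrite mulr_ge0// addr_ge0.
move=> psi B cpsi psi0 HB t s t0 ts sT.
have [minc ->] := carried_increment N0 yN t0 ts sT cpsi psi0 HB.
rewrite normrN (_ : _ * B * (s - t) = C * B * (s - t) * (N - - N)); last by ring.
apply: oint_norm_le; last by move=> c _; exact: HC.
- by apply: bounded_loc_bounded_Borel minc _; exact: (HC psi B).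
- by rewrite (le_trans _ N0)// oppr_le0.
Qed.

Let increment_deriv (t c : R) (psi : R -> R) (B e : R) : 0 < t -> generic t c -> continuous psi ->
  (forall x, `|psi x| <= B) -> 0 < e ->
  exists2 d, 0 < d & forall s, t < s -> s < t + d ->
  `|oint psi (level t c) (level s c) - psi (level t c) * vel (level t c) t * (s - t)|
     <= e * (s - t).
Proof.
move=> t0 gc cpsi HB e0; set x0 := level t c; set v := vel x0 t.
have v1 : 0 < 2 * (`|v| + 1) by rewrite mulr_gt0// ltr_wpDl.
have p1 : 0 < 2 * (`|psi x0| + 1) by rewrite mulr_gt0// ltr_wpDl.
pose e1 := e / (2 * (`|v| + 1)); pose e2 := Num.min 1 (e / (2 * (`|psi x0| + 1))).
have e10 : 0 < e1 by rewrite divr_gt0.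
have e20 : 0 < e2 by rewrite lt_min ltr01 divr_gt0.
have [d1 d10 H1] := oint_first_order x0 cpsi e10.
have [d2 d20 H2] := level_deriv t0 gc e20.
exists (Num.min d2 (d1 / (`|v| + 1))).
  by rewrite lt_min d20 divr_gt0// ltr_wpDl.
move=> s ts; rewrite -ltrBlDl lt_min ltr_pdivlMr; last by rewrite ltr_wpDl.
move=> /andP[sd2 sd1]; have st0 : 0 < s - t by rewrite subr_gt0.
have := H2 s ts; rewrite -ltrBlDl => /(_ sd2); rewrite -/x0 -/v => K2.
have D : `|level s c - x0| <= (`|v| + 1) * (s - t).
  rewrite -[level s c - x0](subrK (v * (s - t))) (le_trans (ler_normD _ _))//.
  rewrite mulrDl mul1r addrC normrM (gtr0_norm st0) lerD2l (le_trans K2)//.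
  by rewrite ler_piMl ?(ltW st0)// ge_min lexx.
have Dd : `|level s c - x0| < d1 by rewrite (le_lt_trans D)// mulrC.
have K1 := H1 _ Dd.
have K3 : e1 * `|level s c - x0| <= e / 2 * (s - t).
  rewrite (_ : e / 2 * (s - t) = e1 * ((`|v| + 1) * (s - t))).
    by rewrite ler_wpM2l// ltW.
  by rewrite /e1; field; rewrite gt_eqF// ltr_wpDl.
have K4 : `|psi x0 * (level s c - x0 - v * (s - t))| <= e / 2 * (s - t).
  rewrite normrM; apply: (@le_trans _ _ ((`|psi x0| + 1) * (e2 * (s - t)))).
    by rewrite ler_pM// lerDl.
  rewrite mulrA ler_wpM2r ?(ltW st0)// (mulrC (_ + 1)) -ler_pdivlMr; last by rewrite ltr_wpDl.
  rewrite /e2 ge_min; apply/orP; right; rewrite le_eqVlt; apply/orP; left; apply/eqP.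
  by field; rewrite gt_eqF// ltr_wpDl.
rewrite (_ : oint psi x0 (level s c) - _ = (oint psi x0 (level s c) - psi x0 * (level s c - x0))
  + psi x0 * (level s c - x0 - v * (s - t))); last by ring.
rewrite (le_trans (ler_normD _ _))// (_ : e * (s - t) = e / 2 * (s - t) + e / 2 * (s - t)); last by field.
by rewrite lerD// (le_trans K1).
Qed.

(** Every curve contributes its own speed. Difference quotients along 1 / (n + 1)
    suffice, and allow for dominated convergence along a sequence. *)
Lemma carried_deriv (psi : R -> R) (t : R) : continuous psi ->
  (forall x, L <= `|x| -> psi x = 0) -> 0 < t -> t + 1 <= T ->
  (oint (fun x => psi x * carried x (t + harmonic n)) (- L) L
     - oint (fun x => psi x * carried x t) (- L) L) / harmonic n @[n --> \oo] -->
  - \int[mu]_c (psi (level t c) * vel (level t c) t * rho c).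
Proof.
move=> cpsi psi0 t0 tT; have lpsi := continuous_loc_bounded_Borel cpsi.
have [B HB] : exists B, forall x, `|psi x| <= B.
  have [_ /(_ L)[B HB]] := lpsi; exists B => x.
  have [xL|Lx] := leP `|x| L; first exact: HB.
  by rewrite psi0 ?normr0 ?(ltW Lx)// (le_trans _ (HB 0 _)) ?normr0.
have [N N0 yN] := range_bound; have [C C0 HC] := increment_norm.
have NN : - N <= N by rewrite (le_trans _ N0)// oppr_le0.
have h0 n : 0 < harmonic n :> R by rewrite /harmonic/= invr_gt0.
have h1 n : harmonic n <= 1 :> R by rewrite /harmonic/= invf_le1// ler1n.
have tt n : t <= t + harmonic n by rewrite lerDl ltW.
have tT' n : t + harmonic n <= T by rewrite (le_trans _ tT)// lerD2l.
have tleT : t <= T by rewrite (le_trans _ tT)// lerDl.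
pose F n c := (harmonic n)^-1 * (increment t (t + harmonic n) psi \_ (genset t)) c.
pose G c := ((fun c => psi (level t c) * vel (level t c) t * rho c) \_ (genset t)) c.
have minc n := (carried_increment N0 yN t0 (tt n) (tT' n) cpsi psi0 HB).1.
have linc n : loc_bounded_Borel (increment t (t + harmonic n) psi \_ (genset t)).
  by apply: bounded_loc_bounded_Borel (minc n) _; exact: (HC psi B cpsi HB t _ t0 (tt n) (tT' n)).
have mF n : measurable_fun setT (F n) by apply: measurable_funM.
have FB n c : - N <= c <= N -> `|F n c| <= C * B.
  move=> _; rewrite /F normrM gtr0_norm ?invr_gt0// mulrC ler_pdivrMr//.
  have := HC psi B cpsi HB t _ t0 (tt n) (tT' n) c.
  by rewrite (_ : t + harmonic n - t = harmonic n)//; ring.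
have FG c : - N <= c <= N -> F n c @[n --> \oo] --> G c.
  move=> _; have FE n : F n c = (harmonic n)^-1 *
      (if c \in genset t then increment t (t + harmonic n) psi c else 0).
    by rewrite /F patchE.
  rewrite /G patchE; case: ifPn => cg; last first.
    by under eq_fun do rewrite FE (negbTE cg) mulr0; exact: cvg_cst.
  have gc := genset_generic (set_mem cg); apply/cvgrPdist_le => e e0.
  have M1 : 0 < M + 1 by rewrite ltr_wpDl.
  have [d d0 Hd] := increment_deriv t0 gc cpsi HB (divr_gt0 e0 M1).
  have := @cvg_harmonic R => /cvgrPdist_lt /(_ _ d0); apply: filterS => n.
  rewrite sub0r normrN gtr0_norm// => hd.
  have := Hd (t + harmonic n); rewrite ltrDl ltrD2l => /(_ (h0 n) hd).
  rewrite (_ : t + harmonic n - t = harmonic n); last by ring.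
  rewrite FE cg /increment; set O := oint _ _ _; set v := psi _ * vel _ _ => H.
  rewrite (_ : v * rho c - _ = - (rho c * (O - v * harmonic n) / harmonic n)); last first.
    by field; rewrite gt_eqF.
  rewrite normrN normrM normfV (gtr0_norm (h0 n)) ler_pdivrMr// normrM.
  apply: (@le_trans _ _ ((M + 1) * (e / (M + 1) * harmonic n))).
    by rewrite ler_pM// (le_trans (rhoM c))// lerDl.
  by rewrite mulrA mulrCA divff ?mulr1// gt_eqF.
have [_ H] := oint_cvg NN mF FB FG.
have -> : \int[mu]_c (psi (level t c) * vel (level t c) t * rho c) = oint G (- N) N.
  rewrite /G -oint_genset ointE// [RHS]Rintegral_mkcond; apply: eq_Rintegral => c _.
  rewrite patchE; case: ifPn => //; rewrite notin_setE/= in_itv/= => cN.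
  rewrite psi0 ?mul0r//; have [c1|c1] := ltP N c.
    rewrite (le_trans _ (ler_norm _))// -level_le// (le_trans _ (ltW c1))//.
    by have := yN L t t0 tleT; rewrite (ger0_norm L0) => /(_ (lexx _))/andP[_ /ltW].
  have c2 : c < - N by rewrite ltNge; apply/negP => c2; apply: cN; rewrite c2.
  rewrite -normrN (le_trans _ (ler_norm _))// lerNr leNgt; apply/negP => /ltW.
  rewrite -level_le// leNgt => /negP; apply; rewrite (lt_trans c2)//.
  by have := yN (- L) t t0 tleT; rewrite normrN (ger0_norm L0) => /(_ (lexx _))/andP[].
have E n : (oint (fun x => psi x * carried x (t + harmonic n)) (- L) L
    - oint (fun x => psi x * carried x t) (- L) L) / harmonic n = - oint (F n) (- N) N.
  have [_ ->] := carried_increment N0 yN t0 (tt n) (tT' n) cpsi psi0 HB.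
  by rewrite /F ointZ// mulNr mulrC.
by under eq_fun do rewrite E; exact: cvgN H.
Qed.

End at_most_T.

Lemma Rintegral_supp (g : R -> R) u v : u <= v ->
  (forall t, ~ (u <= t <= v) -> g t = 0) -> \int[mu]_t g t = oint g u v.
Proof.
move=> uv g0; rewrite ointE// [RHS]Rintegral_mkcond; apply: eq_Rintegral => t _.
rewrite patchE; case: ifPn => //; rewrite notin_setE/= in_itv/= => tuv.
exact: g0.
Qed.

Section in_time.
Variables (L a b : R).
Hypothesis L0 : 0 <= L.
Hypothesis a0 : 0 < a.
Hypothesis ab : a <= b.

(** The regularity of a test function that matters here; its time derivative must
    have it too, in order that pairings with it be continuous in time. *)
Record time_lipschitz (B : R) (phi : R -> R -> R) : Prop := TimeLipschitz {
  tl_cont : forall t, continuous (phi ^~ t);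
  tl_space : forall x t, L <= `|x| -> phi x t = 0;
  tl_before : forall x t, t <= a -> phi x t = 0;
  tl_after : forall x t, b <= t -> phi x t = 0;
  tl_bound : forall x t, `|phi x t| <= B;
  tl_lip : forall x s t, `|phi x s - phi x t| <= B * `|s - t| }.

Definition pairing (phi : R -> R -> R) t :=
  oint (fun x => phi x t * carried x t) (- L) L.

Lemma pairing_lipschitz (B : R) (phi : R -> R -> R) : time_lipschitz B phi ->
  exists2 C : R, 0 <= C & forall s t : R, `|pairing phi s - pairing phi t| <= C * `|s - t|.
Proof.
move=> H; have b0 : 0 < b by exact: lt_le_trans ab.
have B0 : 0 <= B by rewrite (le_trans _ (tl_bound H 0 0)).
have LL : - L <= L by rewrite (le_trans _ L0)// oppr_le0.
have [C C0 HC] := carried_lipschitz L0 b0; have [W W0 HW] := carried_norm L b.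
pose E := C * B + B * W * (L - - L).
have E0 : 0 <= E by rewrite addr_ge0// mulr_ge0// ?mulr_ge0// subr_ge0.
have lw (psi : R -> R) t : continuous psi -> 0 < t ->
    loc_bounded_Borel (fun x => psi x * carried x t).
  move=> cpsi t0; apply: loc_bounded_BorelM; last exact: carried_loc_bounded.
  exact: continuous_loc_bounded_Borel.
have base t s : 0 < t -> t <= s -> s <= b ->
    `|pairing phi s - pairing phi t| <= E * (s - t).
  move=> t0 ts sb; have s0 : 0 < s by exact: lt_le_trans ts.
  have := HC (phi ^~ t) B (tl_cont H (t := t)) (fun x => tl_space H t) (fun x => tl_bound H x t) t s t0 ts sb.
  set I := oint _ _ _; rewrite -/(pairing phi t) => HI.
  have -> : pairing phi s = I + oint (fun x => (phi x s - phi x t) * carried x s) (- L) L.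
    rewrite -ointD; last 2 first.
    - by apply: lw => //; exact: (tl_cont H).
    - by apply: lw => // x; apply: cvgB; exact: (tl_cont H).
    by apply: eq_oint => x _; ring.
  rewrite addrAC (le_trans (ler_normD _ _))// /E mulrDl lerD//.
  rewrite (_ : _ * _ * (s - t) = B * (s - t) * W * (L - - L)); last by ring.
  apply: oint_norm_le => //.
    by apply: lw => // x; apply: cvgB; exact: (tl_cont H).
  move=> x xL; rewrite normrM ler_pM//.
    by rewrite (le_trans (tl_lip H x s t))// ger0_norm// subr_ge0.
  by apply: HW; rewrite ?ler_norml.
exists E => // s t; apply: (lipschitz_compact ab E0) => [u ub|u v au uv vb].
  by apply: oint_eq0 => x _; case: ub => ub;
    rewrite ?(tl_before H _ ub) ?(tl_after H _ ub) mul0r.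
by apply: base => //; exact: lt_le_trans au.
Qed.

Lemma pairing_cont (B : R) (phi : R -> R -> R) : time_lipschitz B phi -> continuous (pairing phi).
Proof.
move=> /pairing_lipschitz[C C0 HC] t; apply/cvgrPdist_lt => e e0.
apply/nbhs_ballP; exists (e / (C + 1)) => /=; first by rewrite divr_gt0// ltr_wpDl.
move=> y; rewrite /ball/= ltr_pdivlMr; last by rewrite ltr_wpDl.
by apply: le_lt_trans; rewrite (le_trans (HC _ _))// mulrC ler_wpM2l// lerDl.
Qed.

Variables (B : R) (phi phit : R -> R -> R).
Hypothesis phi_tl : time_lipschitz B phi.
Hypothesis phit_tl : time_lipschitz B phit.
Hypothesis phi_deriv : forall x t,
  (phi x (t + harmonic n) - phi x t) / harmonic n @[n --> \oo] --> phit x t.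

Definition flux_integral t := \int[mu]_c (phi (level t c) t * vel (level t c) t * rho c).

Let h0 n : 0 < harmonic n :> R.
Proof. by rewrite /harmonic/= invr_gt0. Qed.

Let h1 n : harmonic n <= 1 :> R.
Proof. by rewrite /harmonic/= invf_le1// ler1n. Qed.

Let LL : - L <= L.
Proof. by rewrite (le_trans _ L0)// oppr_le0. Qed.

Let B0 : 0 <= B.
Proof. by rewrite (le_trans _ (tl_bound phi_tl 0 0)). Qed.

(** Product rule: the quotient of the test function paired at time t, a correction
    that vanishes in the limit, and the motion of the curves. *)
Let pairing_deriv t : 0 < t ->
  (pairing phi (t + harmonic n) - pairing phi t) / harmonic n @[n --> \oo] -->
  pairing phit t - flux_integral t.
Proof.
move=> t0; pose q n x := (phi x (t + harmonic n) - phi x t) / harmonic n.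
have T0 : 0 < t + 1 by rewrite addr_gt0.
have cq n : continuous (q n).
  move=> x; apply: cvgM; last exact: cvg_cst.
  by apply: cvgB; exact: (tl_cont phi_tl).
have q0 n x : L <= `|x| -> q n x = 0.
  by move=> Lx; rewrite /q !(tl_space phi_tl)// subrr mul0r.
have qB n x : `|q n x| <= B.
  rewrite /q normrM normfV (gtr0_norm (h0 n)) ler_pdivrMr//.
  have := tl_lip phi_tl x (t + harmonic n) t.
  by rewrite (_ : t + harmonic n - t = harmonic n) ?(gtr0_norm (h0 n))//; ring.
have [W W0 HW] := carried_norm L (t + 1).
have [C C0 HC] := carried_lipschitz L0 T0.
have tt1 : t <= t + 1 by rewrite lerDl.
have th n : 0 < t + harmonic n by rewrite addr_gt0.
have lw (psi : R -> R) u : continuous psi -> 0 < u ->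
    loc_bounded_Borel (fun x => psi x * carried x u).
  move=> cpsi u0; apply: loc_bounded_BorelM; last exact: carried_loc_bounded.
  exact: continuous_loc_bounded_Borel.
have LA := carried_deriv L0 T0 (tl_cont phi_tl (t := t)) (fun x => tl_space phi_tl t) t0 (lexx _).
have [_ LB] : mu.-integrable `[- L, L] (EFin \o (fun x => phit x t * carried x t)) /\
    oint (fun x => q n x * carried x t) (- L) L @[n --> \oo] --> pairing phit t.
  apply: (oint_cvg (B := B * W)) => // [n|n x xL|x xL].
  - by case: (lw _ _ (cq n) t0).
  - by rewrite normrM ler_pM//; apply: HW; rewrite ?ler_norml.
  - by apply: cvgM; [exact: phi_deriv|exact: cvg_cst].
have LC : oint (fun x => q n x * carried x (t + harmonic n)) (- L) L
    - oint (fun x => q n x * carried x t) (- L) L @[n --> \oo] --> (0 : R).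
  apply/cvgrPdist_le => e e0.
  have CB1 : 0 < C * B + 1 by rewrite ltr_wpDl// mulr_ge0.
  have := @cvg_harmonic R => /cvgrPdist_lt /(_ _ (divr_gt0 e0 CB1)); apply: filterS => n.
  rewrite sub0r normrN gtr0_norm// ltr_pdivlMr// => hd; rewrite sub0r normrN.
  have := HC (q n) B (cq n) (q0 n) (qB n) t (t + harmonic n) t0.
  rewrite lerDl lerD2l => /(_ (ltW (h0 n)) (h1 n))/le_trans; apply.
  rewrite (_ : t + harmonic n - t = harmonic n); last by ring.
  rewrite (le_trans _ (ltW hd))// mulrC ler_wpM2l ?(ltW (h0 n))//.
  by rewrite lerDl.
have E n : (pairing phi (t + harmonic n) - pairing phi t) / harmonic n =
    oint (fun x => q n x * carried x t) (- L) L
    + (oint (fun x => q n x * carried x (t + harmonic n)) (- L) L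
        - oint (fun x => q n x * carried x t) (- L) L)
    + (oint (fun x => phi x t * carried x (t + harmonic n)) (- L) L
        - oint (fun x => phi x t * carried x t) (- L) L) / harmonic n.
  have -> : pairing phi (t + harmonic n) = oint (fun x => phi x t * carried x (t + harmonic n)) (- L) L
      + harmonic n * oint (fun x => q n x * carried x (t + harmonic n)) (- L) L.
    rewrite -ointZ; last by apply: lw.
    rewrite -ointD; last 2 first.
    - by apply: lw => //; exact: (tl_cont phi_tl).
    - by apply: loc_bounded_BorelM; [exact: loc_bounded_cst|exact: lw].
    by apply: eq_oint => x _; rewrite /q; field; rewrite gt_eqF.
  by apply: quotient_split; rewrite gt_eqF.
exact: (cvg_sum3 E LB LC LA).
Qed.

(** The integral over time of the difference quotients of a compactly supported
    function vanishes by translation invariance; by dominated convergence so does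
    that of their limit. The fundamental theorem of calculus would need more than
    the right derivatives that are known. *)
Lemma weak_identity : mu.-integrable `]0, +oo[ (EFin \o flux_integral) /\
  \int[mu]_(t in `]0, +oo[) pairing phit t = \int[mu]_(t in `]0, +oo[) flux_integral t.
Proof.
have [C C0 HC] := pairing_lipschitz phi_tl.
have cK := pairing_cont phi_tl; have cT := pairing_cont phit_tl.
have lK := continuous_loc_bounded_Borel cK; have lT := continuous_loc_bounded_Borel cT.
have K0 psi u : time_lipschitz B psi -> u <= a \/ b <= u -> pairing psi u = 0.
  move=> psiT ub; apply: oint_eq0 => x _; case: ub => ub;
  by rewrite ?(tl_before psiT _ ub) ?(tl_after psiT _ ub) mul0r.
have S0 u : u <= a \/ b <= u -> flux_integral u = 0.
  move=> ub; rewrite /flux_integral; transitivity (\int[mu]_(c in [set: R]) (0 : R)).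
    apply: eq_Rintegral => c _; case: ub => ub;
    by rewrite ?(tl_before phi_tl _ ub) ?(tl_after phi_tl _ ub) !mul0r.
  by rewrite Rintegral_cst// mul0r.
have a1b : a - 1 <= b by rewrite lerBlDr (le_trans ab)// lerDl.
have outside t : ~ (a - 1 <= t <= b) -> t <= a \/ b <= t.
  by move=> tab; have := outside_shifted (lexx 0) ler01 tab; rewrite addr0.
pose Q n t := (pairing phi (t + harmonic n) - pairing phi t) / harmonic n.
have cKs n : continuous (fun t : R => pairing phi (t + harmonic n)).
  move=> t; have ct : {for t, continuous (fun t : R => t + harmonic n)}.
    by rewrite /continuous_at; apply: cvgD; [exact: cvg_id|exact: cvg_cst].
  exact: (continuous_comp ct (@cK _)).
have cQ n : continuous (Q n).
  move=> t; apply: cvgM; last exact: cvg_cst.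
  by apply: cvgB; [exact: cKs|exact: cK].
have QC n t : a - 1 <= t <= b -> `|Q n t| <= C.
  move=> _; rewrite /Q normrM normfV (gtr0_norm (h0 n)) ler_pdivrMr//.
  have := HC (t + harmonic n) t.
  by rewrite (_ : t + harmonic n - t = harmonic n) ?(gtr0_norm (h0 n))//; ring.
have QD t : a - 1 <= t <= b -> Q n t @[n --> \oo] --> pairing phit t - flux_integral t.
  move=> _; have [t0|t0] := ltP 0 t; first exact: pairing_deriv.
  have ta : t <= a by rewrite (le_trans t0)// ltW.
  rewrite K0 ?S0 ?subr0; [|by left|exact: phit_tl|by left].
  apply/cvgrPdist_le => e e0.
  have := @cvg_harmonic R => /cvgrPdist_lt /(_ _ a0); apply: filterS => n.
  rewrite sub0r normrN gtr0_norm// => ha.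
  rewrite /Q (K0 phi t phi_tl); last by left.
  rewrite (K0 phi (t + harmonic n) phi_tl); last by left; lra.
  by rewrite subrr mul0r subrr normr0 ltW.
have [iD LD] := oint_cvg a1b (fun n => continuous_measurable_fun (cQ n)) QC QD.
have Q0 n : oint (Q n) (a - 1) b = 0.
  have -> : oint (Q n) (a - 1) b = (harmonic n)^-1 *
      (oint (fun t => pairing phi (t + harmonic n)) (a - 1) b + (-1) * oint (pairing phi) (a - 1) b).
    have l1 := continuous_loc_bounded_Borel (cKs n).
    have l2 := loc_bounded_BorelM (loc_bounded_cst (-1)) lK.
    rewrite -(ointZ _ _ _ lK) -(ointD _ _ l1 l2) -ointZ.
      by apply: eq_oint => t _; rewrite /Q mulN1r mulrC.
    apply: continuous_loc_bounded_Borel => t; apply: cvgD; first exact: cKs.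
    by apply: cvgM; [exact: cvg_cst|exact: cK].
  apply: scaled_diff0.
  have Z1 := @Rintegral_supp (fun t => pairing phi (t + harmonic n)) _ _ a1b.
  have Z2 := @Rintegral_supp (pairing phi) _ _ a1b.
  have Z3 := integral_translate (harmonic n) (continuous_measurable_fun cK).
  apply: (etrans (esym (Z1 _)) (etrans Z3 (Z2 _))) => t tab; apply: (K0 _ _ phi_tl).
    exact: (outside_shifted (ltW (h0 n)) (h1 n) tab).
  exact: outside.
have D0 : oint (fun t => pairing phit t - flux_integral t) (a - 1) b = 0.
  have H0 : oint (Q n) (a - 1) b @[n --> \oo] --> (0 : R).
    by under eq_fun do rewrite Q0; exact: cvg_cst.
  exact: (etrans (esym (cvg_lim (@Rhausdorff R) LD)) (cvg_lim (@Rhausdorff R) H0)).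
have iT := loc_bounded_integrable (a - 1) b lT.
have iS : mu.-integrable `[a - 1, b] (EFin \o flux_integral).
  pose D t := pairing phit t - flux_integral t.
  have -> : EFin \o flux_integral = ((EFin \o pairing phit) \- (EFin \o D))%E.
    by apply/funext => t /=; rewrite -EFinB /D subKr.
  by apply: integrableB => //; exact: measurable_itv.
have S0' t : ~ (a - 1 <= t <= b) -> flux_integral t = 0.
  by move=> tab; apply: S0; exact: outside.
have T0' t : ~ (a - 1 <= t <= b) -> pairing phit t = 0.
  by move=> tab; apply: (K0 _ _ phit_tl); exact: outside.
split.
  suff : mu.-integrable setT (EFin \o flux_integral).
    by apply: integrableS => //; exact: measurable_itv.
  have -> : EFin \o flux_integral = (EFin \o flux_integral) \_ `[a - 1, b].
    apply/funext => t; rewrite patchE; case: ifPn => //; rewrite notin_setE/= in_itv/= => tab.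
    by rewrite S0'.
  have := @integrable_mkcond _ (measurableTypeR R) R mu `[a - 1, b] (EFin \o flux_integral) (measurable_itv _).
  by move=> <-.
have half (g : R -> R) : (forall t, t <= 0 -> g t = 0) -> (forall t, ~ (a - 1 <= t <= b) -> g t = 0) ->
    \int[mu]_(t in `]0, +oo[) g t = oint g (a - 1) b.
  move=> g0 gab; rewrite -Rintegral_supp// Rintegral_mkcond; apply: eq_Rintegral => t _.
  rewrite patchE; case: ifPn => //; rewrite notin_setE/= in_itv/= andbT => /negP.
  by rewrite -leNgt => /g0.
have ta t : t <= 0 -> t <= a by move=> t0; rewrite (le_trans t0)// ltW.
have D1 : oint (pairing phit) (a - 1) b = oint flux_integral (a - 1) b.
  apply: subr0_eq; rewrite -D0 !(ointE _ a1b); apply/esym.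
  by apply: RintegralB => //; exact: measurable_itv.
rewrite (half (pairing phit)) ?(half flux_integral)//.
- by move=> t /ta t0; apply: S0; left.
- by move=> t /ta t0; apply: (K0 _ _ phit_tl); left.
Qed.

End in_time.

End transport.

(** * Test functions *)

Section test_functions.
Context {R : realType}.
Implicit Types (psi phi : R * R -> R) (S : set (R * R)).

Lemma slice_derivative psi (x t : R) : derivable psi (x, t) (0, 1) ->
  is_derive t 1 (fun s => psi (x, s)) ('D_(0, 1) psi (x, t)).
Proof.
have E : (fun h : R => h^-1 *: (psi (h *: (0, 1) + (x, t)) - psi (x, t))) =
    (fun h : R => h^-1 *: (psi (x, h *: 1 + t) - psi (x, t))).
  apply/funext => h; congr (_ *: (psi _ - _)).
  have -> : h *: ((0, 1) : R * R) + (x, t) = (h * 0 + x, h * 1 + t) by [].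
  by rewrite mulr0 add0r.
by move=> D; split; [move: D; rewrite /derivable E|rewrite /derive E].
Qed.

Lemma slice_lipschitz psi (B : R) : (forall p, derivable psi p (0, 1)) ->
  (forall p, `|'D_(0, 1) psi p| <= B) ->
  forall x s t, `|psi (x, s) - psi (x, t)| <= B * `|s - t|.
Proof.
move=> dpsi HB x s t; wlog st : s t / s <= t.
  move=> H; have [/H//|/ltW/H] := leP s t.
  by rewrite distrC [`|t - s|]distrC.
move: st; rewrite le_eqVlt => /predU1P[->|st]; first by rewrite !subrr normr0 mulr0.
have dd (u : R) : is_derive u 1 (fun s : R => psi (x, s)) ('D_(0, 1) psi (x, u)) by exact: slice_derivative.
have [|c _ cE] := @MVT R (fun s : R => psi (x, s)) (fun u : R => 'D_(0, 1) psi (x, u)) s t st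
    (fun u _ => dd u).
  apply: derivable_within_continuous => u _; exact: (@ex_derive _ _ _ _ _ _ _ (dd u)).
by rewrite distrC cE normrM [`|s - t|]distrC ler_wpM2r.
Qed.

(** The form in which the time derivative enters the limit of the pairings. *)
Lemma slice_quotient_cvg psi (x t : R) : derivable psi (x, t) (0, 1) ->
  (psi (x, t + harmonic n) - psi (x, t)) / harmonic n @[n --> \oo] --> 'D_(0, 1) psi (x, t).
Proof.
move=> /slice_derivative dd; apply/cvgrPdist_le => e e0.
have [d d0 Hd] := derive1_first_order (@ex_derive _ _ _ _ _ _ _ dd) e0.
have := @cvg_harmonic R => /cvgrPdist_lt /(_ _ d0); apply: filterS => n.
have h0 : 0 < harmonic n :> R by rewrite /harmonic/= invr_gt0.
rewrite sub0r normrN gtr0_norm// => hd.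
have := Hd (t + harmonic n); rewrite (_ : t + harmonic n - t = harmonic n); last by ring.
rewrite gtr0_norm// derive1E (derive_val) => /(_ hd); cbv beta.
move: (psi (x, t + harmonic n)) (psi (x, t)) ('D_(0, 1) psi (x, t)) => A A' D.
move: (harmonic n) h0 => h h0 H.
rewrite (_ : D - (A - A') / h = - ((A - A' - D * h) / h)); last by field; rewrite gt_eqF.
by rewrite normrN normrM normfV (gtr0_norm h0) ler_pdivrMr.
Qed.

(** The complement of S is open, so psi vanishes identically near p. *)
Lemma derive_off_support psi S p : closed S -> (forall q, ~ S q -> psi q = 0) ->
  ~ S p -> 'D_(0, 1) psi p = 0.
Proof.
move=> cS psi0 Sp; case: p Sp => x t Sp.
have nS : nbhs (x, t) (~` S) by apply: open_nbhs_nbhs; split => //; exact: closed_openC.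
apply: cvg_lim => //; apply/cvgrPdist_le => e e0.
have c0 : {for (0 : R), continuous (fun h : R => h *: ((0, 1) : R * R) + (x, t))}.
  by rewrite /continuous_at; apply: cvgD; [apply: cvgZ; [exact: cvg_id|exact: cvg_cst]|exact: cvg_cst].
have : \forall h \near (0 : R), ~ S (h *: ((0, 1) : R * R) + (x, t)).
  by apply: (c0 (~` S)); rewrite scale0r add0r.
move=> H; apply: cvg_within; apply: filterS H => h Sh.
have E : (psi \o shift (x, t)) (h *: (0, 1)) = 0 := psi0 _ Sh.
by rewrite E (psi0 _ Sp) subrr scaler0 subrr normr0 ltW.
Qed.

Lemma bounded_support psi S : compact S -> continuous psi -> (forall q, ~ S q -> psi q = 0) ->
  exists B, forall q, `|psi q| <= B.
Proof.
move=> cS cpsi psi0.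
have : compact (psi @` S) by apply: continuous_compact => //; exact: continuous_subspaceT.
move/compact_bounded => [N [_ HN]]; have N1 : N < N + 1 by rewrite ltrDl.
exists `|N + 1| => q; have [Sq|Sq] := pselect (S q); last by rewrite psi0// normr0.
by rewrite (le_trans (HN _ N1 _ _)) ?ler_norm//; exists q.
Qed.

(** The times occurring in S form a compact set which avoids 0, hence they stay
    away from 0. *)
Lemma compact_box S : compact S -> S `<=` @upper_half_plane R ->
  exists L a : R, [/\ 0 <= L, 0 < a, a <= L & forall x t,
    (L <= `|x| \/ t <= a \/ L <= t) -> ~ S (x, t)].
Proof.
move=> cS SO.
have c2 : compact (snd @` S) by apply: continuous_compact => //; apply: continuous_subspaceT => p; exact: cvg_snd.
have n0 : nbhs (0 : R) (~` (snd @` S)).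
  apply: open_nbhs_nbhs; split; first by apply: closed_openC; exact: compact_closed.
  by move=> [p /SO + p0]; rewrite /upper_half_plane/= p0 ltxx.
have [a /= a0 Ha] := (nbhs_ballP _ _).1 n0.
have [N [_ HN]] := compact_bounded cS; have N1 : N < N + 1 by rewrite ltrDl.
exists (`|N + 1| + 1 + a), (a / 2); split.
- by rewrite !addr_ge0// ltW.
- by rewrite divr_gt0.
- have := normr_ge0 (N + 1); lra.
move=> x t H Sxt; have : `|(x, t) : R * R| <= N + 1 := HN _ N1 _ Sxt.
rewrite prod_normE/= ge_max => /andP[h1 h2].
have h3 := ler_norm (N + 1); have h4 := ler_norm t.
have t0 : 0 < t by exact: SO Sxt.
have ta : a <= t.
  rewrite leNgt; apply/negP => ta; apply: (Ha t); last by exists (x, t).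
  by rewrite /ball/= sub0r normrN gtr0_norm.
move: h3 h1 h2 h4 H; move: `|N + 1| `|x| `|t| => A X T h3 h1 h2 h4.
by move=> [|[|]]; lra.
Qed.

(** Two derivatives in time are bounded, being continuous and supported in a
    compact set; the mean value theorem turns this into Lipschitz estimates. *)
Lemma test_function_time_lipschitz phi : test_function upper_half_plane phi ->
  exists L a B : R, [/\ 0 <= L, 0 < a, a <= L,
    time_lipschitz L a L B (fun x t => phi (x, t)) &
    time_lipschitz L a L B (fun x t => 'D_(0, 1) phi (x, t))].
Proof.
move=> [Ck cS SO]; set S := closure _ in cS SO.
have closedS : closed S by exact: closed_closure.
have phi0 q : ~ S q -> phi q = 0.
  by move=> Sq; apply/eqP/negP => /negP pq; apply: Sq; exact: subset_closure.
pose phit : R * R -> R := 'D_(0, 1) phi; pose phitt : R * R -> R := 'D_(0, 1) phit.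
have phit0 q : ~ S q -> phit q = 0 by exact: derive_off_support.
have phitt0 q : ~ S q -> phitt q = 0 by exact: derive_off_support.
have [L [a [L0 a0 aL boxS]]] := compact_box cS SO.
have c0 : continuous phi by exact: (Ck 0%N).
have c1 : continuous phit by have [_ _] := Ck 1%N.
have c2 : continuous phitt by have [_ _ [_ _]] := Ck 2%N.
have d0 p : derivable phi p (0, 1) by have [/(_ p)[]] := Ck 1%N.
have d1 p : derivable phit p (0, 1) by have [_ _ [/(_ p)[]]] := Ck 2%N.
have [B0 HB0] := bounded_support cS c0 phi0.
have [B1 HB1] := bounded_support cS c1 phit0.
have [B2 HB2] := bounded_support cS c2 phitt0.
pose B := Num.max B0 (Num.max B1 B2).
have B0B : B0 <= B by rewrite le_max lexx.
have B1B : B1 <= B by rewrite !le_max lexx orbT.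
have B2B : B2 <= B by rewrite !le_max lexx !orbT.
have tl (psi : R * R -> R) (C1 C2 : R) : C1 <= B -> C2 <= B -> continuous psi ->
    (forall q, ~ S q -> psi q = 0) -> (forall p, derivable psi p (0, 1)) ->
    (forall q, `|psi q| <= C1) -> (forall q, `|'D_(0, 1) psi q| <= C2) ->
    time_lipschitz L a L B (fun x t => psi (x, t)).
  move=> C1B C2B cpsi psi0 dpsi H1 H2; split.
  - move=> t; apply: (@section1_cont R (fun x s => psi (x, s)) _ t).
    by have -> : (fun p : R * R => psi (p.1, p.2)) = psi by apply/funext => -[].
  - by move=> x t Lx; apply: psi0; apply: boxS; left.
  - by move=> x t ta; apply: psi0; apply: boxS; right; left.
  - by move=> x t ta; apply: psi0; apply: boxS; right; right.
  - by move=> x t; exact: le_trans (H1 _) C1B.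
  - move=> x s t; apply: (le_trans (slice_lipschitz dpsi H2 x s t)).
    exact: ler_wpM2r.
exists L, a, B; split => //.
  exact: (tl phi B0 B1).
exact: (tl phit B1 B2).
Qed.

End test_functions.

(** * Minimizers, one-sided limits and u for the conservation law *)

Section one_sided_limits.
Context {R : realType}.
Implicit Types (D : set R) (g : R -> R).

Lemma lim_within_left D g (x l : R) :
  (forall d, 0 < d -> exists2 z, x - d < z < x & D z) ->
  (forall e, 0 < e -> exists2 d, 0 < d & forall z, x - d < z -> z < x -> D z -> `|g z - l| < e) ->
  lim (g z @[z --> within D x^'-]) = l.
Proof.
move=> Dx gl; have FF : ProperFilter (within D x^'-).
  apply: Build_ProperFilter_ex => A /nbhs_ballP[d /= d0 Hd].
  have [z /andP[z1 z2] Dz] := Dx d d0; exists z; apply: (Hd z) => //=.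
  by rewrite /ball/= gtr0_norm ?subr_gt0// ltrBlDl -ltrBlDr.
apply: cvg_lim => //; apply/cvgrPdist_lt => e e0.
have [d d0 Hd] := gl e e0; apply/nbhs_ballP; exists d => //= z zd zx Dz.
rewrite distrC; apply: Hd => //; move: zd; rewrite /ball/= => /ltr_distlBl.
by rewrite ltrBlDr addrC -ltrBlDr.
Qed.

Lemma lim_within_right D g (x l : R) :
  (forall d, 0 < d -> exists2 z, x < z < x + d & D z) ->
  (forall e, 0 < e -> exists2 d, 0 < d & forall z, x < z -> z < x + d -> D z -> `|g z - l| < e) ->
  lim (g z @[z --> within D x^'+]) = l.
Proof.
move=> Dx gl; have FF : ProperFilter (within D x^'+).
  apply: Build_ProperFilter_ex => A /nbhs_ballP[d /= d0 Hd].
  have [z /andP[z1 z2] Dz] := Dx d d0; exists z; apply: (Hd z) => //=.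
  by rewrite /ball/= distrC gtr0_norm ?subr_gt0// ltrBlDl.
apply: cvg_lim => //; apply/cvgrPdist_lt => e e0.
have [d d0 Hd] := gl e e0; apply/nbhs_ballP; exists d => //= z zd zx Dz.
rewrite distrC; apply: Hd => //; move: zd; rewrite /ball/= distrC => /ltr_distlDr.
by rewrite addrC.
Qed.

End one_sided_limits.

Section lax_oleinik_flow.
Context {R : realType}.
Notation oint := oriented_integral.
Notation mu := (@lebesgue_measure R).
Variables (f alpha u0 galpha gu0 : R -> R) (Ma M : R).
Hypothesis f_C2 : class_C2 f.
Hypothesis f_convex : strictly_convex f.
Hypothesis f_growth : superlinear f.
Hypothesis galpha_meas : measurable_fun setT galpha.
Hypothesis galphaM : forall x, `|galpha x| <= Ma.
Hypothesis alphaE : forall A, A `<=` `[0, +oo[%classic ->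
  \int[mu]_(x in A) alpha x = \int[mu]_(x in A) galpha x.
Hypothesis M0 : 0 <= M.
Hypothesis gu0_meas : measurable_fun setT gu0.
Hypothesis gu0M : forall x, `|gu0 x| <= M.
Hypothesis u0E : forall A, \int[mu]_(x in A) u0 x = \int[mu]_(x in A) gu0 x.

Notation b := (beta alpha).
Notation speedf := (speed f b).
Notation costf := (cost f b).
Notation driftf := (drift f b).
Notation actionf := (action f b).
Notation U := (oint u0 0).
Notation h := (fun t x => hfun f alpha x t).
Notation ylow := (y_low f alpha u0).
Notation yupp := (y_upp f alpha u0).
Notation velf := (vel speedf costf h ylow yupp).

(** For negative t the domain of integration is empty, so beta vanishes there and is
    continuous on the whole line. *)
Lemma beta_cont : continuous b.
Proof.
have bE t : b t = oint galpha 0 (Num.max 0 t).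
  rewrite /beta; have [t0|t0] := leP t 0; last first.
    rewrite ointE ?ltW//; apply: alphaE => x /=; rewrite !in_itv/= andbT.
    by case/andP.
  rewrite alphaE => [|x /=]; last by rewrite !in_itv/= andbT; case/andP.
  move: t0; rewrite le_eqVlt => /predU1P[->|t0]; first by rewrite ointE.
  by rewrite ointxx set_itv_ge ?Rintegral_set0// bnd_simp -ltNge.
have lg := bounded_loc_bounded_Borel galpha_meas galphaM.
have cg : continuous (oint galpha 0) := oint_continuous lg galphaM.
have cmax : continuous (fun t : R => Num.max 0 t).
  move=> t; apply: (continuous_max (f := cst 0) (g := id)); first exact: cvg_cst.
  exact: cvg_id.
have -> : b = oint galpha 0 \o (fun t : R => Num.max 0 t) by apply/funext.
by move=> t; apply: continuous_comp; [exact: cmax|exact: cg].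
Qed.

Let cf : continuous f. Proof. exact: C2_cont. Qed.
Let cf' : continuous (derive1 f). Proof. exact: C2_cont'. Qed.
Let tf : tangent_below f. Proof. exact: C2_tangent_below. Qed.
Let sf : forall p, exists v, derive1 f v = p.
Proof. exact: superlinear_derive_surj. Qed.

Lemma characteristic_flow : flow driftf actionf speedf costf.
Proof.
have cb := beta_cont; split.
- exact: drift_chasles.
- exact: action_chasles.
- exact: action_tangent.
- exact: drift_norm_le.
- exact: action_norm_le.
- exact: drift_coercive.
- by move=> q0 t e e0; apply: cont2_mean => //; exact: speed2_cont.
- by move=> q0 t e e0; apply: cont2_mean => //; exact: cost2_cont.
Qed.

Lemma drift_hfun (t p : R) : 0 < t -> driftf 0 t (hfun f alpha p t) = p.
Proof.
move=> t0; have [q Hq] := drift_surj cf' tf sf beta_cont p t0.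
have E q' : driftf 0 t q' = \int[mu]_(theta in `[0, t]) derive1 f (q' * expR (b theta)).
  by rewrite /drift ointE// ltW.
rewrite E.
exact: (@xgetPex _ 0 [set q | \int[mu]_(theta in `[0, t]) derive1 f (q * expR (b theta)) = p]
  (ex_intro _ q (etrans (esym (E q)) Hq))).
Qed.

Lemma initial_lipschitz (y z : R) : `|U y - U z| <= M * `|y - z|.
Proof.
have UE w : U w = oint gu0 0 w by rewrite /oriented_integral !u0E.
rewrite !UE; apply: oint_lipschitz => //; exact: bounded_loc_bounded_Borel gu0M.
Qed.

(** By [legendre_slope] the integrand is q speed q - cost q with q = h (x - y, t),
    and the integral of speed q is x - y by the choice of q. *)
Lemma Ffun_value (x y t : R) : 0 < t -> Ffun f alpha u0 x y t = value actionf U h x y t.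
Proof.
move=> t0; rewrite /Ffun /value /conj_action; congr (_ + _).
set q := hfun f alpha (x - y) t; rewrite -[X in q * X](drift_hfun (x - y) t0) -/q.
have cb := beta_cont.
have lq := continuous_loc_bounded_Borel (speed_cont cf' cb (q := q)).
have lc := continuous_loc_bounded_Borel (cost_cont cf cb (q := q)).
have lN := loc_bounded_BorelM (loc_bounded_cst (-1)) lc.
have lZ := loc_bounded_BorelM (loc_bounded_cst q) lq.
rewrite /drift /action -(ointZ q _ _ lq) -mulN1r -(ointZ (-1) _ _ lc) -(ointD _ _ lZ lN).
rewrite ointE ?ltW//; apply: eq_Rintegral => theta _.
rewrite (legendre_slope f_C2 f_convex) /speed /cost expRN.
by field; rewrite gt_eqF// expR_gt0.
Qed.

Lemma minimizer_is_min (x t y : R) : 0 < t ->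
  minimizer f alpha u0 x t y <-> is_min actionf U h x t y.
Proof.
by move=> t0; split => H z; have := H z; rewrite !Ffun_value.
Qed.

Lemma y_lowP (x t : R) : 0 < t ->
  is_min actionf U h x t (ylow x t) /\ forall z, is_min actionf U h x t z -> ylow x t <= z.
Proof.
move=> t0; have [y [y1 y2]] := least_min_exists characteristic_flow M0 initial_lipschitz
  (fun t p => @drift_hfun t p) x t0.
have := @xgetPex _ 0 [set y | minimizer f alpha u0 x t y /\
  forall z, minimizer f alpha u0 x t z -> y <= z].
case.
  exists y; split; first exact/minimizer_is_min.
  by move=> z /(minimizer_is_min _ _ t0); exact: y2.
rewrite -/(ylow x t) => m1 m2; split; first exact/minimizer_is_min.
by move=> z /(minimizer_is_min _ _ t0); exact: m2.
Qed.

Lemma y_uppP (x t : R) : 0 < t ->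
  is_min actionf U h x t (yupp x t) /\ forall z, is_min actionf U h x t z -> z <= yupp x t.
Proof.
move=> t0; have [y [y1 y2]] := greatest_min_exists characteristic_flow M0 initial_lipschitz
  (fun t p => @drift_hfun t p) x t0.
have := @xgetPex _ 0 [set y | minimizer f alpha u0 x t y /\
  forall z, minimizer f alpha u0 x t z -> z <= y].
case.
  exists y; split; first exact/minimizer_is_min.
  by move=> z /(minimizer_is_min _ _ t0); exact: y2.
rewrite -/(yupp x t) => m1 m2; split; first exact/minimizer_is_min.
by move=> z /(minimizer_is_min _ _ t0); exact: m2.
Qed.

Let dyn := characteristic_flow.
Let hP := fun t p => @drift_hfun t p.

(** The points of uniqueness are dense, so the limit is taken along a proper
    filter; at these points y_low is the unique minimizer. *)
Lemma ubar_left_slope (x t : R) : 0 < t ->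
  ubar_left f alpha u0 x t = hfun f alpha (x - ylow x t) t * expR (b t).
Proof.
move=> t0; apply: lim_within_left => [d d0|e e0].
  have xd : x - d < x by rewrite gtrBl.
  by have [z zx Ez] := regular_dense dyn initial_lipschitz hP y_lowP y_uppP t0 xd; exists z.
have E0 : 0 < expR (b t) by exact: expR_gt0.
have [d d0 Hd] := slope_left dyn M0 initial_lipschitz hP y_lowP y_uppP x t0 (divr_gt0 e0 E0).
exists d => // z z1 z2 _; have := Hd z z1 z2.
by rewrite /ubar -mulrBl normrM (gtr0_norm E0) ltr_pdivlMr.
Qed.

Lemma ubar_right_slope (x t : R) : 0 < t ->
  ubar_right f alpha u0 x t = hfun f alpha (x - yupp x t) t * expR (b t).
Proof.
move=> t0; apply: lim_within_right => [d d0|e e0].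
  have xd : x < x + d by rewrite ltrDl.
  by have [z zx Ez] := regular_dense dyn initial_lipschitz hP y_lowP y_uppP t0 xd; exists z.
have E0 : 0 < expR (b t) by exact: expR_gt0.
have [d d0 Hd] := slope_right dyn M0 initial_lipschitz hP y_lowP y_uppP x t0 (divr_gt0 e0 E0).
exists d => // z z1 z2 _; have := Hd z z1 z2.
by rewrite /ubar -mulrBl normrM (gtr0_norm E0) ltr_pdivlMr.
Qed.

(** At a shock, the factor e^beta that turns slopes q into values q e^beta of u
    cancels from the difference quotient of f, leaving that of cost. *)
Lemma derive_ufun (x t : R) : 0 < t -> derive1 f (ufun f alpha u0 x t) = velf x t.
Proof.
move=> t0; rewrite /ufun /vel; case: eqP => // E.
rewrite (derive_invK f_C2 f_convex f_growth) (ubar_left_slope x t0) (ubar_right_slope x t0).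
have lt12 : hfun f alpha (x - yupp x t) t < hfun f alpha (x - ylow x t) t.
  apply: (h_lt dyn hP t0); rewrite ltrD2l ltrN2 lt_neqAle; apply/andP; split; first exact/eqP.
  exact: (ylow_le_yupp y_lowP y_uppP).
rewrite /cost expRN; have := expR_gt0 (b t).
move: (expR (b t)) lt12 => e; move: (hfun _ _ _ _) (hfun _ _ _ _) => q2 q1 q12 e0.
move: (f (q1 * e)) (f (q2 * e)) => f1 f2.
have q0 : q2 - q1 != 0 by rewrite subr_eq0 neq_lt q12 ?orbT.
have en0 : e != 0 by rewrite gt_eqF.
field; rewrite q0 en0 -mulrBl mulf_neq0//.
by rewrite -opprB oppr_eq0.
Qed.

Lemma cost_tangent (q q' t : R) : costf q t + speedf q t * (q' - q) <= costf q' t.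
Proof.
have [->|qq'] := eqVneq q q'; first by rewrite subrr mulr0 addr0.
have E0 := expR_gt0 (b t).
have qE : q * expR (b t) != q' * expR (b t).
  by apply: contra qq' => /eqP/(mulIf (lt0r_neq0 E0)) ->.
have := ltW (tf qE); rewrite /cost /speed expRN.
rewrite -[in X in X -> _](ler_pM2r (_ : 0 < (expR (b t))^-1)) ?invr_gt0//.
move/(le_trans _); apply.
move: (expR (b t)) E0 (f _) (derive1 f _) => e e0 A B.
by rewrite (_ : (A + B * (q' * e - q * e)) / e = A / e + B * (q' - q)) //; field; rewrite gt_eqF.
Qed.

(** The Rankine-Hugoniot speed, a difference quotient of the convex function cost,
    lies between the characteristic speeds on both sides. *)
Lemma vel_bounded (t : R) : 0 < t -> exists B, forall x, `|velf x t| <= B.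
Proof.
move=> t0; have [C C0 HC] := cont2_bounded (speed2_cont cf' beta_cont) M t.
have tt : `|t| <= t by rewrite gtr0_norm.
exists C => x; rewrite /vel.
have m1 := is_min_h dyn initial_lipschitz hP t0 (y_lowP x t0).1.
have m2 := is_min_h dyn initial_lipschitz hP t0 (y_uppP x t0).1.
case: eqP => E; first exact: HC.
have lt12 : hfun f alpha (x - yupp x t) t < hfun f alpha (x - ylow x t) t.
  apply: (h_lt dyn hP t0); rewrite ltrD2l ltrN2 lt_neqAle; apply/andP; split; first exact/eqP.
  exact: (ylow_le_yupp y_lowP y_uppP).
move: (hfun _ _ _ _) (hfun _ _ _ _) m1 m2 lt12 => q2 q1 m1 m2 q12.
have := cost_tangent q1 q2 t; have := cost_tangent q2 q1 t.
have := HC _ _ m1 tt; have := HC _ _ m2 tt; rewrite !ler_norml.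
move: (speedf q1 t) (speedf q2 t) (costf q1 t) (costf q2 t) => s1 s2 c1 c2.
have d0 : 0 < q1 - q2 by rewrite subr_gt0.
move=> /andP[s2l _] /andP[_ s1u] T1 T2.
rewrite ler_pdivlMr// ler_pdivrMr//.
have U1 : s1 * (q1 - q2) <= C * (q1 - q2) by rewrite ler_pM2r.
have U2 : - C * (q1 - q2) <= s2 * (q1 - q2) by rewrite ler_pM2r.
by apply/andP; split; lra.
Qed.

Lemma vel_meas (t : R) : 0 < t -> measurable_fun setT (velf ^~ t).
Proof.
move=> t0.
have ml := ylow_meas (fun s x y => @ylow_mono _ _ _ _ _ dyn _ _ hP _ _ y_lowP y_uppP s x y) t0.
have mu_ := ylow_meas (fun s x y => @yupp_mono _ _ _ _ _ dyn _ _ hP _ _ y_lowP y_uppP s x y) t0.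
have ch : continuous (fun p : R => hfun f alpha p t).
  move=> p; apply/cvgrPdist_lt => e e0; have [d d0 Hd] := h_cont dyn hP p t0 e0.
  apply/nbhs_ballP; exists d => //= p'; rewrite /ball/= distrC => pp; rewrite distrC.
  by apply: Hd; rewrite ?subrr ?normr0.
have mq (y : R -> R) : measurable_fun setT y ->
    measurable_fun setT (fun x : R => hfun f alpha (x - y x) t).
  move=> my; apply: (measurableT_comp (continuous_measurable_fun ch)).
  by apply: measurable_funB; [exact: measurable_id|exact: my].
have cs : continuous (speedf ^~ t) := @section1_cont _ _ (speed2_cont cf' beta_cont) t.
have cc : continuous (costf ^~ t) := @section1_cont _ _ (cost2_cont cf beta_cont) t.
(* The slopes are ordered, so the inverse of their difference is a real power of
   a nonnegative number; that power is a Borel function. *)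
have mV : measurable_fun setT (fun x : R => (hfun f alpha (x - ylow x t) t
    - hfun f alpha (x - yupp x t) t)^-1).
  have -> : (fun x : R => (hfun f alpha (x - ylow x t) t - hfun f alpha (x - yupp x t) t)^-1)
    = (fun x : R => powR (hfun f alpha (x - ylow x t) t - hfun f alpha (x - yupp x t) t) (-1)).
    apply/funext => x; rewrite powR_inv1// subr_ge0.
    by apply: (h_le dyn hP t0); rewrite lerD2l lerN2 (ylow_le_yupp y_lowP y_uppP).
  apply: (measurableT_comp (measurable_powR _)).
  by apply: measurable_funB; [exact: (mq _ ml)|exact: (mq _ mu_)].
rewrite /vel; apply: measurable_fun_if.
- exact: measurableT.
- exact: (measurable_fun_eqr ml mu_).
- apply: measurable_funTS; apply: (measurableT_comp (continuous_measurable_fun cs)).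
  exact: (mq _ ml).
- apply: measurable_funTS; apply: measurable_funM; last exact: mV.
  apply: measurable_funB; apply: (measurableT_comp (continuous_measurable_fun cc)).
    exact: (mq _ ml).
  exact: (mq _ mu_).
Qed.

End lax_oleinik_flow.

(** * The weak solution *)

Section right_limits.
Context {R : realType}.
Implicit Types (A y : R -> R).

Lemma lipschitz_comp_bounded_variation A y (M a b : R) :
  (forall u v, `|A u - A v| <= M * `|u - v|) -> {homo y : u v / u <= v} ->
  bounded_variation a b (A \o y).
Proof.
move=> AM ndy; exists (M * (y b - y a)) => _ [s abs <-].
rewrite -(@nondecreasing_variation R a b y s) //; last by move=> u v _ _; exact: ndy.
rewrite /variation mulr_sumr; apply: ler_sum => n _; exact: AM.
Qed.

Lemma right_regE y (q : R) : {homo y : u v / u <= v} ->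
  right_reg y q = inf (y @` `]q, +oo[).
Proof. by move=> ndy; rewrite /right_reg; case: pselect. Qed.

Lemma right_reg_le y (q x : R) : {homo y : u v / u <= v} -> q < x -> right_reg y q <= y x.
Proof.
move=> ndy qx; rewrite right_regE//; apply: ge_inf; last by exists x => //=; rewrite in_itv/= andbT.
by exists (y q) => _ [v /= + <-]; rewrite in_itv/= andbT => /ltW; exact: ndy.
Qed.

Lemma le_right_reg y (q c : R) : {homo y : u v / u <= v} ->
  (forall x, q < x -> c <= y x) -> c <= right_reg y q.
Proof.
move=> ndy cy; rewrite right_regE//; apply: lb_le_inf.
  by exists (y (q + 1)), (q + 1) => //=; rewrite in_itv/= andbT ltrDl.
by move=> _ [v /= + <-]; rewrite in_itv/= andbT; exact: cy.
Qed.

End right_limits.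

Section weak_solution_of_transport.
Context {R : realType}.
Notation oint := oriented_integral.
Notation mu := (@lebesgue_measure R).
Variables (ylow level vel : R -> R -> R) (rho : R -> R) (M : R).
Hypothesis rho_meas : measurable_fun setT rho.
Hypothesis rhoM : forall c, `|rho c| <= M.
Hypothesis ylow_mono : forall t x1 x2, 0 < t -> x1 <= x2 -> ylow x1 t <= ylow x2 t.
Hypothesis level_le : forall x t c, 0 < t -> (ylow x t <= c) = (x <= level t c).
Hypothesis level_mono : forall t c c', 0 < t -> c <= c' -> level t c <= level t c'.
Hypothesis ylow_dist : forall T : R, exists2 C : R, 0 <= C & forall x t,
  0 < t -> t <= T -> `|x - ylow x t| <= C * t.
Hypothesis level_dist : forall T : R, exists2 C : R, 0 <= C & forall t c,
  0 < t -> t <= T -> `|level t c - c| <= C * t.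
Notation generic t c := (forall r : rat, ylow (ratr r) t != c).
Hypothesis level_lipschitz : forall T : R, exists2 C : R, 0 <= C & forall t s c,
  0 < t -> t <= s -> s <= T -> generic t c -> `|level s c - level t c| <= C * (s - t).
Hypothesis level_deriv : forall t c e : R, 0 < t -> generic t c -> 0 < e ->
  exists2 d : R, 0 < d & forall s, t < s -> s < t + d ->
    `|level s c - level t c - vel (level t c) t * (s - t)| <= e * (s - t).
Hypothesis ylow_lsc : forall x t c, 0 < t -> c < ylow x t -> exists2 d, 0 < d &
  forall x' t', `|x' - x| < d -> `|t' - t| < d -> c < ylow x' t'.
Hypothesis vel_meas : forall t, 0 < t -> measurable_fun setT (vel ^~ t).
Hypothesis vel_bounded : forall t, 0 < t -> exists B, forall x, `|vel x t| <= B.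

Notation carried := (carried ylow rho).

Let lrho : loc_bounded_Borel rho.
Proof. exact: bounded_loc_bounded_Borel rhoM. Qed.

Let M0 : 0 <= M. Proof. by rewrite (le_trans _ (rhoM 0)). Qed.

Let A_lip u v : `|oint rho 0 u - oint rho 0 v| <= M * `|u - v|.
Proof. exact: oint_lipschitz. Qed.

(** Joint measurability comes from the lower semicontinuity of ylow in (x, t). *)
Lemma carried_Linfty_loc : Linfty_loc upper_half_plane carried.
Proof.
move=> K cK KO; pose y (p : R * R) := if 0 < p.2 then ylow p.1 p.2 else 0.
have mO : measurable (@upper_half_plane R).
  have -> : upper_half_plane = snd @^-1` `]0, +oo[%classic :> set (R * R).
    by apply/seteqP; split => p /=; rewrite in_itv/= andbT.
  by rewrite -[X in measurable X]setTI; exact: measurable_snd.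
have my : measurable_fun setT y.
  apply: measurable_fun_rat => q.
  have oq : open [set p : R * R | 0 < p.2 /\ ratr q < ylow p.1 p.2].
    rewrite openE => -[x t] /= [t0 qy]; have [d d0 Hd] := ylow_lsc t0 qy.
    apply/nbhs_ballP; exists (Num.min d t); first by rewrite /= lt_min d0.
    move=> -[x' t'] [/=]; rewrite /ball/= distrC lt_min => /andP[x1 x2].
    rewrite distrC lt_min => /andP[t1 t2].
    split; last exact: Hd.
    by move: t2; rewrite ltr_norml; case/andP => + _; lra.
  have -> : y @^-1` `]ratr q, +oo[%classic =
     [set p : R * R | 0 < p.2 /\ ratr q < ylow p.1 p.2] `|`
     (if (ratr q : R) < 0 then ~` upper_half_plane else set0).
    apply/seteqP; split => -[x t]; rewrite /y /upper_half_plane/= in_itv/= andbT.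
      case: ifPn => t0 qy; first by left.
      by right; rewrite qy /=; apply/negP.
    move=> [[t0 qy]|]; first by rewrite t0.
    by case: ifP => // q0 /negP/negbTE ->.
  apply: measurableU; first exact: open_measurable2.
  by case: ifP => // _; exact: measurableC.
have mw : measurable_fun setT (fun p => oint rho 0 (y p)).
  apply: (measurableT_comp _ my); apply: continuous_measurable_fun.
  exact: oint_continuous lrho rhoM.
have wE p : K p -> carried p.1 p.2 = oint rho 0 (y p).
  by move=> /KO; rewrite /upper_half_plane/= /y => ->.
split.
  move=> Y mY; exists (K `&` (fun p => oint rho 0 (y p)) @^-1` Y).
    have := mw measurableT Y mY; rewrite setTI => mwY.
    exact: measurableI (compact_measurable2 cK) mwY.
  exists set0; first exact: negligible_set0.
  by rewrite setU0; apply/seteqP; split => p /= [Kp]; rewrite wE.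
have [N [_ HN]] := compact_bounded cK; have N1 : N < N + 1 by rewrite ltrDl.
have [W W0 HW] := carried_norm rho_meas rhoM ylow_dist (N + 1) (N + 1).
apply: (@le_lt_trans _ _ W%:E); last by rewrite ltry.
apply: Linfty_norm_le => // -[x t]; rewrite patchE; case: ifPn => [|_]; last by rewrite normr0.
rewrite inE => Kp; have := KO _ Kp; rewrite /upper_half_plane/= => t0.
have : `|(x, t) : R * R| <= N + 1 := HN _ N1 _ Kp.
rewrite prod_normE/= ge_max => /andP[h1 h2].
by apply: HW => //; rewrite (le_trans (ler_norm t)).
Qed.

Lemma carried_BV_loc t : 0 < t -> BV_loc (carried ^~ t).
Proof.
move=> t0 a b; apply: (lipschitz_comp_bounded_variation (y := ylow ^~ t) _ _ A_lip).
by move=> u v; exact: ylow_mono.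
Qed.

(** The feet of the characteristics are within C t of x. *)
Lemma carried_initial :
  Lnorm mu +oo%E (fun x => (carried x t - oint rho 0 x)%:E) @[t --> 0^'+] --> 0%E.
Proof.
have [C C0 HC] := ylow_dist 1.
have H0 : (fun _ : R => 0%E : \bar R) @ (0 : R)^'+ --> 0%E by exact: cvg_cst.
have H1 : (M * (C * t))%:E @[t --> (0 : R)^'+] --> 0%E.
  apply: cvg_EFin; first by near=> t.
  rewrite -[X in _ --> X](mulr0 (M * C)); under eq_fun do rewrite mulrA.
  by apply: cvgM; [exact: cvg_cst|exact: cvg_at_right_filter].
apply: (squeeze_cvge _ H0 H1); near=> t.
have t0 : 0 < t by near: t; exact: nbhs_right_gt.
have t1 : t <= 1 by near: t; exact: nbhs_right_le.
rewrite Lnorm_ge0/=.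
apply: (@Linfty_norm_le _ _ _ mu (fun x => carried x t - oint rho 0 x)).
  by rewrite mulr_ge0// mulr_ge0// ltW.
move=> x; apply: (le_trans (A_lip _ _)); rewrite ler_wpM2l// distrC.
exact: HC.
Unshelve. all: by end_near. Qed.

(** The curves that lie in ]p, q] at time t are those from the c between the right
    limits of ylow at p and at q, up to the two end points. *)
Lemma carried_right_diff t p q gp gq : 0 < t -> p <= q ->
  carried x t @[x --> p^'+] --> gp -> carried x t @[x --> q^'+] --> gq ->
  gq - gp = \int[mu]_(c in level t @^-1` `]p, q]) rho c.
Proof.
move=> t0 pq Hp Hq; pose y x := ylow x t.
have ndy : {homo y : u v / u <= v} by move=> u v; exact: ylow_mono.
have cA : continuous (oint rho 0) by exact: oint_continuous lrho rhoM.
have lim_carried r gr : carried x t @[x --> r^'+] --> gr -> gr = oint rho 0 (right_reg y r).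
  move=> Hr; apply: (cvg_unique _ Hr) => //.
  by apply: (continuous_cvg _ (cA _)); exact: nd_right_reg_cvg.
rewrite (lim_carried _ _ Hp) (lim_carried _ _ Hq).
rewrite -(oint_chasles (right_reg y p) 0 (right_reg y q) lrho) addrAC subrr add0r.
rewrite ointE; last exact: right_reg_nondecreasing.
have gt c x : (level t c < x) = (c < y x) by rewrite !ltNge level_le.
have lev_le r c : c < right_reg y r -> level t c <= r.
  move=> cr; rewrite leNgt; apply/negP => rl.
  pose x := (r + level t c) / 2.
  have := right_reg_le ndy (_ : r < x); rewrite leNgt => /(_ _)/negP; apply.
    by rewrite /x; lra.
  apply: le_lt_trans cr; rewrite /y level_le// /x; lra.
have le_lev r c : level t c <= r -> c <= right_reg y r.
  move=> lr; apply: le_right_reg => // x rx; apply: ltW; rewrite -gt; exact: le_lt_trans rx.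
pose N := [set right_reg y p] `|` [set right_reg y q].
have mN : measurable N by apply: measurableU; exact: measurable_set1.
have N0 : mu N = 0%E.
  apply: countable_lebesgue_measure0; apply: finite_set_countable.
  by rewrite finite_setU; split; exact: finite_set1.
rewrite Rintegral_mkcond [RHS]Rintegral_mkcond; congr fine.
apply: (@integral_off_null _ (measurableTypeR R) R mu _ _ _ _ mN N0) => c _ Nc.
suff E : (c \in level t @^-1` `]p, q]) = (c \in `[right_reg y p, right_reg y q]%classic).
  by rewrite !patchE E.
apply/idP/idP; rewrite !inE/= !in_itv/=.
  move=> /andP[c1 c2]; apply/andP; split; last exact: le_lev.
  by rewrite leNgt; apply/negP => /lev_le; rewrite leNgt c1.
move=> /andP[c1 c2]; apply/andP; split.
  rewrite ltNge; apply/negP => /le_lev c3; apply: Nc; left.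
  by apply/eqP; rewrite /= eq_le c1 c3.
apply: lev_le; rewrite lt_neqAle c2 andbT; apply/eqP => cq.
by apply: Nc; right.
Qed.
Lemma level_proper t p q : 0 < t ->
  exists N, level t @^-1` `]p, q] `<=` `[- N, N]%classic.
Proof.
move=> t0; have [C C0 HC] := level_dist t; exists (`|p| + `|q| + C * t) => c /=.
rewrite !in_itv/= => /andP[pc cq]; have := HC t c t0 (lexx _); rewrite ler_norml => /andP[c1 c2].
have := ler_norm q; have := ler_norm (- p); rewrite normrN.
have := normr_ge0 p; have := normr_ge0 q.
by move: (level t c) (C * t) c1 c2 pc cq => l D *; apply/andP; split; lra.
Qed.

(** By [stieltjes_image], with the curves as parametrization. *)
Lemma carried_stieltjes t (psi : R -> R) (B L : R) : 0 < t -> continuous psi ->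
  (forall x, `|psi x| <= B) -> (forall x, L <= `|x| -> psi x = 0) ->
  stieltjes_integrable (carried ^~ t) (fun x => vel x t * psi x) /\
  stieltjes_integral (carried ^~ t) (fun x => vel x t * psi x) =
    \int[mu]_c (psi (level t c) * vel (level t c) t * rho c).
Proof.
move=> t0 cpsi psiB psiL; have [V HV] := vel_bounded t0.
have [|||H1 H2] := @stieltjes_image R (carried ^~ t) (level t) rho M (carried_BV_loc t0)
  (level_meas level_mono t0) rho_meas rhoM (fun p q => level_proper p q t0)
  (fun p q gp gq => @carried_right_diff t p q gp gq t0)
  (fun x => vel x t * psi x) (V * B) L.
- by apply: measurable_funM; [exact: vel_meas|exact: continuous_measurable_fun].
- by move=> x; rewrite normrM ler_pM.
- by move=> x Lx; rewrite psiL ?mulr0// ltW.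
split => //; rewrite H2; apply: eq_Rintegral => c _.
by rewrite [vel _ _ * _]mulrC.
Qed.

Variables (f : R -> R) (u : R -> R -> R).
Hypothesis u_vel : forall x t, 0 < t -> derive1 f (u x t) = vel x t.

Lemma carried_weak_solution : weak_solution f u carried (oint rho 0).
Proof.
split; [exact: carried_Linfty_loc|exact: carried_BV_loc| |exact: carried_initial].
move=> phi phiT; have [L [a [B [L0 a0 aL tl tlt]]]] := test_function_time_lipschitz phiT.
have dphi p : derivable phi p (0, 1).
  by case: phiT => Ck _ _; have [/(_ p)[]] := Ck 1%N.
have [Iflux Eflux] := weak_identity rho_meas rhoM ylow_mono level_le level_mono ylow_dist
  level_lipschitz level_deriv L0 a0 aL tl tlt (fun x t => slice_quotient_cvg (dphi (x, t))).
have S t : 0 < t ->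
    stieltjes_integrable (carried ^~ t) (fun x => derive1 f (u x t) * phi (x, t)) /\
    stieltjes_integral (carried ^~ t) (fun x => derive1 f (u x t) * phi (x, t)) =
      flux_integral level vel rho (fun x t => phi (x, t)) t.
  move=> t0; have -> : (fun x => derive1 f (u x t) * phi (x, t)) = (fun x => vel x t * phi (x, t)).
    by apply/funext => x; rewrite u_vel.
  exact: (carried_stieltjes t0 (tl_cont tl (t := t)) (fun x => tl_bound tl x t) (fun x => tl_space tl t)).
have LL : - L <= L by rewrite (le_trans _ L0)// oppr_le0.
split.
- by apply: nearW => t /S[].
- apply: (eq_integrable _ _ _ _ Iflux); first exact: measurable_itv.
  by move=> t; rewrite inE/= in_itv/= andbT => /S[_ ->].
- rewrite [X in X - _](_ : _ = \int[mu]_(t in `]0, +oo[) pairing ylow rho L (fun x t => 'D_(0, 1) phi (x, t)) t).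
    rewrite Eflux; apply/eqP; rewrite subr_eq0; apply/eqP.
    by apply: eq_Rintegral => t; rewrite inE/= in_itv/= andbT => /S[_ ->].
  apply: eq_Rintegral => t _; rewrite /pairing -(Rintegral_supp LL).
    by apply: eq_Rintegral => x _; rewrite mulrC.
  move=> x xL; rewrite (tl_space tlt) ?mul0r// leNgt; apply/negP => xL'.
  by apply: xL; move: xL'; rewrite ltr_norml => /andP[/ltW -> /ltW ->].
Qed.

End weak_solution_of_transport.

Theorem theorem5p4 (R : realType) (f alpha u0 rho0 : R -> R)
  (f_C2 : class_C2 f) (f_convex : strictly_convex f) (f_growth : superlinear f)
  (alpha_Linfty : Linfty (@lebesgue_measure R) `[0, +oo[ alpha)
  (u0_bounded : bounded_measurable u0)
  (rho0_bounded : bounded_measurable rho0) :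
  weak_solution f (ufun f alpha u0)
    (fun x t => oriented_integral rho0 0 (y_low f alpha u0 x t))
    (fun x => oriented_integral rho0 0 x).
Proof.
have [ga [Ma Ma0 [mga gaM gaE]]] := Linfty_version (measurable_itv `[0, +oo[) alpha_Linfty.
have [gu [M M0 [mgu guM guE]]] := bounded_measurable_version u0_bounded.
have [gr [Mr Mr0 [mgr grM grE]]] := bounded_measurable_version rho0_bounded.
have rhoE c : oriented_integral rho0 0 c = oriented_integral gr 0 c.
  by rewrite /oriented_integral !grE.
have -> : (fun x => oriented_integral rho0 0 x) = oriented_integral gr 0 by apply/funext.
have -> : (fun x t => oriented_integral rho0 0 (y_low f alpha u0 x t)) =
    carried (y_low f alpha u0) gr by apply/funext => x; apply/funext => t; exact: rhoE.
have dyn := characteristic_flow f_C2 f_convex f_growth mga gaM gaE.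
have hP t p := @drift_hfun _ _ _ _ _ f_C2 f_convex f_growth mga gaM gaE t p.
have UL := initial_lipschitz mgu guM guE.
have lowP := y_lowP f_C2 f_convex f_growth mga gaM gaE M0 mgu guM guE.
have uppP := y_uppP f_C2 f_convex f_growth mga gaM gaE M0 mgu guM guE.
apply: (@carried_weak_solution R (y_low f alpha u0) (level (y_low f alpha u0))
  (vel (speed f (beta alpha)) (cost f (beta alpha)) (fun t x => hfun f alpha x t)
    (y_low f alpha u0) (y_upp f alpha u0)) gr Mr).
- exact: mgr.
- exact: grM.
- by move=> t x1 x2; exact: (ylow_mono dyn hP lowP uppP).
- by move=> x t c; exact: (level_le dyn M0 UL hP lowP uppP).
- by move=> t c c'; exact: (level_mono dyn M0 UL hP lowP uppP).
- move=> T; have [C C0 HC] := min_dist dyn UL hP T; exists C => // x t t0 tT.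
  by apply: HC => //; exact: (lowP x t t0).1.
- exact: (level_dist dyn M0 UL hP lowP uppP).
- exact: (level_lipschitz dyn M0 UL hP lowP uppP).
- exact: (level_deriv dyn M0 UL hP lowP uppP).
- by move=> x t c; exact: (ylow_lsc dyn M0 UL hP lowP).
- exact: (vel_meas f_C2 f_convex f_growth mga gaM gaE M0 mgu guM guE).
- exact: (vel_bounded f_C2 f_convex f_growth mga gaM gaE M0 mgu guM guE).
- exact: (derive_ufun f_C2 f_convex f_growth mga gaM gaE M0 mgu guM guE).
Qed.
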